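(* Let $k$ be a field, $V$ a finite dimensional $k$-vector space, and $G$ a finite subgroup of $\mathrm{GL}(V)$ such that $|G|$ is invertible in $k$ and $k$ contains a primitive $|G|$-th root of $1$. Then $$H^{\bullet}(S(V)\#G)=\bigoplus_{\langle g\rangle\in\langle G\rangle}\left(S(V^g)\otimes\Lambda^{\bullet}\big((V^g)^{*}\big)\otimes \det|_{V_g}^{-1}[d_g]\right)^{\mathcal{Z}_g};$$ that is, for every $n$, $$H^{n}(S(V)\#G)\cong\bigoplus_{\langle g\rangle\in\langle G\rangle}\left(S(V^g)\otimes\Lambda^{n-d_g}\big((V^g)^{*}\big)\otimes \det|_{V_g}^{-1}\right)^{\mathcal{Z}_g}.$$
   Context: $S(V)$ is the symmetric algebra, with $G$ acting by algebra automorphisms extending its action on $V$, and $S(V)\#G$ is the crossed product (smash product with $k[G]$). For an algebra $B$, $H^{\bullet}(B)=\mathrm{Ext}^{\bullet}_{B^e}(B,B)$, $B^e=B\otimes_k B^{\mathrm{op}}$, is its Hochschild cohomology. $\langle G\rangle$ is the set of conjugacy classes of $G$, $\langle g\rangle$ the class of $g$, and $\mathcal{Z}_g$ the centralizer of $g$ in $G$. $V^g=\{x\in V : g(x)=x\}$, $V_g$ is the unique $g$-stable complement of $V^g$ in $V$ (so $V=V^g\oplus V_g$, and both summands are $\mathcal{Z}_g$-stable), and $d_g=\dim_k V_g$. $\det|_{V_g}^{-1}$ is the one-dimensional representation of $\mathcal{Z}_g$ on which $h$ acts as multiplication by $\det(h|_{V_g})^{-1}$. $\mathcal{Z}_g$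 acts on the tensor products diagonally, and the superscript $\mathcal{Z}_g$ denotes invariants. For a graded space $X$, $X[n]$ is $X$ with degree shifted by $n$, so that if $X$ is concentrated in degree $0$ then $X[n]$ is concentrated in degree $n$; here $S(V^g)$ and $\det|_{V_g}^{-1}$ are in degree $0$ and $\Lambda^p$ is in degree $p$. *)

(* Defs.v *)
From HB Require Import structures.
From mathcomp Require Import all_fingroup all_boot all_order all_algebra.
From mathcomp Require Import boolp classical_sets functions.
From mathcomp Require Import mpoly.

Set Implicit Arguments.
Unset Strict Implicit.
Unset Printing Implicit Defensive.

Import GRing.Theory.
Local Open Scope ring_scope.
Local Open Scope quotient_scope.

Section Submodules.
Variables (R : pzRingType) (V : lmodType R) (S : submodClosed V).

Definition submod : Type := {x : V | x \in S}.
HB.instance Definition _ := SubType.on submod.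
HB.instance Definition _ := [Choice of submod by <:].
HB.instance Definition _ := [SubChoice_isSubLmodule of submod by <:].

Lemma submod_val_eq0 (x : submod) : (val x = 0) <-> (x = 0).
Proof.
by split=> [x0|->]; [apply: val_inj; rewrite x0 raddf0 | rewrite raddf0].
Qed.

Definition submodz : {pred V} := S.
Fact submodz_closed : zmod_closed submodz.
Proof. exact/GRing.submod_closedB/submodClosedP. Qed.
HB.instance Definition _ := GRing.isZmodClosed.Build V submodz submodz_closed.

Definition qmod : Type := Quotient.quot submodz.
HB.instance Definition _ := GRing.Zmodule.on qmod.
Definition qpi (x : V) : qmod := \pi_(Quotient.quot submodz) x.

Lemma qpi_zmod : zmod_morphism qpi.
Proof. exact: raddfB. Qed.
HB.instance Definition _ := GRing.isZmodMorphism.Build V qmod qpi qpi_zmod.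

Lemma qpi_surj (q : qmod) : exists x, q = qpi x.
Proof. by exists (repr (q : Quotient.quot submodz)); rewrite /qpi reprK. Qed.

Lemma qpi_eq x y : (qpi x = qpi y) <-> (x - y \in S).
Proof.
rewrite -[_ \in S]/(x - y \in submodz) Quotient.idealrBE.
by split=> /eqP.
Qed.

Definition qscale (a : R) (q : qmod) : qmod :=
  qpi (a *: repr (q : Quotient.quot submodz)).

Lemma qscaleE a x : qscale a (qpi x) = qpi (a *: x).
Proof.
apply/qpi_eq; rewrite -scalerBr rpredZ //; apply/qpi_eq.
by rewrite /qpi reprK.
Qed.

Fact qscaleA a b q : qscale a (qscale b q) = qscale (a * b) q.
Proof. by have [x ->] := qpi_surj q; rewrite !qscaleE scalerA. Qed.
Fact qscale1 : left_id 1 qscale.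
Proof. by move=> q; have [x ->] := qpi_surj q; rewrite qscaleE scale1r. Qed.
Fact qscaleDr : right_distributive qscale +%R.
Proof.
move=> a q r; have [x ->] := qpi_surj q; have [y ->] := qpi_surj r.
by rewrite -raddfD !qscaleE scalerDr raddfD.
Qed.
Fact qscaleDl q : {morph qscale^~ q : a b / a + b}.
Proof.
by move=> a b; have [x ->] := qpi_surj q; rewrite !qscaleE scalerDl raddfD.
Qed.
HB.instance Definition _ :=
  GRing.Zmodule_isLmodule.Build R qmod qscaleA qscale1 qscaleDr qscaleDl.

Lemma qpi_scalable : scalable qpi.
Proof. by move=> a x; rewrite -qscaleE. Qed.
HB.instance Definition _ := GRing.isScalable.Build R V qmod *:%R qpi qpi_scalable.

End Submodules.

Section Kernel.
Variables (R : pzRingType) (U V : lmodType R) (f : {linear U -> V}).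
Definition ker_pred : {pred U} := fun x => f x == 0.
Fact ker_pred_closed : submod_closed ker_pred.
Proof.
split=> [|a x y]; rewrite ?unfold_in /ker_pred ?linear0 //.
by rewrite linearP => /eqP -> /eqP ->; rewrite scaler0 addr0.
Qed.
HB.instance Definition _ := GRing.isSubmodClosed.Build R U ker_pred ker_pred_closed.
End Kernel.

(* The R-module generated by the symbols [x], x : X, universal for the maps    *)
(* out of X that satisfy Phi: two formal combinations of symbols are equal iff *)
(* every map satisfying Phi, into any module, gives them the same value.  With *)
(* Phi trivial this is the free module on X; with Phi the bilinear, or the     *)
(* alternating multilinear, maps it is a tensor product, or exterior power.    *)
Section Universal.
Variables (R : pzRingType) (X : choiceType).
Variable Phi : forall Z : lmodType R, (X -> Z) -> Prop.
Implicit Types (s t u : seq (R * X)) (Z : lmodType R).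

Definition fsum Z (f : X -> Z) s : Z := \sum_(z <- s) z.1 *: f z.2.

Definition uequiv s t : bool :=
  `[< forall Z (f : X -> Z), Phi f -> fsum f s = fsum f t >].

Lemma uequivP s t :
  reflect (forall Z (f : X -> Z), Phi f -> fsum f s = fsum f t) (uequiv s t).
Proof. exact: asboolP. Qed.

Fact uequiv_is_equiv : equiv_class_of uequiv.
Proof.
split=> [s|s t|t s u]; first exact/uequivP.
- by apply/uequivP/uequivP=> h Z f /h.
- by move=> /uequivP h1 /uequivP h2; apply/uequivP=> Z f Pf; rewrite h1 ?h2.
Qed.
Canonical uequiv_equiv := EquivRelPack uequiv_is_equiv.
Canonical uequiv_encModRel := defaultEncModRel uequiv.

Definition umod : Type := {eq_quot uequiv}.
HB.instance Definition _ := Choice.on umod.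
Definition umk s : umod := \pi_({eq_quot uequiv}) s.
Definition urep (x : umod) : seq (R * X) := repr (x : {eq_quot uequiv}).

Lemma urepK x : umk (urep x) = x. Proof. exact: reprK. Qed.
Lemma umk_eq s t :
  umk s = umk t <-> (forall Z (f : X -> Z), Phi f -> fsum f s = fsum f t).
Proof.
split=> [/eqP|h]; first by rewrite piE => /uequivP.
by apply/eqP; rewrite piE; apply/uequivP.
Qed.
Lemma urep_umk s Z (f : X -> Z) : Phi f -> fsum f (urep (umk s)) = fsum f s.
Proof. by move: Z f; apply/umk_eq; rewrite urepK. Qed.

Lemma fsum_nil Z (f : X -> Z) : fsum f [::] = 0. Proof. exact: big_nil. Qed.
Lemma fsum_cat Z (f : X -> Z) s t : fsum f (s ++ t) = fsum f s + fsum f t.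
Proof. exact: big_cat. Qed.
Lemma fsum_scale Z (f : X -> Z) a s :
  fsum f [seq (a * z.1, z.2) | z <- s] = a *: fsum f s.
Proof.
by rewrite /fsum big_map scaler_sumr; apply: eq_bigr => z _; rewrite scalerA.
Qed.

Definition uadd x y := umk (urep x ++ urep y).
Definition uscale a x := umk [seq (a * z.1, z.2) | z <- urep x].
Definition uopp x := uscale (-1) x.

Let fsumE := (fsum_cat, fsum_scale, fsum_nil).
Fact uaddA : associative uadd.
Proof.
by move=> x y z; apply/umk_eq=> Z f Pf; rewrite !fsumE !urep_umk // !fsumE addrA.
Qed.
Fact uaddC : commutative uadd.
Proof. by move=> x y; apply/umk_eq=> Z f Pf; rewrite !fsumE addrC. Qed.
Fact uadd0 : left_id (umk [::]) uadd.
Proof.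
move=> x; rewrite -[RHS]urepK; apply/umk_eq=> Z f Pf.
by rewrite !fsumE urep_umk // fsumE add0r.
Qed.
Fact uaddN : left_inverse (umk [::]) uopp uadd.
Proof.
move=> x; apply/umk_eq=> Z f Pf; rewrite !fsumE urep_umk // fsumE.
by rewrite scaleN1r addNr.
Qed.
HB.instance Definition _ := GRing.isZmodule.Build umod uaddA uaddC uadd0 uaddN.

Fact uscaleA a b x : uscale a (uscale b x) = uscale (a * b) x.
Proof.
by apply/umk_eq=> Z f Pf; rewrite !fsumE urep_umk // !fsumE scalerA.
Qed.
Fact uscale1 : left_id 1 uscale.
Proof.
by move=> x; rewrite -[RHS]urepK; apply/umk_eq=> Z f Pf; rewrite fsumE scale1r.
Qed.
Fact uscaleDr : right_distributive uscale +%R.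
Proof.
move=> a x y; apply/umk_eq=> Z f Pf.
by rewrite !(fsumE, urep_umk) // scalerDr.
Qed.
Fact uscaleDl x : {morph uscale^~ x : a b / a + b}.
Proof.
move=> a b; apply/umk_eq=> Z f Pf.
by rewrite !(fsumE, urep_umk) // scalerDl.
Qed.
HB.instance Definition _ :=
  GRing.Zmodule_isLmodule.Build R umod uscaleA uscale1 uscaleDr uscaleDl.

Definition ugen (x : X) : umod := umk [:: (1, x)].

Definition ulift Z (f : X -> Z) (x : umod) : Z := fsum f (urep x).

Section Lift.
Variables (Z : lmodType R) (f : X -> Z) (Pf : Phi f).
Lemma ulift_linear : linear (ulift f).
Proof. by move=> a x y; rewrite /ulift !(fsumE, urep_umk). Qed.
Lemma uliftE x : ulift f (ugen x) = f x.
Proof. by rewrite /ulift urep_umk // /fsum big_seq1 scale1r. Qed.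
Definition ulin : umod -> Z := let _ := Pf in ulift f.
HB.instance Definition _ :=
  GRing.isSemilinear.Build R umod Z *:%R ulin
    (GRing.semilinear_linear ulift_linear).
Lemma ulinE x : ulin (ugen x) = f x. Proof. exact: uliftE. Qed.
End Lift.

Lemma ugen_lin a x y z :
  (forall Z (f : X -> Z), Phi f -> f z = a *: f x + f y) ->
  ugen z = a *: ugen x + ugen y.
Proof.
move=> h; apply/umk_eq => Z f Pf; rewrite !(fsumE, urep_umk) // /fsum !big_seq1.
by rewrite /= !scale1r h.
Qed.

Lemma ugen_eq0 x :
  (forall Z (f : X -> Z), Phi f -> f x = 0) -> ugen x = 0.
Proof.
by move=> h; apply/umk_eq => Z f Pf; rewrite fsumE /fsum big_seq1 h // scaler0.
Qed.

Lemma umkE s : umk s = \sum_(z <- s) z.1 *: ugen z.2.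
Proof.
elim: s => [|[a x] s IHs]; first by rewrite big_nil.
rewrite big_cons -IHs /=; apply/umk_eq=> Z f Pf.
rewrite !(fsumE, urep_umk) // /fsum big_cons /=; congr (_ + _).
by rewrite big_seq1 /= scale1r.
Qed.

Lemma umod_ind (P : umod -> Prop) :
  P 0 -> (forall a x y, P y -> P (a *: ugen x + y)) -> forall x, P x.
Proof.
move=> P0 PD x; rewrite -[x]urepK umkE.
by elim: (urep x) => [|z s IHs]; rewrite ?big_nil ?big_cons //; apply: PD.
Qed.

Lemma umod_ext Z (f g : {linear umod -> Z}) :
  (forall x, f (ugen x) = g (ugen x)) -> f =1 g.
Proof.
move=> fg; elim/umod_ind=> [|a x y IH]; first by rewrite !linear0.
by rewrite !linearP fg IH.
Qed.

End Universal.

Section FreeModule.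
Variable R : pzRingType.

Definition freemod (X : choiceType) : lmodType R :=
  umod (fun (Z : lmodType R) (_ : X -> Z) => True).

Variable M : lmodType R.
Definition free_counit : {linear freemod M -> M} :=
  @ulin R M (fun (Z : lmodType R) (_ : M -> Z) => True) M id I.

End FreeModule.

(* The functorial free resolution                                              *)
(*   ... -> freemod (syzygy M 1) -> freemod (syzygy M 0) -> M -> 0             *)
(* where syzygy M 0 = M and syzygy M n.+1 is the kernel of the tautological    *)
(* surjection freemod (syzygy M n) -> syzygy M n.                              *)
Section StandardResolution.
Variables (R : pzRingType) (M : lmodType R).

Fixpoint syzygy (n : nat) : lmodType R :=
  if n is n'.+1 then submod (ker_pred (free_counit (syzygy n'))) else M.

Definition stdres (n : nat) : lmodType R := freemod R (syzygy n).

Definition stdres_aug : {linear stdres 0 -> M} := free_counit M.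

Definition stdres_d (n : nat) : {linear stdres n.+1 -> stdres n} :=
  (val : submod (ker_pred (free_counit (syzygy n))) -> _)
    \o free_counit (syzygy n.+1).

End StandardResolution.

Definition projective (R : pzRingType) (P : lmodType R) : Prop :=
  forall (U W : lmodType R) (p : {linear U -> W}) (f : {linear P -> W}),
    (forall w, exists u, p u = w) -> exists g : {linear P -> U}, p \o g =1 f.

Section StandardResolutionTheory.
Variable R : pzRingType.

Lemma free_projective (X : choiceType) : projective (freemod R X).
Proof.
move=> U W p f p_surj.
have [h hE] := choice (fun x : X => p_surj (f (ugen _ x))).
exists (@ulin R X (fun (Z : lmodType R) (_ : X -> Z) => True) U h I).
by apply: (umod_ext (f := p \o _)) => x /=; rewrite ulinE hE.
Qed.

Lemma free_counit_surj (M : lmodType R) (m : M) : exists x, free_counit M x = m.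
Proof. by exists (ugen _ m); rewrite /free_counit /= ulinE. Qed.

Lemma free_counit_exact (N : lmodType R) (x : freemod R N) :
  free_counit N x = 0 <->
  exists y : freemod R (submod (ker_pred (free_counit N))),
    x = val (free_counit (submod (ker_pred (free_counit N))) y).
Proof.
split=> [x0|[y ->]].
  have kx : x \in ker_pred (free_counit N) by apply/eqP.
  have [y yE] := free_counit_surj (Sub x kx : submod (ker_pred (free_counit N))).
  by exists y; rewrite yE.
exact/eqP/(valP (free_counit (submod (ker_pred (free_counit N))) y)).
Qed.

Variable M : lmodType R.

Lemma stdres_projective n : projective (stdres M n).
Proof. exact: free_projective. Qed.

Lemma stdres_exact_aug (x : stdres M 0) :
  stdres_aug M x = 0 <-> exists y, x = stdres_d M 0 y.
Proof. exact: free_counit_exact. Qed.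

Lemma stdres_exact n (x : stdres M n.+1) :
  stdres_d M n x = 0 <-> exists y, x = stdres_d M n.+1 y.
Proof.
have d0 : (stdres_d M n x = 0) <-> (free_counit (syzygy M n.+1) x = 0).
  exact: submod_val_eq0.
exact: (iff_trans d0 (free_counit_exact (N := syzygy M n.+1) x)).
Qed.

End StandardResolutionTheory.

(* Cohomology of a cochain complex C 0 -> C 1 -> ... of modules.               *)
Section Cohomology.
Variables (R : pzRingType) (C : nat -> lmodType R).
Variable delta : forall n, {linear C n -> C n.+1}.

Definition cocycles n : lmodType R := submod (ker_pred (delta n)).

Definition coboundary n : C n -> Prop :=
  match n with
  | 0 => fun x => x = 0
  | m.+1 => fun x => exists y, x = delta m y
  end.

Definition coboundaries n : {pred cocycles n} :=
  fun x => `[< coboundary (val x) >].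

Fact coboundaries_closed n : submod_closed (@coboundaries n).
Proof.
rewrite /coboundaries; split=> [|a x y]; rewrite ?unfold_in.
  by apply/asboolP; case: n => //= n; exists 0; rewrite linear0.
move=> /asboolP bx /asboolP; move: bx; case: n x y => [|n] x y /=.
  by move=> x0 y0; apply/asboolP; rewrite /= x0 y0 scaler0 addr0.
move=> [u xE] [v yE]; apply/asboolP; exists (a *: u + v).
by rewrite linearP -xE -yE.
Qed.
HB.instance Definition _ n :=
  GRing.isSubmodClosed.Build R (cocycles n) (@coboundaries n)
    (@coboundaries_closed n).

Definition cohomology n : lmodType R := qmod (@coboundaries n).

End Cohomology.

(* An E-module over a k-algebra E, seen as a k-module.                         *)
Section RestrictScalars.
Variables (k : comNzRingType) (E : algType k) (N : lmodType E).
Definition resk : Type := N.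
HB.instance Definition _ := GRing.Zmodule.on resk.
Definition resk_scale (c : k) (x : resk) : resk := c%:A *: (x : N).
Fact resk_scaleA a b x : resk_scale a (resk_scale b x) = resk_scale (a * b) x.
Proof. by rewrite /resk_scale scalerA mulr_algl scalerA. Qed.
Fact resk_scale1 : left_id 1 resk_scale.
Proof. by move=> x; rewrite /resk_scale !scale1r. Qed.
Fact resk_scaleDr : right_distributive resk_scale +%R.
Proof. by move=> a x y; rewrite /resk_scale scalerDr. Qed.
Fact resk_scaleDl x : {morph resk_scale^~ x : a b / a + b}.
Proof. by move=> a b; rewrite /resk_scale !scalerDl. Qed.
HB.instance Definition _ := GRing.Zmodule_isLmodule.Build k resk
  resk_scaleA resk_scale1 resk_scaleDr resk_scaleDl.
End RestrictScalars.

Section HomComplex.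
Variables (k : comNzRingType) (E : algType k).

Section HomModule.
Variables (P N : lmodType E).
Definition hom_pred : {pred P -> resk N} := fun f => `[< linear (f : P -> N) >].
Fact hom_closed : submod_closed hom_pred.
Proof.
split=> [|c f g]; rewrite ?unfold_in /hom_pred.
  by apply/asboolP => a x y; rewrite /= scaler0 addr0.
move=> /asboolP lf /asboolP lg; apply/asboolP => a x y.
have fE z : (c *: f + g) z = c%:A *: (f z : N) + g z by [].
rewrite !fE lf lg !scalerDr !scalerA mulr_algl mulr_algr.
by rewrite addrACA.
Qed.
HB.instance Definition _ :=
  GRing.isSubmodClosed.Build k (P -> resk N) hom_pred hom_closed.
Definition hommod : lmodType k := submod hom_pred.
Definition hom_fun (f : hommod) : P -> N := val f.
Lemma hom_funP (f : hommod) : linear (hom_fun f).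
Proof. exact: (asboolW (valP f)). Qed.
End HomModule.

Section Precomposition.
Variables (P Q N : lmodType E) (d : {linear Q -> P}).
Fact precomp_subproof (f : hommod P N) :
  (fun x => hom_fun f (d x) : resk N) \in @hom_pred Q N.
Proof. by apply/asboolP => a x y; rewrite linearP hom_funP. Qed.
Definition precomp (f : hommod P N) : hommod Q N :=
  exist (fun g : Q -> resk N => g \in @hom_pred Q N)
    (fun x => hom_fun f (d x)) (precomp_subproof f).
Fact precomp_linear : linear precomp.
Proof. by move=> c f g; apply: val_inj. Qed.
HB.instance Definition _ :=
  GRing.isSemilinear.Build k (hommod P N) (hommod Q N) *:%R precomp
    (GRing.semilinear_linear precomp_linear).
End Precomposition.
Arguments precomp [P Q] N d f.

(* Computed on the standard free resolution of M; by the lemmas stdres_* above *)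
(* it is a projective resolution.                                              *)
Definition Ext (M N : lmodType E) (n : nat) : lmodType k :=
  cohomology (fun n => precomp N (stdres_d M n)) n.

End HomComplex.

Section Tensor.
Variable k : comNzRingType.

Definition bilin (U W Z : lmodType k) (f : U * W -> Z) : Prop :=
  (forall w, linear (fun u => f (u, w))) /\ (forall u, linear (fun w => f (u, w))).

Definition tensor (U W : lmodType k) : lmodType k :=
  umod (@bilin U W).

Section TensorTheory.
Variables U W : lmodType k.

Definition tens (u : U) (w : W) : tensor U W := ugen (@bilin U W) (u, w).

Fact tens_bilin : bilin (fun p => tens p.1 p.2).
Proof.
by split=> x a y z; apply: ugen_lin => Z f [fl fr]; rewrite ?fl ?fr.
Qed.

Lemma tensDl u1 u2 w : tens (u1 + u2) w = tens u1 w + tens u2 w.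
Proof. by have /= := tens_bilin.1 w 1 u1 u2; rewrite !scale1r. Qed.
Lemma tensDr u w1 w2 : tens u (w1 + w2) = tens u w1 + tens u w2.
Proof. by have /= := tens_bilin.2 u 1 w1 w2; rewrite !scale1r. Qed.
Lemma tens0l w : tens 0 w = 0.
Proof. by apply: (addrI (tens 0 w)); rewrite -tensDl !addr0. Qed.
Lemma tens0r u : tens u 0 = 0.
Proof. by apply: (addrI (tens u 0)); rewrite -tensDr !addr0. Qed.
Lemma tensZl a u w : tens (a *: u) w = a *: tens u w.
Proof. by have /= := tens_bilin.1 w a u 0; rewrite !addr0 tens0l addr0. Qed.
Lemma tensZr a u w : tens u (a *: w) = a *: tens u w.
Proof. by have /= := tens_bilin.2 u a w 0; rewrite !addr0 tens0r addr0. Qed.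

Lemma tens_ind (P : tensor U W -> Prop) :
  P 0 -> (forall u w x, P x -> P (tens u w + x)) -> forall x, P x.
Proof.
move=> P0 PD; apply: umod_ind => // a [u w] x Px.
by rewrite -[ugen _ _]/(tens u w) -tensZl; apply: PD.
Qed.

Lemma tens_ext (Z : lmodType k) (f g : {linear tensor U W -> Z}) :
  (forall u w, f (tens u w) = g (tens u w)) -> f =1 g.
Proof. by move=> fg; apply: umod_ext => -[u w]; apply: fg. Qed.

Section TensorLift.
Variables (Z : lmodType k) (f : U -> W -> Z).
Hypothesis f_bilin : bilin (fun p : U * W => f p.1 p.2).
Definition tens_lift : {linear tensor U W -> Z} := ulin f_bilin.
Lemma tens_liftE u w : tens_lift (tens u w) = f u w.
Proof. by rewrite /tens_lift /= ulinE. Qed.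
End TensorLift.
#[global] Arguments tens_lift : simpl never.

End TensorTheory.

Section TensorMap.
Variables (U U' W W' : lmodType k) (f : {linear U -> U'}) (g : {linear W -> W'}).
Fact tens_map_bilin : bilin (fun p : U * W => tens (f p.1) (g p.2)).
Proof. by split=> x a y z /=; rewrite linearP ?(tensDl, tensDr) ?(tensZl, tensZr). Qed.
Definition tens_map : {linear tensor U W -> tensor U' W'} :=
  tens_lift (f := fun u w => tens (f u) (g w)) tens_map_bilin.
Lemma tens_mapE u w : tens_map (tens u w) = tens (f u) (g w).
Proof. exact: tens_liftE. Qed.
End TensorMap.
#[global] Arguments tens_map : simpl never.

End Tensor.

Section LinearFunctional.
Variables (k : fieldType) (A : lmodType k) (e : A).
Hypothesis e_neq0 : e != 0.

Lemma functional_exists : exists f : {linear A -> k^o}, f e = 1.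
Proof.
pose P (S : set A) := ~ S e /\ forall c x y, S x -> S y -> S (c *: x + y).
have [|S [[Se SL] Smax]] := @Zorn_bigcup A P.
  move=> F FP Ftot; split=> [[S FS] /(proj1 (FP _ FS))//|].
  move=> c x y [S1 FS1 S1x] [S2 FS2 S2y].
  have [S12|S21] := Ftot _ _ FS1 FS2.
    by exists S2 => //; apply: (proj2 (FP _ FS2)) => //; apply: S12.
  by exists S1 => //; apply: (proj2 (FP _ FS1)) => //; apply: S21.
have S0 : S 0.
  apply: contrapT => nS0; apply: (Smax (fun x => S x \/ x = 0)).
    split; last by move=> /(_ 0); apply: contra_not nS0; apply; right.
    by move=> x; left.
  split=> [[//|/eqP]|]; first by rewrite (negPf e_neq0).
  move=> c x y [Sx|->] [Sy|->]; rewrite ?scaler0 ?addr0 ?add0r; [left|left|left|right] => //.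
    exact: SL.
  have := SL (-1) x x Sx Sx; rewrite scaleN1r addNr => ?.
  by rewrite -[_ *: _]addr0; apply: SL.
have dec a : exists c, S (a - c *: e).
  have [Sa|nSa] := pselect (S a); first by exists 0; rewrite scale0r subr0.
  pose Sa x := exists2 s, S s & exists c, x = s + c *: a.
  have /existsNP : ~ forall s c, S s -> e <> s + c *: a.
    move=> ne; apply: (Smax Sa).
      split; first by move=> x Sx; exists x => //; exists 0; rewrite scale0r addr0.
      by move=> /(_ a) h; apply: nSa; apply: h; exists 0 => //; exists 1; rewrite scale1r add0r.
    split=> [[s Ss [c]]|]; first exact: ne.
    move=> c _ _ [s Ss [d ->]] [t St [d' ->]]; exists (c *: s + t); first exact: SL.
    by exists (c * d + d'); rewrite scalerDr scalerDl scalerA addrACA.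
  move=> [s /existsNP[c /not_implyP[Ss /contrapT eE]]].
  have c0 : c != 0.
    by apply: contra_notN Se => /eqP c0; rewrite eE c0 scale0r addr0.
  exists c^-1; rewrite {1}eE scalerDr scalerA mulVf // scale1r opprD addrCA subrr.
  by rewrite addr0 -scaleNr -[_ *: s]addr0; apply: SL.
have [f fE] := choice dec.
have f_uniq a c : S (a - c *: e) -> c = f a.
  move=> Sc; apply/eqP; apply: contra_notT Se => neq.
  have d0 : f a - c != 0 by rewrite subr_eq0 eq_sym.
  have := SL (-1) _ _ (fE a) Sc; rewrite scaleN1r opprB addrA subrK -scalerBl.
  by move=> /(SL (f a - c)^-1 _ 0)/(_ S0); rewrite addr0 scalerA mulVf // scale1r.
have f_lin : linear (f : A -> k^o).
  move=> c x y; apply/esym/f_uniq; have := SL c _ _ (fE x) (fE y).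
  by rewrite scalerBr scalerDl scalerA addrACA opprD.
pose fL := GRing.isSemilinear.Build k A k^o *:%R (f : A -> k^o)
  (GRing.semilinear_linear f_lin).
pose F : {linear A -> k^o} := HB.pack (f : A -> k^o) fL.
by exists F; apply/esym/f_uniq; rewrite scale1r subrr.
Qed.
End LinearFunctional.

Section TensorAlgebra.
Variables (k : fieldType) (A B : algType k).

Section LeftMul.
Variables (C : algType k) (a : C).
Definition lmul (x : C) : C := a * x.
Fact lmul_linear : linear lmul.
Proof. by move=> c x y; rewrite /lmul mulrDr scalerAr. Qed.
HB.instance Definition _ :=
  GRing.isSemilinear.Build k C C *:%R lmul (GRing.semilinear_linear lmul_linear).
End LeftMul.

Let T : lmodType k := tensor A B.

Definition tmul_gen (a : A) (b : B) : {linear T -> T} := tens_map (lmul a) (lmul b).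

Lemma tmul_genE a b u w : tmul_gen a b (tens u w) = tens (a * u) (b * w).
Proof. exact: tens_mapE. Qed.
Fact tmul_genl c a1 a2 b y :
  tmul_gen (c *: a1 + a2) b y = c *: tmul_gen a1 b y + tmul_gen a2 b y.
Proof.
elim/tens_ind: y => [|u w y IH]; first by rewrite !linear0 addr0.
rewrite !linearD IH !tmul_genE mulrDl -scalerAl tensDl tensZl.
by rewrite addrACA.
Qed.
Fact tmul_genr c a b1 b2 y :
  tmul_gen a (c *: b1 + b2) y = c *: tmul_gen a b1 y + tmul_gen a b2 y.
Proof.
elim/tens_ind: y => [|u w y IH]; first by rewrite !linear0 addr0.
rewrite !linearD IH !tmul_genE mulrDl -scalerAl tensDr tensZr.
by rewrite addrACA.
Qed.
Fact tmul_bilin (y : T) : bilin (fun p : A * B => tmul_gen p.1 p.2 y).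
Proof. by split=> x c y1 y2; [apply: tmul_genl | apply: tmul_genr]. Qed.

Definition tmul (x y : T) : T :=
  tens_lift (f := fun a b => tmul_gen a b y) (tmul_bilin y) x.

Lemma tmulE a b a' b' : tmul (tens a b) (tens a' b') = tens (a * a') (b * b').
Proof. by rewrite /tmul tens_liftE tens_mapE. Qed.
Lemma tmul_tens a b y : tmul (tens a b) y = tmul_gen a b y.
Proof. by rewrite /tmul tens_liftE. Qed.

Fact tmulDl : left_distributive tmul +%R.
Proof. by move=> x y z; rewrite /tmul linearD. Qed.
Fact tmulDr : right_distributive tmul +%R.
Proof.
move=> x y z; elim/tens_ind: x => [|u w x IH]; first by rewrite /tmul !linear0 addr0.
by rewrite !tmulDl IH !tmul_tens linearD addrACA.
Qed.
Fact tmul0x x : tmul 0 x = 0. Proof. by rewrite /tmul linear0. Qed.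
Fact tmulx0 x : tmul x 0 = 0.
Proof. by apply: (addrI (tmul x 0)); rewrite -tmulDr !addr0. Qed.
Fact tmulA : associative tmul.
Proof.
move=> x y z; elim/tens_ind: x => [|a b x IHx]; first by rewrite !tmul0x.
rewrite !tmulDl IHx; congr (_ + _); clear x IHx.
elim/tens_ind: y => [|a' b' y IHy]; first by rewrite tmul0x !tmulx0 tmul0x.
rewrite tmulDl !tmulDr tmulDl IHy; congr (_ + _); clear y IHy.
elim/tens_ind: z => [|a'' b'' z IHz]; first by rewrite !tmulx0.
by rewrite !tmulDr IHz !tmulE !mulrA.
Qed.
Fact tmul1x : left_id (tens 1 1) tmul.
Proof.
elim/tens_ind=> [|a b x IHx]; first by rewrite tmulx0.
by rewrite tmulDr IHx tmulE !mul1r.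
Qed.
Fact tmulx1 : right_id (tens 1 1) tmul.
Proof.
elim/tens_ind=> [|a b x IHx]; first by rewrite tmul0x.
by rewrite tmulDl IHx tmulE !mulr1.
Qed.
Fact tens1_neq0 : tens (1 : A) (1 : B) != 0.
Proof.
have [f f1] := functional_exists (oner_neq0 A).
have [g g1] := functional_exists (oner_neq0 B).
have fg_bilin : bilin (fun p : A * B => f p.1 * g p.2 : k^o).
  split=> x c y z; rewrite /= linearP ?mulrDl ?mulrDr; congr (_ + _).
    by rewrite -mulrA.
  by rewrite mulrCA.
apply/eqP => /(congr1 (tens_lift (f := fun a b => f a * g b : k^o) fg_bilin)).
rewrite tens_liftE f1 g1 linear0 mulr1 => /eqP.
by rewrite oner_eq0.
Qed.

Definition talg : Type := tensor A B.
HB.instance Definition _ := GRing.Lmodule.on talg.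
HB.instance Definition _ := GRing.Zmodule_isNzRing.Build talg
  tmulA tmul1x tmulx1 tmulDl tmulDr tens1_neq0.
Fact tmul_scaleAl (c : k) (x y : talg) : c *: (x * y) = (c *: x) * y.
Proof. by rewrite /GRing.mul /= /tmul linearZ. Qed.
HB.instance Definition _ := GRing.Lmodule_isLalgebra.Build k talg tmul_scaleAl.
Fact tmul_scaleAr (c : k) (x y : talg) : c *: (x * y) = x * (c *: y).
Proof.
elim/tens_ind: x => [|a b x IHx]; first by rewrite !mul0r scaler0.
rewrite !mulrDl scalerDr IHx; congr (_ + _).
by rewrite /GRing.mul /= !tmul_tens linearZ.
Qed.
HB.instance Definition _ := GRing.Lalgebra_isAlgebra.Build k talg tmul_scaleAr.

End TensorAlgebra.

Section Opposite.
Variables (k : fieldType) (B : algType k).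
HB.instance Definition _ := GRing.Lmodule.copy B^c B.
Fact opp_scaleAl (c : k) (x y : B^c) : c *: (x * y) = (c *: x : B^c) * y.
Proof. exact: (@scalerAr k B c y x). Qed.
HB.instance Definition _ := GRing.Lmodule_isLalgebra.Build k B^c opp_scaleAl.
Fact opp_scaleAr (c : k) (x y : B^c) : c *: (x * y) = x * (c *: y : B^c).
Proof. exact: (@scalerAl k B c y x). Qed.
HB.instance Definition _ := GRing.Lalgebra_isAlgebra.Build k B^c opp_scaleAr.
End Opposite.

Section Hochschild.
Variables (k : fieldType) (B : algType k).

Definition envalg : algType k := talg B B^c.

Definition bimod : Type := B.
HB.instance Definition _ := GRing.Zmodule.on bimod.

Fact bimod_bilin (x : B) : bilin (fun p : B * B^c => p.1 * x * (p.2 : B)).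
Proof.
split=> y c a b /=; first by rewrite !mulrDl -!scalerAl.
by rewrite mulrDr scalerAr.
Qed.

Definition bimod_scale (t : envalg) (x : bimod) : bimod :=
  tens_lift (f := fun (a : B) (b : B^c) => a * (x : B) * (b : B) : B)
    (bimod_bilin x) t.

Lemma bimod_scaleE (a : B) (b : B^c) (x : B) :
  bimod_scale (tens a b) x = a * x * (b : B).
Proof. by rewrite /bimod_scale tens_liftE. Qed.

Fact bimod_scaleDl x : {morph bimod_scale^~ x : s t / s + t}.
Proof. by move=> s t; rewrite /bimod_scale linearD. Qed.
Fact bimod_scale0 x : bimod_scale 0 x = 0.
Proof. by rewrite /bimod_scale linear0. Qed.
Fact bimod_scaleDr : right_distributive bimod_scale +%R.
Proof.
move=> t x y; elim/tens_ind: t => [|a b t IH]; first by rewrite !bimod_scale0 addr0.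
by rewrite !bimod_scaleDl IH !bimod_scaleE mulrDr mulrDl addrACA.
Qed.
Fact bimod_scale1 : left_id 1 bimod_scale.
Proof. by move=> x; rewrite bimod_scaleE mulr1 mul1r. Qed.
Fact bimod_scalex0 t : bimod_scale t 0 = 0.
Proof. by apply: (addrI (bimod_scale t 0)); rewrite -bimod_scaleDr !addr0. Qed.
Fact bimod_scaleA s t x :
  bimod_scale s (bimod_scale t x) = bimod_scale (s * t) x.
Proof.
elim/tens_ind: s => [|a b s IHs]; first by rewrite mul0r !bimod_scale0.
rewrite mulrDl !bimod_scaleDl IHs; congr (_ + _); clear s IHs.
elim/tens_ind: t => [|a' b' t IHt].
  by rewrite mulr0 !bimod_scale0 bimod_scalex0.
rewrite mulrDr !bimod_scaleDl bimod_scaleDr IHt; congr (_ + _).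
by rewrite [_ * _ in RHS]tmulE !bimod_scaleE !mulrA.
Qed.
HB.instance Definition _ := GRing.Zmodule_isLmodule.Build envalg bimod
  bimod_scaleA bimod_scale1 bimod_scaleDr bimod_scaleDl.

Definition HH (n : nat) : lmodType k := Ext (E := envalg) bimod bimod n.

End Hochschild.

Local Notation dimv V := (\dim (fullv : {vspace V})).

(* S(W), as polynomials in the coordinates with respect to a basis of W.       *)
Section SymmetricAlgebra.
Variable k : fieldType.

Definition sym (W : vectType k) : comAlgType k := {mpoly k[dimv W]}.

Definition sym_in (W : vectType k) (w : W) : sym W :=
  \sum_i coord (vbasis fullv) i w *: 'X_i.

Fact sym_in_linear (W : vectType k) : linear (@sym_in W).
Proof.
move=> a x y; rewrite /sym_in scaler_sumr -big_split /=.
by apply: eq_bigr => i _; rewrite linearP scalerDl scalerA.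
Qed.
HB.instance Definition _ (W : vectType k) :=
  GRing.isSemilinear.Build k W (sym W) *:%R (@sym_in W)
    (GRing.semilinear_linear (@sym_in_linear W)).

Lemma sym_inX (W : vectType k) (i : 'I_(dimv W)) :
  sym_in (vbasis (fullv : {vspace W}))`_i = 'X_i.
Proof.
rewrite /sym_in (bigD1 i) //= big1 ?addr0 => [|j ji].
  by rewrite coord_free ?eqxx ?scale1r ?(basis_free (vbasisP _)).
rewrite coord_free ?(basis_free (vbasisP _)) //.
by rewrite eq_sym (negPf ji) scale0r.
Qed.

Lemma sym_ext (W : vectType k) (A : comAlgType k) (f g : {lrmorphism sym W -> A}) :
  (forall w, f (sym_in w) = g (sym_in w)) -> f =1 g.
Proof.
move=> fg p; rewrite [p]mpolyE !linear_sum; apply: eq_bigr => m _.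
rewrite !linearZ; congr (_ *: _); rewrite mpolyXE_id !rmorph_prod.
by apply: eq_bigr => i _; rewrite !rmorphXn /= -sym_inX fg.
Qed.

(* The algebra morphism S(U) -> S(W) extending f : U -> W.                     *)
Definition sym_map (U W : vectType k) (f : 'Hom(U, W)) : sym U -> sym W :=
  comp_mpoly [tuple sym_in (f (vbasis fullv)`_i) | i < dimv U].
HB.instance Definition _ (U W : vectType k) (f : 'Hom(U, W)) :=
  GRing.LRMorphism.copy (sym_map f)
    (comp_mpoly [tuple sym_in (f (vbasis fullv)`_i) | i < dimv U]).

Lemma sym_map_in (U W : vectType k) (f : 'Hom(U, W)) (u : U) :
  sym_map f (sym_in u) = sym_in (f u).
Proof.
rewrite [u in RHS](coord_vbasis (memvf u)) {1}/sym_in !linear_sum.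
apply: eq_bigr => i _; rewrite !linearZ; congr (_ *: _).
rewrite /= /sym_map comp_mpolyXU.
have := tnth_nth 0 [tuple sym_in (f (vbasis fullv)`_j) | j < dimv U] i.
by rewrite tnth_mktuple => <-.
Qed.

Lemma sym_map_id (W : vectType k) : sym_map (\1%VF : 'End(W)) =1 id.
Proof.
apply: (@sym_ext W (sym W) (sym_map _) idfun) => w /=.
by rewrite sym_map_in lfunE.
Qed.

Lemma sym_map_comp (U V W : vectType k) (f : 'Hom(V, W)) (g : 'Hom(U, V)) :
  sym_map (f \o g)%VF =1 sym_map f \o sym_map g.
Proof.
apply: (@sym_ext U (sym W) (sym_map _) (sym_map f \o sym_map g)) => u /=.
by rewrite !sym_map_in lfunE.
Qed.

End SymmetricAlgebra.

Section ExteriorPower.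
Variable k : comNzRingType.

Section Power.
Variables (W : lmodType k) (p : nat).

Definition upd (w : {ffun 'I_p -> W}) (i : 'I_p) (x : W) : {ffun 'I_p -> W} :=
  [ffun j => if j == i then x else w j].

Definition altmul (Z : lmodType k) (f : {ffun 'I_p -> W} -> Z) : Prop :=
  (forall w i, linear (fun x => f (upd w i x))) /\
  (forall (w : {ffun 'I_p -> W}) i j, i != j -> w i = w j -> f w = 0).

Definition extpow : lmodType k := umod altmul.

Definition wedge (w : {ffun 'I_p -> W}) : extpow := ugen altmul w.

Lemma wedge_alt : altmul wedge.
Proof.
split=> [w i a x y|w i j ij wij]; first by apply: ugen_lin => Z f [fl _]; rewrite fl.
by apply: ugen_eq0 => Z f [_ fa]; apply: fa ij wij.
Qed.

Section ExtLift.
Variables (Z : lmodType k) (f : {ffun 'I_p -> W} -> Z) (f_alt : altmul f).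
Definition ext_lift : {linear extpow -> Z} := ulin f_alt.
Lemma ext_liftE w : ext_lift (wedge w) = f w.
Proof. by rewrite /ext_lift /= ulinE. Qed.
End ExtLift.

End Power.

Section ExtMap.
Variables (U W : lmodType k) (p : nat) (f : {linear U -> W}).
Fact ext_map_alt : altmul (fun w : {ffun 'I_p -> U} => wedge [ffun i => f (w i)]).
Proof.
have updE w i x : [ffun j => f (upd w i x j)] = upd [ffun j => f (w j)] i (f x).
  by apply/ffunP => j; rewrite !ffunE; case: eqP.
split=> [w i a x y|w i j ij wij].
  by rewrite !updE linearP (wedge_alt _ _).1.
by apply: (wedge_alt _ _).2 ij _; rewrite !ffunE wij.
Qed.
Definition ext_map : {linear extpow U p -> extpow W p} := ext_lift ext_map_alt.
Lemma ext_mapE w : ext_map (wedge w) = wedge [ffun i => f (w i)].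
Proof. exact: ext_liftE. Qed.
End ExtMap.

(* Exterior powers of arbitrary integer degree, zero in negative degrees.      *)
Definition extpowz (W : lmodType k) (p : int) : lmodType k :=
  match p with Posz p => extpow W p | Negz _ => 'rV[k]_0 end.

Definition extz_map (U W : lmodType k) (f : {linear U -> W}) (p : int) :
    {linear extpowz U p -> extpowz W p} :=
  match p with Posz p => ext_map p f | Negz _ => idfun end.

End ExteriorPower.
#[global] Arguments ext_map [k U W] p f.

Section Representation.
Variables (k : fieldType) (V : vectType k) (gT : finGroupType).

(* A linear left action; finite subgroups of GL(V) are the injective ones.     *)
Record linrep : Type := LinRep {
  rep_fun :> gT -> 'End(V);
  rep_fun1 : rep_fun 1%g = \1%VF;
  rep_funM : forall g h, rep_fun (g * h)%g = (rep_fun g \o rep_fun h)%VF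
}.

End Representation.

(* S(V) # G: an element x stands for the sum of the x g # g over g : gT, and   *)
(* (a # g) (b # h) = a g(b) # g h.                                             *)
Section Smash.
Variables (k : fieldType) (V : vectType k) (gT : finGroupType).
Variable rho : linrep V gT.
Implicit Types (x y z : {ffun gT -> sym V}) (g h : gT).

Definition smash_one : {ffun gT -> sym V} := [ffun g => (g == 1%g)%:R].
Definition smash_mul x y : {ffun gT -> sym V} :=
  [ffun g => \sum_h x h * sym_map (rho h) (y (h^-1 * g)%g)].

Fact smash_mulA : associative smash_mul.
Proof.
move=> x y z; apply/ffunP => g; rewrite !ffunE.
under eq_bigr => l _ do rewrite ffunE linear_sum mulr_sumr.
under [RHS]eq_bigr => h _ do rewrite ffunE mulr_suml.
rewrite [RHS]exchange_big /=; apply: eq_bigr => l _.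
rewrite [RHS](reindex_inj (mulgI l)) /=; apply: eq_bigr => m _.
rewrite mulKg invMg -mulgA rep_funM sym_map_comp /= rmorphM mulrA.
by rewrite mulgA.
Qed.

Fact smash_mul1x : left_id smash_one smash_mul.
Proof.
move=> x; apply/ffunP => g; rewrite !ffunE (bigD1 1%g) //= big1 ?addr0.
  by rewrite ffunE eqxx mul1r rep_fun1 sym_map_id invg1 mul1g.
by move=> h /negPf h1; rewrite ffunE h1 mul0r.
Qed.

Fact smash_mulx1 : right_id smash_one smash_mul.
Proof.
move=> x; apply/ffunP => g; rewrite !ffunE (bigD1 g) //= big1 ?addr0.
  by rewrite ffunE mulVg eqxx rmorph1 mulr1.
move=> h hg; rewrite ffunE -eq_mulVg1 (negPf hg).
by rewrite rmorph0 mulr0.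
Qed.

Fact smash_mulDl : left_distributive smash_mul +%R.
Proof.
move=> x y z; apply/ffunP => g; rewrite !ffunE -big_split /=.
by apply: eq_bigr => h _; rewrite ffunE mulrDl.
Qed.

Fact smash_mulDr : right_distributive smash_mul +%R.
Proof.
move=> x y z; apply/ffunP => g; rewrite !ffunE -big_split /=.
by apply: eq_bigr => h _; rewrite ffunE linearD mulrDr.
Qed.

Fact smash_one_neq0 : smash_one != 0.
Proof. by apply/eqP => /ffunP/(_ 1%g)/eqP; rewrite !ffunE eqxx oner_eq0. Qed.

Definition smash (r : linrep V gT) : Type := {ffun gT -> sym V}.
HB.instance Definition _ := GRing.Lmodule.on (smash rho).
HB.instance Definition _ := GRing.Zmodule_isNzRing.Build (smash rho)
  smash_mulA smash_mul1x smash_mulx1 smash_mulDl smash_mulDr smash_one_neq0.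

Fact smash_scaleAl (c : k) (x y : smash rho) : c *: (x * y) = (c *: x : smash rho) * y.
Proof.
apply/ffunP => g; rewrite !ffunE scaler_sumr.
by apply: eq_bigr => h _; rewrite ffunE -scalerAl.
Qed.
HB.instance Definition _ := GRing.Lmodule_isLalgebra.Build k (smash rho) smash_scaleAl.
Fact smash_scaleAr (c : k) (x y : smash rho) : c *: (x * y) = x * (c *: y : smash rho).
Proof.
apply/ffunP => g; rewrite !ffunE scaler_sumr.
by apply: eq_bigr => h _; rewrite ffunE linearZ -scalerAr.
Qed.
HB.instance Definition _ := GRing.Lalgebra_isAlgebra.Build k (smash rho) smash_scaleAr.

End Smash.

Section LinearAlgebra.
Variables (k : fieldType) (V : vectType k).

(* The endomorphism of U induced by f, when f maps U into U.                   *)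
Definition restr (f : 'End(V)) (U : {vspace V}) : 'End(subvs_of U) :=
  linfun (vsproj U \o f \o vsval).

Lemma restrE (f : 'End(V)) (U : {vspace V}) (u : subvs_of U) :
  (f @: U <= U)%VS -> vsval (restr f U u) = f (vsval u).
Proof.
move=> fU; rewrite lfunE /= vsprojK //.
exact: (subvP fU) (memv_img _ (subvsP u)).
Qed.

Definition lfdet (f : 'End(V)) : k :=
  \det (passmx.mxof (vbasis (fullv : {vspace V})) (vbasis (fullv : {vspace V})) f).

Definition dualv : vectType k := 'Hom(V, k^o).

Definition dual_map (f : 'End(V)) (phi : dualv) : dualv := (phi \o f)%VF.
Fact dual_map_linear f : linear (dual_map f).
Proof. by move=> a x y; rewrite /dual_map comp_lfunDl comp_lfunZl. Qed.
HB.instance Definition _ f :=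
  GRing.isSemilinear.Build k dualv dualv *:%R (dual_map f)
    (GRing.semilinear_linear (dual_map_linear f)).

Definition stable_complement (f : 'End(V)) (U : {vspace V}) : Prop :=
  [/\ (f @: U <= U)%VS, (fixedSpace f + U = fullv)%VS
    & (fixedSpace f :&: U = 0)%VS].

Lemma stable_complement_unique (f : 'End(V)) (U : {vspace V}) :
  stable_complement f U -> U = limg (f - \1)%VF.
Proof.
move=> [fU sU cU]; have lU : (limg (f - \1)%VF <= U)%VS.
  apply/subvP => _ /memv_imgP[v _ ->].
  have : v \in (fixedSpace f + U)%VS by rewrite sU memvf.
  case/memv_addP => u /fixedSpaceP fu [w wU ->].
  rewrite !lfun_simp linearD /= fu opprD addrACA subrr add0r memvB //.
  exact: (subvP fU) (memv_img _ wU).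
apply/esym/eqP; rewrite eqEdim lU /=.
have := limg_ker_dim (f - \1)%VF fullv; rewrite capfv -/(fixedSpace f).
by rewrite -sU dimv_disjoint_sum // => /addnI ->.
Qed.

End LinearAlgebra.

Section Invariants.
Variables (k : pzRingType) (T : lmodType k) (gT : finGroupType).
Variables (H : {set gT}) (act : gT -> {linear T -> T}).
Definition inv_pred : {pred T} := fun t => [forall h in H, act h t == t].
Fact inv_closed : submod_closed inv_pred.
Proof.
split=> [|a x y]; rewrite ?unfold_in /inv_pred.
  by apply/forall_inP => h _; rewrite linear0.
move=> /forall_inP hx /forall_inP hy; apply/forall_inP => h hH.
by rewrite linearP (eqP (hx _ hH)) (eqP (hy _ hH)).
Qed.
HB.instance Definition _ := GRing.isSubmodClosed.Build k T inv_pred inv_closed.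
Definition invariants : lmodType k := submod inv_pred.
End Invariants.

(* The direct sum of a finite family of modules.                               *)
Section DirectSum.
Variables (k : pzRingType) (I : finType) (X : I -> lmodType k).
Definition dsum : Type := forall i, X i.
HB.instance Definition _ := gen_eqMixin dsum.
HB.instance Definition _ := gen_choiceMixin dsum.
Implicit Types x y z : dsum.
Definition dsum_add x y : dsum := fun i => x i + y i.
Definition dsum_opp x : dsum := fun i => - x i.
Definition dsum_scale (a : k) x : dsum := fun i => a *: x i.
Fact dsum_addA : associative dsum_add.
Proof. by move=> x y z; apply: functional_extensionality_dep => i; apply: addrA. Qed.
Fact dsum_addC : commutative dsum_add.
Proof. by move=> x y; apply: functional_extensionality_dep => i; apply: addrC. Qed.
Fact dsum_add0 : left_id (fun i => 0) dsum_add.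
Proof. by move=> x; apply: functional_extensionality_dep => i; apply: add0r. Qed.
Fact dsum_addN : left_inverse (fun i => 0) dsum_opp dsum_add.
Proof. by move=> x; apply: functional_extensionality_dep => i; apply: addNr. Qed.
HB.instance Definition _ :=
  GRing.isZmodule.Build dsum dsum_addA dsum_addC dsum_add0 dsum_addN.
Fact dsum_scaleA a b x : dsum_scale a (dsum_scale b x) = dsum_scale (a * b) x.
Proof. by apply: functional_extensionality_dep => i; apply: scalerA. Qed.
Fact dsum_scale1 : left_id 1 dsum_scale.
Proof. by move=> x; apply: functional_extensionality_dep => i; apply: scale1r. Qed.
Fact dsum_scaleDr : right_distributive dsum_scale +%R.
Proof. by move=> a x y; apply: functional_extensionality_dep => i; apply: scalerDr. Qed.
Fact dsum_scaleDl x : {morph dsum_scale^~ x : a b / a + b}.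
Proof. by move=> a b; apply: functional_extensionality_dep => i; apply: scalerDl. Qed.
HB.instance Definition _ := GRing.Zmodule_isLmodule.Build k dsum
  dsum_scaleA dsum_scale1 dsum_scaleDr dsum_scaleDl.
End DirectSum.

Section Summand.
Variables (k : fieldType) (V : vectType k) (gT : finGroupType).
Variable rho : linrep V gT.

(* V^g, and its g-stable complement V_g: see movvP for existence, and          *)
(* stable_complement_unique for uniqueness.                                    *)
Definition fixv (g : gT) : {vspace V} := fixedSpace (rho g).

Definition movv (g : gT) : {vspace V} := xget 0%VS (stable_complement (rho g)).

Lemma movvP (g : gT) : #|gT|%:R != 0 :> k -> stable_complement (rho g) (movv g).
Proof.
move=> G0; apply: xgetPex; exists (limg (rho g - \1)%VF).
have cap0 : (fixedSpace (rho g) :&: limg (rho g - \1)%VF = 0)%VS.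
  apply/eqP; rewrite -subv0; apply/subvP => v.
  rewrite memv_cap memv0 => /andP[/fixedSpaceP gv /memv_imgP[w _ vE]].
  have gvE i : v = rho (g ^+ i.+1)%g w - rho (g ^+ i)%g w.
    rewrite expgSr rep_funM !lfun_simp -linearB /=.
    have -> : rho g w - w = v by rewrite vE !lfun_simp.
    elim: i => [|i IHi]; first by rewrite expg0 rep_fun1 lfunE.
    by rewrite expgSr rep_funM lfunE /= gv.
  have : \sum_(0 <= i < #|gT|) v = 0.
    rewrite (@telescope_sumr_eq _ 0 #|gT| (fun i => rho (g ^+ i)%g w)) //.
    have -> : (g ^+ #|gT|)%g = 1%g.
      have /dvdnP[q] := cardSg (finset.subsetT <[g]>%G); rewrite cardsT => ->.
      by rewrite mulnC expgM -orderE expg_order expg1n.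
    by rewrite expg0 subrr.
  rewrite sumr_const_nat subn0 -scaler_nat => /eqP.
  by rewrite scaler_eq0 (negPf G0).
split=> //.
- apply/subvP => _ /memv_imgP[_ /memv_imgP[v _ ->] ->]; apply/memv_imgP.
  by exists (rho g v); rewrite ?memvf // !lfun_simp linearB.
- apply/eqP; rewrite eqEdim subvf /= dimv_disjoint_sum //.
  by have := limg_ker_dim (rho g - \1)%VF fullv; rewrite capfv => ->.
Qed.

Definition mov_dim (g : gT) : nat := \dim (movv g).

Section Degree.
Variables (g : gT) (p : int).

(* S(V^g) (x) Lambda^p((V^g)^* ) (x) det|_{V_g}^{-1}; the last factor is the   *)
(* line k^o, and the centralizer of g acts by summand_act.                     *)
Definition summand_mod : lmodType k :=
  tensor (tensor (sym (subvs_of (fixv g))) (extpowz (dualv (subvs_of (fixv g))) p))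
         k^o.

Definition summand_act (h : gT) : {linear summand_mod -> summand_mod} :=
  tens_map
    (tens_map (sym_map (restr (rho h) (fixv g)))
              (extz_map (dual_map (restr (rho h^-1%g) (fixv g))) p))
    ( *:%R (lfdet (restr (rho h) (movv g)))^-1 : k^o -> k^o).

Definition summand : lmodType k := invariants 'C[g]%g summand_act.

End Degree.

Definition conj_class : finType := {C : {set gT} | C \in classes [set: gT]}.

End Summand.

Definition isomorphic (k : pzRingType) (X Y : lmodType k) : Prop :=
  exists f : {linear X -> Y}, bijective f.

(* Main.v *)
From HB Require Import structures.
Require Import Defs.
From mathcomp Require Import all_fingroup all_boot all_order all_algebra.
From mathcomp Require Import boolp classical_sets functions.
From mathcomp Require Import mpoly ssrcomplements.

(** Write A = S(V), B = A # G and E for the enveloping algebra of B, so that the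
    n-th Hochschild cohomology of B is the n-th Ext of B with itself over E.

    The elements t_v = v (x) 1 - 1 (x) v of E, for v in V, commute with each
    other.  Their Koszul complex Q, with Q_p = E (x) Lambda^p V, is a resolution
    by projective modules of E / (E t_v, v in V) = B (x)_A B: dividing by one
    t_(e_j) after another (tdiff_div) contracts it in positive degrees
    (kchain_exact).  Since |G| is invertible, |G|^-1 sum_h h (x) h^-1 splits the
    multiplication B (x)_A B -> B.  So B is a direct summand of the module that
    Q resolves, and the idempotent lifts to Q as the average over G.  Comparing
    Q with the standard resolution of B (comparison_maps, koszul_comparison)
    identifies Ext^n with the G-invariant classes of the complex Hom_E (Q, B):
    its cochains are the alternating maps from V^n to B, its differential is
    the exterior product with v |-> t_v, and h in G acts by conjugation on the
    values and by h^-1 on the arguments.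

    On the component A g of B = sum_g A g, t_v is multiplication by v - g v.
    The complex therefore is the sum over g of the complexes of alternating
    maps from V^n to A with differential v - g v.  On V^g this operator is 0,
    and it maps a basis u_i of V_g to another basis x_i of V_g.  Contracting
    with u_i and dividing by x_i, one i after another, leaves the product of
    the top form of V_g with alternating maps from (V^g)^(n - d_g) to
    A / (x_i) = S(V^g); the class of a cocycle is read off by evaluating it on
    the u_i and restricting to V^g (res, res_injective, res_surjective).
    These maps are S(V^g) (x) Lambda^(n - d_g) (V^g)^* (theta), and an element
    h of the centralizer of g acts with the additional factor
    det (h | V_g)^-1, because h^-1 is applied to the basis u_i (res_equiv).
    All this is collected in local_relation.

    Finally G permutes the components by conjugation.  An invariant class is
    determined by its components at representatives of the conjugacy classes
    (kcob_reps), these are invariant under the centralizers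
    (invariant_class), and every choice of such components comes from an
    invariant class, by averaging (invariant_lift). *)

Set Implicit Arguments.
Unset Strict Implicit.
Unset Printing Implicit Defensive.

Import GRing.Theory.
Local Open Scope ring_scope.

(** * Alternating maps on lists and Koszul operators *)

Section AlternatingMaps.
Variables (k : comNzRingType) (W : lmodType k).

(** Only neighbouring repetitions are required to vanish; multialt_repeat gives
    the others.  With lists for arguments, the Koszul differential and the
    determinant pairing are structural recursions. *)
Definition multialt (X : lmodType k) (f : seq W -> X) : Prop :=
  (forall s1 s2 a v w,
     f (s1 ++ (a *: v + w) :: s2) = a *: f (s1 ++ v :: s2) + f (s1 ++ w :: s2)) /\
  (forall s1 s2 v, f (s1 ++ v :: v :: s2) = 0).

(** Forms of all degrees live on lists of any length, p-forms being extended by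
    0 to the lists of another length. *)
Definition isalt (X : lmodType k) (p : nat) (f : seq W -> X) : Prop :=
  multialt f /\ forall s, size s != p -> f s = 0.

(** The sum of the (-1)^i t (v_i) (f (s without v_i)): the Koszul differential
    if t v is the action of commuting elements of a ring, the exterior product
    with phi if t v is multiplication by phi v. *)
Fixpoint koszul (X : zmodType) (t : W -> X -> X) (f : seq W -> X) (s : seq W) : X :=
  if s is v :: s' then t v (f s') - koszul t (fun r => f (v :: r)) s' else 0.

Definition bilinop (X : lmodType k) (t : W -> X -> X) : Prop :=
  (forall a v w x, t (a *: v + w) x = a *: t v x + t w x) /\
  (forall v a x y, t v (a *: x + y) = a *: t v x + t v y).

Lemma bilinop0 (X : lmodType k) (t : W -> X -> X) v : bilinop t -> t v 0 = 0.
Proof.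
by move=> [_ tl]; apply: (addrI (1 *: t v 0)); rewrite -tl !scale1r !addr0.
Qed.

Definition scalop (X : lmodType k) (phi : W -> k) (v : W) (x : X) : X := phi v *: x.

Lemma koszul_ext (X : zmodType) (t t' : W -> X -> X) f f' s :
  (forall v x, t v x = t' v x) -> f =1 f' -> koszul t f s = koszul t' f' s.
Proof.
move=> tt'; elim: s f f' => [|v s IHs] f f' ff' //=.
by rewrite tt' ff'; congr (_ - _); apply: IHs => r; rewrite ff'.
Qed.

Lemma koszul_post (X Y : zmodType) (t : W -> X -> X) (t' : W -> Y -> Y) (L : X -> Y) f s :
  {morph L : x y / x - y} -> (forall v x, L (t v x) = t' v (L x)) ->
  L (koszul t f s) = koszul t' (fun r => L (f r)) s.
Proof.
move=> LB Lt; elim: s f => [|v s IHs] f /=; last by rewrite LB Lt IHs.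
by have := LB 0 0; rewrite !subrr.
Qed.

Lemma koszul_map (X : zmodType) (t t' : W -> X -> X) (h : W -> W) f s : (forall v x, t (h v) x = t' v x) ->
  koszul t f (map h s) = koszul t' (fun r => f (map h r)) s.
Proof.
move=> tt'; elim: s f => [|v s IHs] f //=.
by rewrite tt' (IHs (fun r => f (h v :: r))).
Qed.

Section Multialt.
Variable X : lmodType k.
Implicit Types (f g : seq W -> X) (t : W -> X -> X) (phi : W -> k) (s : seq W).

Lemma multialtS f v : multialt f -> multialt (fun s => f (v :: s)).
Proof. by move=> [fl fa]; split=> [s1 s2|s1 s2]; [apply: (fl (v :: s1)) | apply: (fa (v :: s1))]. Qed.

Lemma isaltS p f v : isalt p.+1 f -> isalt p (fun s => f (v :: s)).
Proof. by move=> [fa fs]; split=> [|s sp]; [apply: multialtS | apply: fs]. Qed.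

Lemma multialt0 : multialt (fun=> 0 : X).
Proof. by split=> *; rewrite ?scaler0 ?addr0. Qed.

Lemma multialtD a f g : multialt f -> multialt g -> multialt (fun s => a *: f s + g s).
Proof.
move=> [fl fa] [gl ga]; split=> [s1 s2 b v w|s1 s2 v]; last first.
  by rewrite fa ga scaler0 addr0.
by rewrite fl gl !scalerDr !scalerA mulrC addrACA.
Qed.

Lemma isaltD p a f g : isalt p f -> isalt p g -> isalt p (fun s => a *: f s + g s).
Proof.
move=> [fa fs] [ga gs]; split=> [|s sp]; first exact: multialtD.
by rewrite fs // gs // scaler0 addr0.
Qed.

Lemma isalt_ext p f g : f =1 g -> isalt p f -> isalt p g.
Proof. by move=> /funext ->. Qed.

Lemma isalt0 p : isalt p (fun=> 0 : X).
Proof. by split=> //; apply: multialt0. Qed.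

Lemma multialt_swap f v w s : multialt f -> f (v :: w :: s) = - f (w :: v :: s).
Proof.
move=> [fl fa]; apply/eqP; rewrite -addr_eq0; apply/eqP.
have := fa [::] s (1 *: v + w); rewrite -[_ ++ _]/([::] ++ _) (fl [::] _) /=.
rewrite (fl [:: v] s) (fl [:: w] s) /= (fa [::]) (fa [::] s w) /=.
by rewrite !scale1r add0r addr0.
Qed.

Lemma multialt_cons_lin f a v w s :
  multialt f -> f ((a *: v + w) :: s) = a *: f (v :: s) + f (w :: s).
Proof. by move=> [fl _]; apply: (fl [::]). Qed.

Lemma multialt_slot0 f s1 s2 : multialt f -> f (s1 ++ 0 :: s2) = 0.
Proof.
move=> [fl _]; have := fl s1 s2 1 0 0; rewrite !scale1r addr0 => h.
by apply: (addrI (f (s1 ++ 0 :: s2))); rewrite -h addr0.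
Qed.

Lemma multialt_cons0 f s : multialt f -> f (0 :: s) = 0.
Proof. exact: (multialt_slot0 [::]). Qed.

Lemma multialt_repeat f v s1 s2 s3 : multialt f -> f (s1 ++ v :: s2 ++ v :: s3) = 0.
Proof.
elim: s1 f => [|x s1 IHs] f fa /=; last exact: IHs (multialtS x fa).
elim: s2 f fa => [|x s2 IHs] f fa /=; first exact: (fa.2 [::]).
by rewrite multialt_swap //= (IHs _ (multialtS x fa)) oppr0.
Qed.

Lemma koszulD t a f g s : bilinop t ->
  koszul t (fun r => a *: f r + g r) s = a *: koszul t f s + koszul t g s.
Proof.
move=> [_ tl]; elim: s f g => [|v s IHs] f g /=; first by rewrite scaler0 addr0.
by rewrite IHs tl scalerBr opprD addrACA.
Qed.

Lemma koszul0 t f s : bilinop t -> f =1 (fun=> 0) -> koszul t f s = 0.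
Proof.
move=> tb f0; have := koszulD (1) f f s tb.
rewrite scale1r (koszul_ext (t' := t) (f' := f)) // => [h|r]; last first.
  by rewrite !f0 scaler0 addr0.
by apply: (addrI (koszul t f s)); rewrite addr0.
Qed.

Lemma koszulN t f s : bilinop t -> koszul t (fun r => - f r) s = - koszul t f s.
Proof.
move=> tb; have := koszulD (-1) f (fun=> 0) s tb.
rewrite (koszul0 (f := fun=> 0)) // addr0 scaleN1r => <-.
by apply: koszul_ext => // r; rewrite scaleN1r addr0.
Qed.

Lemma koszulB t f g s : bilinop t ->
  koszul t (fun r => f r - g r) s = koszul t f s - koszul t g s.
Proof.
move=> tb; rewrite -koszulN // -[koszul t f s]scale1r -koszulD //.
by apply: koszul_ext => // r; rewrite scale1r.
Qed.

Lemma koszul_multialt t f : bilinop t -> multialt f -> multialt (koszul t f).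
Proof.
move=> tb fa; split=> [s1 s2 a v w|s1 s2 v].
  elim: s1 f fa => [|x s1 IHs] f fa /=.
    rewrite tb.1 scalerBr addrACA -opprD -koszulD //; congr (_ - _).
    by apply: koszul_ext => // r; apply: multialt_cons_lin.
  by rewrite fa.1 tb.2 (IHs _ (multialtS x fa)) scalerBr opprD addrACA.
elim: s1 f fa => [|x s1 IHs] f fa /=.
  rewrite opprB addrC subrK; apply: koszul0 => // r.
  by have /= := fa.2 [::] r v.
by rewrite fa.2 (IHs _ (multialtS x fa)) bilinop0 // subr0.
Qed.

Lemma koszul_supp (D : pred nat) t f s : bilinop t ->
  (forall r, ~~ D (size r).+1 -> f r = 0) -> ~~ D (size s) -> koszul t f s = 0.
Proof.
move=> tb; elim: s D f => [|v s IHs] D f f0 //= sD.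
rewrite f0 // bilinop0 // (IHs (fun n => D n.+1)) ?subr0 // => r rD.
exact: f0.
Qed.

Lemma koszul_isalt t p f : bilinop t -> isalt p f -> isalt p.+1 (koszul t f).
Proof.
move=> tb [fa fs]; split; first exact: koszul_multialt.
by move=> s; apply: (koszul_supp (D := pred1 p.+1)).
Qed.

Definition commop t t' := forall v w x, t v (t' w x) = t' w (t v x).

(** The first two terms cancel for t = t' and change sign when t and t' are
    exchanged: koszul_sq and koszul_anticomm follow by induction on s. *)
Lemma koszul_koszul_cons t t' f v s : bilinop t -> bilinop t' -> commop t t' ->
  koszul t (koszul t' f) (v :: s) =
    t v (koszul t' f s) - t' v (koszul t f s)
    + koszul t (koszul t' (fun r => f (v :: r))) s.
Proof.
move=> tb tb' tt' /=; rewrite koszulB // opprB addrA addrAC; congr (_ - _ + _).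
apply/esym/koszul_post => [x y|w x]; last by rewrite tt'.
by have := tb'.2 v (-1) y x; rewrite !scaleN1r ![- _ + _]addrC.
Qed.

Lemma koszul_sq t f s : bilinop t -> commop t t -> koszul t (koszul t f) s = 0.
Proof.
move=> tb tt; elim: s f => [|v s IHs] f //.
by rewrite koszul_koszul_cons // IHs addr0 subrr.
Qed.

Lemma koszul_anticomm t t' f s : bilinop t -> bilinop t' -> commop t t' ->
  koszul t (koszul t' f) s = - koszul t' (koszul t f) s.
Proof.
move=> tb tb' tt'; have t't : commop t' t by move=> v w x; rewrite tt'.
elim: s f => [|v s IHs] f; first by rewrite /= oppr0.
by rewrite !koszul_koszul_cons // IHs [in RHS]opprD opprB.
Qed.

Lemma scalop_bilin phi : (forall a v w, phi (a *: v + w) = a * phi v + phi w) ->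
  bilinop (scalop (X := X) phi).
Proof.
rewrite /scalop => pl; split=> [a v w x|v a x y]; first by rewrite pl scalerDl scalerA.
by rewrite scalerDr !scalerA mulrC.
Qed.

Lemma scalop_comm phi t : bilinop t -> commop (scalop phi) t.
Proof.
by move=> tb v w x; have := tb.2 w (phi v) x 0; rewrite bilinop0 // !addr0.
Qed.

(** Used with phi e = 1, when it is the projection onto the kernel of phi along e. *)
Definition projalong (e : W) phi (w : W) : W := w - phi w *: e.

Lemma multialt_projalong_in f e phi s : multialt f -> (forall r, f (e :: r) = 0) ->
  f (map (projalong e phi) s) = f s.
Proof.
elim: s f => [|v s IHs] f fa f0 //=.
rewrite /projalong addrC -scaleNr multialt_cons_lin // f0 scaler0 add0r.
apply: (IHs (fun r => f (v :: r))) => [|r]; first exact: multialtS.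
by rewrite multialt_swap // f0 oppr0.
Qed.

(** Contracting with e and wedging back with phi recovers what the projection
    along e loses.  This is the homotopy identity behind every induction on
    the coordinates below. *)
Lemma alt_split f e phi s :
  (forall a v w, phi (a *: v + w) = a * phi v + phi w) -> multialt f ->
  f s = f (map (projalong e phi) s) + koszul (scalop phi) (fun r => f (e :: r)) s.
Proof.
move=> phil; have sb := scalop_bilin phil.
elim: s f => [|v s IHs] f fa /=; first by rewrite addr0.
rewrite {1}(IHs (fun r => f (v :: r))); last exact: multialtS.
have -> : koszul (scalop phi) (fun r => f (e :: v :: r)) s =
          - koszul (scalop phi) (fun r => f (v :: e :: r)) s.
  by rewrite -koszulN //; apply: koszul_ext => // r; rewrite multialt_swap.
rewrite opprK addrA; congr (_ + _).
have -> : projalong e phi v = - phi v *: e + v.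
  by rewrite /projalong addrC scaleNr.
rewrite multialt_cons_lin // (@multialt_projalong_in (fun r => f (e :: r))) => [||r].
- by rewrite scaleNr addrC addrA addrN add0r.
- exact: multialtS.
- exact: (fa.2 [::]).
Qed.

Lemma koszul_sumop (I : Type) (r : seq I) (t : I -> W -> X -> X) f s :
  koszul (fun v x => \sum_(i <- r) t i v x) f s = \sum_(i <- r) koszul (t i) f s.
Proof.
elim: s f => [|v s IHs] f /=; first by rewrite big1.
by rewrite IHs -sumrB.
Qed.

End Multialt.

Lemma multialt_post (X Y : lmodType k) (L : X -> Y) (f : seq W -> X) :
  linear L -> multialt f -> multialt (fun s => L (f s)).
Proof.
move=> Ll [fl fa]; split=> *; rewrite ?fl ?fa ?Ll //.
by have := Ll (-1) 0 0; rewrite scaler0 addr0 => ->; rewrite scaleN1r addNr.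
Qed.

Lemma isalt_post (X Y : lmodType k) (L : X -> Y) p (f : seq W -> X) :
  linear L -> isalt p f -> isalt p (fun s => L (f s)).
Proof.
move=> Ll [fa fs]; split; first exact: multialt_post.
move=> s sp; rewrite fs //.
by have := Ll (-1) 0 0; rewrite scaler0 addr0 => ->; rewrite scaleN1r addNr.
Qed.

End AlternatingMaps.

Lemma multialt_pre (k : comNzRingType) (U W X : lmodType k) (h : U -> W)
    (f : seq W -> X) :
  linear h -> multialt f -> multialt (fun s => f (map h s)).
Proof. by move=> hl [fl fa]; split=> *; rewrite !map_cat /= ?hl ?fl ?fa. Qed.

Lemma isalt_pre (k : comNzRingType) (U W X : lmodType k) (h : U -> W) p
    (f : seq W -> X) :
  linear h -> isalt p f -> isalt p (fun s => f (map h s)).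
Proof.
move=> hl [fa fs]; split; first exact: multialt_pre.
by move=> s sp; rewrite fs // size_map.
Qed.

(** * Dual bases *)

Section DualBasis.
Variables (k : comNzRingType) (W : lmodType k) (n : nat).

Definition dualbasis (e : 'I_n -> W) (phi : 'I_n -> W -> k) : Prop :=
  [/\ forall i a v w, phi i (a *: v + w) = a * phi i v + phi i w,
      forall i j, phi i (e j) = (i == j)%:R
    & forall w, w = \sum_i phi i w *: e i].

Variables (e : 'I_n -> W) (phi : 'I_n -> W -> k).
Hypothesis db : dualbasis e phi.

Let pi (r : seq 'I_n) (w : W) : W :=
  foldr (fun i w => projalong (e i) (phi i) w) w r.

Lemma projalong_lin i : linear (projalong (e i) (phi i)).
Proof.
case: db => pl _ _ a v w; rewrite /projalong pl scalerDl opprD addrACA.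
by rewrite scalerBr scalerA.
Qed.

Lemma proj_all_eq0 w : pi (enum 'I_n) w = 0.
Proof.
case: db => pl pe pb.
have p0 r i : phi i (pi r w) = if i \in r then 0 else phi i w.
  elim: r => [|j r IHr] //=; rewrite /projalong addrC -scaleNr pl IHr pe in_cons mulNr.
  case: eqVneq => [<-|ij] /=; last by rewrite mulr0 oppr0 add0r.
  by rewrite IHr; case: (i \in r); rewrite ?mul0r ?oppr0 ?addr0 // mulr1 addNr.
by rewrite [LHS]pb big1 // => i _; rewrite p0 mem_enum inE scale0r.
Qed.

(** In positive degree it is enough to pass from the pull-back of a form along
    one coordinate projection to the form itself, because the composite of all
    these projections is 0. *)
Lemma proj_elim (X : lmodType k) p (Q : (seq W -> X) -> Prop) (f : seq W -> X) :
  (forall i g, isalt p.+1 g -> Q (fun s => g (map (projalong (e i) (phi i)) s)) -> Q g) ->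
  Q (fun=> 0) -> isalt p.+1 f -> Q f.
Proof.
move=> QS Q0 fa.
have pil r : linear (pi r).
  by elim: r => [|i r IHr] a v w //=; rewrite IHr projalong_lin.
have Qr r g : isalt p.+1 g -> Q (fun s => g (map (pi r) s)) -> Q g.
  elim: r g => [|i r IHr] g ga Qg.
    by have -> : g = (fun s => g (map (pi [::]) s)) by apply/funext => s; rewrite map_id.
  apply: (QS i) => //; apply: IHr; first exact: isalt_pre (projalong_lin i) ga.
  by under eq_fun => s do rewrite -map_comp.
apply: (Qr (enum 'I_n)) => //.
have -> : (fun s => f (map (pi (enum 'I_n)) s)) = (fun=> 0) => //.
apply/funext => -[|v s] /=; first by case: fa => _ ->.
by rewrite proj_all_eq0 multialt_cons0 //; case: fa.
Qed.

(** Forms are sums of iterated products of coordinate forms with constants, by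
    alt_split.  This induction is used wherever one would choose a basis of an
    exterior power. *)
Lemma alt_ind (X : lmodType k) (P : nat -> (seq W -> X) -> Prop) :
  (forall f, isalt 0 f -> P 0 f) -> (forall p, P p (fun=> 0)) ->
  (forall p f g, P p f -> P p g -> P p (fun s => f s + g s)) ->
  (forall p f i, isalt p f -> P p f -> P p.+1 (koszul (scalop (phi i)) f)) ->
  forall p f, isalt p f -> P p f.
Proof.
move=> P0 Pz PD PK; elim=> [|p IHp] f fa; first exact: P0.
apply: proj_elim fa => // i g ga Pg.
have -> : g = (fun s => g (map (projalong (e i) (phi i)) s)
            + koszul (scalop (phi i)) (fun r => g (e i :: r)) s).
  by apply/funext => s; apply: alt_split; [case: db | case: ga].
by apply: PD => //; apply: PK; [|apply: IHp]; apply: isaltS.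
Qed.

End DualBasis.

Section VectorDualBasis.
Variables (k : fieldType) (W : vectType k).
Let b := vbasis (fullv : {vspace W}).

Lemma vbasis_dual : dualbasis (fun i => b`_i) (fun i w => coord b i w).
Proof.
split=> [i a v w|i j|w]; first by rewrite linearP.
  by rewrite coord_free ?(basis_free (vbasisP _)) // eq_sym.
exact: coord_vbasis (memvf w).
Qed.

Definition dcoord (i : 'I_(\dim (fullv : {vspace W}))) : dualv W :=
  linfun (coord b i : W -> k^o).

Lemma dual_dual : dualbasis dcoord (fun i (w : dualv W) => w b`_i).
Proof.
split=> [i a v w|i j|w]; first by rewrite !lfun_simp.
  by rewrite lfunE /= coord_free ?(basis_free (vbasisP _)).
apply/lfunP => v; rewrite {1}[v](coord_vbasis (memvf v)) sum_lfunE !linear_sum.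
apply: eq_bigr => i _; rewrite linearZ /= lfunE /= [dcoord i v]lfunE.
exact: mulrC.
Qed.

End VectorDualBasis.

(** * Comparison of resolutions *)

(** Existence statements below produce functions that are only known to be
    linear; this gives them the structure. *)
Lemma linear_pack (R : pzRingType) (U V : lmodType R) (f : U -> V) :
  linear f -> exists g : {linear U -> V}, g =1 f.
Proof.
move=> fl; pose fL := GRing.isSemilinear.Build R U V *:%R f (GRing.semilinear_linear fl).
pose g : {linear U -> V} := HB.pack f fL; by exists g.
Qed.

Lemma linear_null (R : pzRingType) (U V : lmodType R) :
  exists g : {linear U -> V}, g =1 (fun=> 0).
Proof. by apply: linear_pack => a u v; rewrite scaler0 addr0. Qed.

Section Comparison.
Variable R : pzRingType.

(** Coboundaries of the complex Hom (C, N), for bare functions so that they can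
    be replaced by pointwise equal ones. *)
Definition hcob (C : nat -> lmodType R) (d : forall n, {linear C n.+1 -> C n})
    (N : lmodType R) n : (C n -> N) -> Prop :=
  match n with
  | 0 => fun c => forall x, c x = 0
  | m.+1 => fun c => exists h : {linear C m -> N}, forall x, c x = h (d m x)
  end.

Lemma hcob_ext (C : nat -> lmodType R) (d : forall n, {linear C n.+1 -> C n})
    (N : lmodType R) n (c c' : C n -> N) : c =1 c' -> hcob d c -> hcob d c'.
Proof. by move=> /funext ->. Qed.

Lemma hcobD (C : nat -> lmodType R) (d : forall n, {linear C n.+1 -> C n})
    (N : lmodType R) n (c c' : C n -> N) :
  hcob d c -> hcob d c' -> hcob d (fun x => c x + c' x).
Proof.
case: n c c' => [|n] c c' /=; first by move=> c0 c'0 x; rewrite c0 c'0 addr0.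
move=> [h hE] [h' hE'].
have [|g gE] := @linear_pack R (C n) N (fun x => h x + h' x).
  by move=> a x y; rewrite !linearP scalerDr addrACA.
by exists g => x; rewrite gE hE hE'.
Qed.

Lemma hcob_pre (C D : nat -> lmodType R) (dC : forall n, {linear C n.+1 -> C n})
    (dD : forall n, {linear D n.+1 -> D n}) (f : forall n, {linear C n -> D n})
    (N : lmodType R) n (c : D n -> N) :
  (forall n x, f n (dC n x) = dD n (f n.+1 x)) -> hcob dD c -> hcob dC (fun x => c (f n x)).
Proof.
case: n c => [|n] c fd /=; first by move=> c0 x; rewrite c0.
by move=> [h hE]; exists (h \o f n) => x; rewrite hE /= fd.
Qed.

Section Image.
Variables (U V : lmodType R) (d : {linear U -> V}).
Definition im_pred : {pred V} := fun x => `[< exists y, x = d y >].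
Fact im_pred_closed : submod_closed im_pred.
Proof.
split=> [|a x y]; rewrite ?unfold_in; first by apply/asboolP; exists 0; rewrite linear0.
move=> /asboolP[u ->] /asboolP[v ->]; apply/asboolP; exists (a *: u + v).
by rewrite linearP.
Qed.
HB.instance Definition _ := GRing.isSubmodClosed.Build R V im_pred im_pred_closed.
End Image.

(** Projectivity speaks of surjections, so the codomain is cut down to the
    image of d. *)
Lemma proj_lift (P U V : lmodType R) (d : {linear U -> V}) (g : P -> V) :
  projective P -> linear g -> (forall x, exists y, g x = d y) ->
  exists h : {linear P -> U}, forall x, d (h x) = g x.
Proof.
move=> Pp gl gd.
have imP x : (x \in im_pred d) <-> exists y, x = d y by split=> /asboolP.
have dI u : d u \in im_pred d by apply/imP; exists u.
have gI x : g x \in im_pred d by apply/imP/gd.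
have [p pE] : exists p : {linear U -> submod (im_pred d)}, forall u, val (p u) = d u.
  have [|p pE] := @linear_pack R U (submod (im_pred d)) (fun u => Sub (d u) (dI u)).
    by move=> a u v; apply: val_inj; rewrite [RHS]linearP !SubK linearP.
  by exists p => u; rewrite pE SubK.
have [f fE] : exists f : {linear P -> submod (im_pred d)}, forall u, val (f u) = g u.
  have [|p' p'E] := @linear_pack R P (submod (im_pred d)) (fun u => Sub (g u) (gI u)).
    by move=> a u v; apply: val_inj; rewrite [RHS]linearP !SubK gl.
  by exists p' => u; rewrite p'E SubK.
have [|h hE] := Pp U (submod (im_pred d)) p f.
  move=> w; have /imP[u uE] := valP w; exists u; apply: val_inj.
  by rewrite pE -uE.
by exists h => x; rewrite -pE -fE -hE.
Qed.

Variables (P Q : nat -> lmodType R).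
Variables (dP : forall n, {linear P n.+1 -> P n}) (dQ : forall n, {linear Q n.+1 -> Q n}).
Hypothesis P_proj : forall n, projective (P n).
Hypothesis dPdP : forall n x, dP n (dP n.+1 x) = 0.
Hypothesis Q_exact : forall n x, dQ n x = 0 -> exists y, x = dQ n.+1 y.

(** Each stage of the recursion carries the proof that the next one exists. *)
Lemma chain_lift (f0 : {linear P 0 -> Q 0}) :
  (forall x, exists y, f0 (dP 0 x) = dQ 0 y) ->
  exists f : forall n, {linear P n -> Q n},
    f 0%N =1 f0 /\ forall n x, f n (dP n x) = dQ n (f n.+1 x).
Proof.
move=> f0d.
pose good n := {f : {linear P n -> Q n} | forall x, exists y, f (dP n x) = dQ n y}.
have step n (F : good n) :
    {F' : good n.+1 | forall x, sval F (dP n x) = dQ n (sval F' x)}.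
  case: F => f fd /=; apply: cid.
  have [|//|h hE] := @proj_lift _ _ _ (dQ n) (f \o dP n) (@P_proj n.+1).
    by move=> a u v; rewrite linearP.
  have hd x : exists y, h (dP n.+1 x) = dQ n.+1 y.
    by apply: Q_exact; rewrite hE /= dPdP linear0.
  by exists (exist _ h hd) => x; rewrite hE.
pose F := fix F n : good n := if n is n'.+1 then sval (step n' (F n')) else exist _ f0 f0d.
exists (fun n => sval (F n)); split=> // n x.
by rewrite /= -(svalP (step n (F n))).
Qed.

(** The conclusion is what a chain homotopy from f to g gives after composition
    with a cocycle. *)
Lemma chain_homotopic (f g : forall n, {linear P n -> Q n}) :
  (forall n x, f n (dP n x) = dQ n (f n.+1 x)) ->
  (forall n x, g n (dP n x) = dQ n (g n.+1 x)) ->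
  (forall x, exists y, f 0%N x - g 0%N x = dQ 0 y) ->
  forall (N : lmodType R) n (c : {linear Q n -> N}), (forall x, c (dQ n x) = 0) ->
  hcob dP (fun x => c (f n x) - c (g n x)).
Proof.
move=> fd gd fg0 N.
have fgl n : linear (fun x => f n x - g n x).
  by move=> a u v; rewrite !linearP addrACA -scalerDr.
have fgd n x : dQ n (f n.+1 x - g n.+1 x) = f n (dP n x) - g n (dP n x).
  by rewrite linearB fd gd.
have [h0 h0E] := proj_lift (@P_proj 0) (fgl 0%N) fg0.
have lift m (h : {linear P m -> Q m.+1}) :
    (forall x, dQ m (h (dP m x)) = f m (dP m x) - g m (dP m x)) ->
    exists h' : {linear P m.+1 -> Q m.+2},
      forall x, dQ m.+1 (h' x) = f m.+1 x - g m.+1 x - h (dP m x).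
  move=> hE; apply: proj_lift => // [a u v|x].
    by rewrite fgl !linearP addrACA -scalerDr.
  by apply: Q_exact; rewrite linearB /= fgd hE subrr.
case=> [|m] c cd; first by move=> x; rewrite /= -linearB -h0E cd.
have [h hE] : exists h : {linear P m -> Q m.+1},
    forall x, dQ m (h (dP m x)) = f m (dP m x) - g m (dP m x).
  elim: {c cd} m => [|m [h hE]]; first by exists h0 => x; rewrite h0E.
  have [h' h'E] := lift m h hE.
  by exists h' => x; rewrite h'E dPdP linear0 subr0.
have [h' h'E] := lift m h hE.
exists (c \o h) => x /=; apply/eqP; rewrite -linearB -subr_eq0 -linearB /=.
by rewrite -h'E cd.
Qed.

End Comparison.

Section CompareCohomology.
Variables (R : pzRingType) (P Q : nat -> lmodType R).
Variables (dP : forall n, {linear P n.+1 -> P n}) (dQ : forall n, {linear Q n.+1 -> Q n}).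
Hypotheses (P_proj : forall n, projective (P n)) (Q_proj : forall n, projective (Q n)).
Hypotheses (dPdP : forall n x, dP n (dP n.+1 x) = 0) (dQdQ : forall n x, dQ n (dQ n.+1 x) = 0).
Hypothesis P_exact : forall n x, dP n x = 0 -> exists y, x = dP n.+1 y.
Hypothesis Q_exact : forall n x, dQ n x = 0 -> exists y, x = dQ n.+1 y.
Variables (a : forall n, {linear P n -> Q n}) (b : forall n, {linear Q n -> P n}).
Variable eps : forall n, {linear Q n -> Q n}.
Hypothesis ad : forall n x, a n (dP n x) = dQ n (a n.+1 x).
Hypothesis bd : forall n x, b n (dQ n x) = dP n (b n.+1 x).
Hypothesis ed : forall n x, eps n (dQ n x) = dQ n (eps n.+1 x).
Variable N : lmodType R.

(** The situation is that of a module resolved by P which is a direct summand of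
    the one resolved by Q: a and b lift the inclusion and the projection, and
    eps lifts the idempotent.  The hypotheses on degree 0 express this. *)
Lemma retract_idem n (c : {linear P n -> N}) :
  (forall x, exists y, b 0%N x - b 0%N (eps 0%N x) = dP 0 y) ->
  (forall x, c (dP n x) = 0) -> hcob dQ (fun x => c (b n x) - c (b n (eps n x))).
Proof.
move=> be c0.
by apply: (chain_homotopic (g := fun n => b n \o eps n) Q_proj dQdQ P_exact) => // m x /=;
  rewrite ed bd.
Qed.

Lemma retract_hcob n (c : {linear P n -> N}) :
  (forall x, exists y, b 0%N (a 0%N x) - x = dP 0 y) ->
  (forall x, c (dP n x) = 0) -> hcob dQ (fun x => c (b n x)) <-> hcob dP c.
Proof.
move=> ba c0; split=> [ch|]; last exact: hcob_pre.
have nl : hcob dP (fun x => c x - c (b n (a n x))).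
  apply: (chain_homotopic (f := fun n => idfun) (g := fun n => b n \o a n)
                          P_proj dPdP P_exact) => //.
    by move=> m x /=; rewrite ad bd.
  by move=> x /=; have [y yE] := ba x; exists (- y); rewrite linearN -yE opprB.
apply: hcob_ext (hcobD nl (hcob_pre ad ch)) => x.
by rewrite subrK.
Qed.

Lemma section_idem n (f : {linear Q n -> N}) :
  (forall x, exists y, a 0%N (b 0%N x) - eps 0%N x = dQ 0 y) ->
  (forall x, f (dQ n x) = 0) -> hcob dQ (fun x => f (a n (b n x)) - f (eps n x)).
Proof.
move=> ab f0.
by apply: (chain_homotopic (f := fun n => a n \o b n) Q_proj dQdQ Q_exact) => // m x /=;
  rewrite bd ad.
Qed.

End CompareCohomology.

(** * Recognizing a quotient *)

(** A relation instead of a function, because the classes of cocycles are only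
    determined through existence statements. *)
Lemma isomorphic_qmod (R : pzRingType) (Z Y : lmodType R) (S : submodClosed Z)
    (rel : Z -> Y -> Prop) :
  (forall z, exists y, rel z y) -> (forall y, exists z, rel z y) ->
  (forall a z z' y y', rel z y -> rel z' y' -> rel (a *: z + z') (a *: y + y')) ->
  (forall z y, rel z y -> (z \in S <-> y = 0)) ->
  isomorphic (qmod S) Y.
Proof.
move=> rtot rsurj rlin rker.
have relS z z' y y' : rel z y -> rel z' y' -> (qpi S z = qpi S z') <-> (y = y').
  move=> zy zy'; have := rlin (-1) _ _ _ _ zy' zy; rewrite !scaleN1r ![- _ + _]addrC.
  move=> /rker h; split=> [/qpi_eq/h/eqP|/eqP]; first by rewrite subr_eq0 => /eqP.
  by rewrite -subr_eq0 => /eqP/h/qpi_eq.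
have [f fE] := choice (fun q : qmod S => rtot (repr (q : Quotient.quot (submodz S)))).
have relf z : rel z (f (qpi S z)).
  have [y zy] := rtot z; suff <- : y = f (qpi S z) by [].
  by apply/(relS _ _ _ _ zy (fE _)); rewrite /qpi reprK.
have fl : linear f.
  move=> a q r; have [x ->] := qpi_surj q; have [y ->] := qpi_surj r.
  rewrite -linearP; apply/(relS _ _ _ _ (relf _) (rlin _ _ _ _ _ (relf _) (relf _))).
  by [].
have [g gE] := linear_pack fl; exists g.
have [h hE] := choice rsurj; exists (fun y => qpi S (h y)) => [q|y].
  rewrite gE; have [x ->] := qpi_surj q.
  exact/(relS _ _ _ _ (hE _) (relf _)).
by rewrite gE; apply/(relS _ _ _ _ (relf _) (hE _)).
Qed.

(** * The smash product and its enveloping algebra *)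

Section MonomialBasis.
Variables (k : fieldType) (n : nat).

Lemma mpoly_lin_ext (Z : lmodType k) (f g : {mpoly k[n]} -> Z) :
  linear f -> linear g -> (forall m, f 'X_[m] = g 'X_[m]) -> f =1 g.
Proof.
move=> /linear_pack[f' fE] /linear_pack[g' gE] fg p; rewrite -fE -gE.
rewrite [p]mpolyE !linear_sum; apply: eq_bigr => m _.
by rewrite !linearZ /= fE gE fg.
Qed.

Lemma mpoly_lin_exists (Z : lmodType k) (F : 'X_{1..n} -> Z) :
  exists f : {mpoly k[n]} -> Z, linear f /\ forall m, f 'X_[m] = F m.
Proof.
pose f (p : {mpoly k[n]}) : Z := \sum_(m <- msupp p) p@_m *: F m.
have fE p i : (msize p <= i)%N -> f p = \sum_(m : 'X_{1..n < i}) p@_m *: F m.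
  move=> le_pi; set I : subFinType _ := 'X_{1..n < i}.
  rewrite /f (big_mksub I) ?msupp_uniq //=; first last.
    by move=> x /msize_mdeg_lt /leq_trans; apply.
  by rewrite big_rmcond //= => j /memN_msupp_eq0 ->; rewrite scale0r.
exists f; split=> [a p q|m]; last first.
  by rewrite /f msuppX big_seq1 mcoeffX eqxx scale1r.
pose d := maxn (msize (a *: p + q)) (maxn (msize p) (msize q)).
rewrite !(fE _ d) ?leq_max ?leqnn ?orbT // scaler_sumr -big_split /=.
by apply: eq_bigr => m _; rewrite mcoeffD mcoeffZ scalerDl scalerA.
Qed.

End MonomialBasis.

Section SymInd.
Variables (k : fieldType) (U : vectType k).

Lemma sym_ind (P : sym U -> Prop) :
  (forall c, P c%:A) -> (forall p q, P p -> P q -> P (p + q)) ->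
  (forall p q, P p -> P q -> P (p * q)) -> (forall u, P (sym_in u)) -> forall p, P p.
Proof.
move=> PC PD PM PX p; rewrite [p]mpolyE; apply: (big_ind P) => [||m _].
- by rewrite -(scale0r (1 : sym U)); apply: PC.
- exact: PD.
rewrite -mul_mpolyC -[_%:MP]mulr1 mul_mpolyC; apply: (PM); first exact: PC.
rewrite mpolyXE_id; apply: (big_ind P) => [||i _].
- by rewrite -(scale1r (1 : sym U)); apply: PC.
- exact: PM.
elim: (m i) => [|e IHe]; first by rewrite expr0 -(scale1r (1 : sym U)); apply: PC.
by rewrite exprS; apply: PM => //; rewrite -sym_inX; apply: PX.
Qed.

End SymInd.

Section Smash.
Variables (k : fieldType) (V : vectType k) (gT : finGroupType) (rho : linrep V gT).
Local Notation A := (sym V).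
Local Notation B := (smash rho).
Local Notation E := (envalg B).
Implicit Types (a b : A) (g h : gT) (x y : B).

Lemma repK h v : rho h^-1%g (rho h v) = v.
Proof.
by rewrite -comp_lfunE -rep_funM mulVg rep_fun1 lfunE.
Qed.

Lemma repKV h v : rho h (rho h^-1%g v) = v.
Proof. by have := repK h^-1%g v; rewrite invgK. Qed.

Lemma sym_mapKV h a : sym_map (rho h) (sym_map (rho h^-1%g) a) = a.
Proof.
by rewrite -[LHS]/((sym_map (rho h) \o sym_map (rho h^-1%g)) a) -sym_map_comp
  -rep_funM mulgV rep_fun1 sym_map_id.
Qed.

(** The element a # g. *)
Definition sm a g : B := [ffun h => if h == g then a else 0].

Lemma smE a g h : sm a g h = if h == g then a else 0.
Proof. by rewrite ffunE. Qed.

Lemma smash_mulE x y g :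
  (x * y) g = \sum_h x h * sym_map (rho h) (y (h^-1 * g)%g).
Proof. exact: ffunE. Qed.

Lemma smash_linE (c : k) x y g : (c *: x + y) g = c *: x g + y g.
Proof. by rewrite !ffunE. Qed.

Lemma sm_mul a g b h : sm a g * sm b h = sm (a * sym_map (rho g) b) (g * h)%g.
Proof.
apply/ffunP => l; rewrite smash_mulE (bigD1 g) //= big1 ?addr0 => [|u ug]; last first.
  by rewrite smE (negPf ug) mul0r.
rewrite !smE eqxx; have -> : ((g^-1 * l)%g == h) = (l == (g * h)%g).
  by apply/eqP/eqP => [<-|->]; rewrite ?mulKVg ?mulKg.
by case: eqP => _; rewrite ?rmorph0 ?mulr0.
Qed.

Lemma sm1 : sm 1 1%g = 1.
Proof. by apply/ffunP => g; rewrite smE [RHS]ffunE; case: eqP. Qed.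

Lemma sm_lin g : linear (sm^~ g).
Proof.
move=> c a b; apply/ffunP => h; rewrite smash_linE !smE.
by case: eqP; rewrite // scaler0 addr0.
Qed.

Lemma smD a b g : sm (a + b) g = sm a g + sm b g.
Proof. by rewrite -[a]scale1r [LHS]sm_lin !scale1r. Qed.

Lemma smZ (c : k) a g : sm (c *: a) g = c *: sm a g.
Proof.
have sm0 : sm 0 g = 0 by apply: (addrI (sm 0 g)); rewrite -smD !addr0.
by rewrite -[c *: a]addr0 [LHS]sm_lin sm0 addr0.
Qed.

Lemma sm_sum x : x = \sum_g sm (x g) g.
Proof.
apply/ffunP => h; rewrite sum_ffunE (bigD1 h) //= big1 => [|g gh].
  by rewrite addr0 smE eqxx.
by rewrite smE eq_sym (negPf gh).
Qed.

(** The second factor multiplies in the opposite order: see ten_mul. *)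
Definition ten (x y : B) : E := tens (x : B) (y : B^c).

Lemma ten_mul x y x' y' : ten x y * ten x' y' = ten (x * x') (y' * y).
Proof. exact: tmulE. Qed.

Lemma ten1 : ten 1 1 = 1. Proof. by []. Qed.

Lemma ten_linl y : linear (ten^~ y).
Proof. by move=> c u v; apply: (tens_bilin _ _).1. Qed.
Lemma ten_linr x : linear (ten x).
Proof. by move=> c u v; apply: (tens_bilin _ _).2. Qed.

Lemma tenDl x x' y : ten (x + x') y = ten x y + ten x' y.
Proof. exact: tensDl. Qed.
Lemma tenDr x y y' : ten x (y + y') = ten x y + ten x y'.
Proof. exact: (@tensDr k B B^c). Qed.
Lemma tenZl (c : k) x y : ten (c *: x) y = c *: ten x y.
Proof. exact: tensZl. Qed.
Lemma tenZr (c : k) x y : ten x (c *: y) = c *: ten x y.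
Proof. exact: (@tensZr k B B^c). Qed.

Lemma E_ind (P : E -> Prop) :
  P 0 -> (forall x y e, P e -> P (ten x y + e)) -> forall e, P e.
Proof. exact: tens_ind. Qed.

Lemma ten_act x y (z : bimod B) : ten x y *: z = x * z * y :> B.
Proof. exact: bimod_scaleE. Qed.

Lemma resk_bimodE (c : k) (z : resk (bimod B)) : c *: z = c *: (z : B).
Proof.
rewrite -[LHS]/((c%:A : E) *: (z : bimod B)).
have -> : (c%:A : E) = ten (c%:A) 1 by rewrite -[LHS]/(c *: ten 1 1) /ten tensZl.
by rewrite ten_act mulr1 mulr_algl.
Qed.

(** On a bimodule this is the commutator with v.  These elements commute, and
    E modulo the left ideal that they generate is B (x)_S(V) B. *)
Definition tdiff (v : V) : E := ten (sm (sym_in v) 1%g) 1 - ten 1 (sm (sym_in v) 1%g).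

(** On a bimodule this is conjugation by h. *)
Definition gdiag (h : gT) : E := ten (sm 1 h) (sm 1 h^-1%g).

Lemma smA_comm a b : sm a 1%g * sm b 1%g = sm b 1%g * sm a 1%g.
Proof. by rewrite !sm_mul rep_fun1 !sym_map_id mulrC. Qed.

Lemma tdiff_lin : linear tdiff.
Proof.
move=> c v w; rewrite /tdiff linearP sm_lin ten_linl ten_linr.
by rewrite scalerBr opprD addrACA.
Qed.

Lemma tdiff_comm v w : tdiff v * tdiff w = tdiff w * tdiff v.
Proof.
suff c x y : x * y = y * x -> GRing.comm (ten x 1 - ten 1 x) (ten y 1 - ten 1 y).
  exact/c/smA_comm.
move=> xy; apply: commrB; apply/commr_sym/commrB; apply/commr_sym;
  by rewrite /GRing.comm !ten_mul ?mulr1 ?mul1r ?xy.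
Qed.

Lemma gdiag_tdiff h v : gdiag h * tdiff v = tdiff (rho h v) * gdiag h.
Proof.
rewrite /gdiag /tdiff mulrBr mulrBl !ten_mul !mulr1 !mul1r !sm_mul.
by rewrite !mulg1 !mul1g rep_fun1 !sym_map_id !mul1r !mulr1 !sym_map_in repK.
Qed.

Lemma gdiagM g h : gdiag (g * h)%g = gdiag g * gdiag h.
Proof. by rewrite /gdiag ten_mul !sm_mul !rmorph1 !mulr1 invMg. Qed.

Lemma sm_mulE a h x g : (sm a h * x) g = a * sym_map (rho h) (x (h^-1 * g)%g).
Proof.
rewrite smash_mulE (bigD1 h) //= big1 ?addr0 ?smE ?eqxx // => u uh.
by rewrite smE (negPf uh) mul0r.
Qed.

Lemma mul_smE a h x g : (x * sm a h) g = x (g * h^-1)%g * sym_map (rho (g * h^-1)%g) a.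
Proof.
rewrite smash_mulE (bigD1 (g * h^-1)%g) //= big1 ?addr0 => [|u ug].
  by rewrite smE invMg invgK -mulgA mulVg mulg1 eqxx.
rewrite smE; case: eqP => [uE|]; last by rewrite rmorph0 mulr0.
by rewrite -uE invMg invgK mulgA mulgV mul1g eqxx in ug.
Qed.

(** Commutation with v is multiplication by v - g v on the component of g,
    because (a # g) v = a g(v) # g. *)
Lemma tdiff_act v (z : bimod B) g :
  (tdiff v *: z : B) g = (sym_in v - sym_in (rho g v)) * (z : B) g.
Proof.
rewrite /tdiff scalerBl -[(_ - _ : bimod B)]/((_ : B) - (_ : B)) !ten_act mulr1 mul1r.
have -> (x y : B) : (x - y) g = x g - y g by rewrite !ffunE.
rewrite sm_mulE mul_smE invg1 !mul1g mulg1 rep_fun1 sym_map_id sym_map_in.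
by rewrite mulrBl [_ * sym_in (rho g v)]mulrC.
Qed.

Lemma gdiag_act h (z : bimod B) g :
  (gdiag h *: z : B) g = sym_map (rho h) ((z : B) (h^-1 * g * h)%g).
Proof.
by rewrite /gdiag ten_act mul_smE sm_mulE invgK mul1r rmorph1 mulr1 mulgA.
Qed.

(** ** Division by the Koszul elements *)

Local Notation dimV := (\dim (fullv : {vspace V})).
Local Notation e_ i := ((vbasis (fullv : {vspace V}))`_i).

Lemma E_lin_ext (f g : {linear E -> E}) :
  (forall x m h, f (ten x (sm 'X_[m] h)) = g (ten x (sm 'X_[m] h))) -> f =1 g.
Proof.
move=> fg; apply: tens_ext => x y; rewrite -[tens x y]/(ten x y) [y]sm_sum.
have [t tE] := linear_pack (ten_linr x); rewrite -tE !linear_sum.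
apply: eq_bigr => h _; rewrite tE.
apply: (@mpoly_lin_ext k dimV E (fun a => f (ten x (sm a h)))
          (fun a => g (ten x (sm a h)))) => // c a b; by rewrite sm_lin ten_linr linearP.
Qed.

(** The quotient of y^m - x^m by x - y in the j-th coordinates; see tdiff_div. *)
Definition divmon (j : 'I_dimV) (m : 'X_{1..dimV}) (h : gT) : E :=
  - \sum_(0 <= i < m j) ten (sm ('X_j ^+ i) 1%g) (sm 'X_[m - U_(j) *+ i.+1] h).

(** Right multiplication in E multiplies a tensor on its inner sides.  For the
    j-th coordinates x and y to the left and to the right of the tensor sign it
    is multiplication by x - y, and s is the division by x - y of f (x, y)
    minus its value f (x, x) at y = x, which commutes with multiplication by
    the elements of the other coordinates. *)
Lemma tdiff_div (j : 'I_dimV) :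
  exists s : {linear E -> E},
    (forall x : E, s (x * tdiff (e_ j)) = x) /\
    (forall i (x : E), i != j -> s (x * tdiff (e_ i)) = s x * tdiff (e_ i)).
Proof.
have /choice[L LP] h := mpoly_lin_exists (divmon j ^~ h).
pose F (x y : B) : E := ten x 1 * \sum_h L h (y h).
have Fb : bilin (fun p : B * B^c => F p.1 (p.2 : B)).
  split=> [y c x x'|x c y y'] /=; first by rewrite /F ten_linl mulrDl -scalerAl.
  rewrite /F scalerAr -mulrDr scaler_sumr -big_split; congr (_ * _).
  by apply: eq_bigr => h _ /=; rewrite -(LP h).1 -smash_linE.
pose s := tens_lift (f := fun (x : B) (y : B^c) => F x y) Fb.
have sE x m h : s (ten x (sm 'X_[m] h)) = ten x 1 * divmon j m h.
  rewrite /s tens_liftE /F (bigD1 h) //= big1 ?addr0 => [|g gh].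
    by rewrite smE eqxx (LP h).2.
  rewrite smE (negPf gh); have := (LP g).1 (-1) 0 0.
  by rewrite scaler0 addr0 scaleN1r addNr.
have tE x m h (i : 'I_dimV) : ten x (sm 'X_[m] h) * tdiff (e_ i) =
    ten (x * sm 'X_i 1%g) (sm 'X_[m] h) - ten x (sm 'X_[U_(i) + m] h).
  rewrite /tdiff sym_inX mulrBr !ten_mul !mulr1 !mul1r sm_mul rep_fun1.
  by rewrite sym_map_id mul1g mpolyXD.
have sT x m h (i : 'I_dimV) : s (ten x (sm 'X_[m] h) * tdiff (e_ i)) =
    ten x 1 * (ten (sm 'X_i 1%g) 1 * divmon j m h - divmon j (U_(i) + m)%MM h).
  by rewrite tE linearB /= !sE mulrBr mulrA ten_mul mulr1.
have divmonS m h : ten (sm 'X_j 1%g) 1 * divmon j m h - divmon j (U_(j) + m)%MM h =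
    ten 1 (sm 'X_[m] h).
  rewrite /divmon mulrN opprK mnmDE mnm1E eqxx add1n big_nat_recl // addrCA.
  rewrite expr0 sm1; have -> : (U_(j) + m - U_(j) *+ 1)%MM = m.
    by apply/mnmP => l; rewrite !(mnmDE, mnmBE, mnm1E) addKn.
  rewrite mulr_sumr -[RHS]addr0; congr (_ + _); apply/eqP; rewrite addrC subr_eq0.
  apply/eqP; apply: eq_bigr => i _; rewrite ten_mul mulr1 sm_mul rep_fun1 sym_map_id.
  rewrite mul1g -exprS; congr (ten _ (sm 'X_[_] _)).
  by apply/mnmP => l; rewrite !(mnmDE, mnmBE, mulmnE, mnm1E) mulnS subnDl.
have divmonC m h (i : 'I_dimV) : i != j ->
    ten (sm 'X_i 1%g) 1 * divmon j m h - divmon j (U_(i) + m)%MM h =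
    divmon j m h * tdiff (e_ i).
  move=> ij; rewrite /divmon mulrN opprK mulNr mnmDE mnm1E (negPf ij) add0n.
  rewrite mulr_sumr mulr_suml -sumrN -big_split -sumrN; apply: eq_big_nat => l /andP[_ lm].
  rewrite /tdiff sym_inX mulrBr !ten_mul !mulr1 !mul1r !sm_mul rep_fun1 !sym_map_id !mul1g.
  rewrite -mpolyXD [_ * 'X_i]mulrC opprB addrC /=; congr (_ + ten _ (sm 'X_[_] _)).
  apply/mnmP => r; rewrite !(mnmDE, mnmBE, mulmnE, mnm1E) -addnBA //.
  by case: eqVneq => [<-|_]; rewrite ?mul1n // mul0n.
have mulT (c : E) (f : {linear E -> E}) : exists g : {linear E -> E}, g =1 (fun x : E => f (x * c)).
  by apply: linear_pack => a u v; rewrite mulrDl -scalerAl linearP.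
have mulT' (c : E) (f : {linear E -> E}) : exists g : {linear E -> E}, g =1 (fun x : E => f x * c).
  by apply: linear_pack => a u v; rewrite linearP mulrDl -scalerAl.
exists s; split=> [x|i x ij].
  have [g gE] := mulT (tdiff (e_ j)) s; rewrite -gE.
  apply: (E_lin_ext (g := idfun)) => y m h.
  by rewrite gE sT divmonS ten_mul mulr1 mulr1.
have [g gE] := mulT (tdiff (e_ i)) s; have [g' g'E] := mulT' (tdiff (e_ i)) s.
rewrite -gE -g'E; apply: E_lin_ext => y m h.
by rewrite gE g'E sT divmonC // sE mulrA.
Qed.

End Smash.

(** * The Koszul complex of commuting elements *)

Section DetPairing.
Variables (k : fieldType) (V : vectType k).
Local Notation W := (dualv V).

Definition evop (X : lmodType k) (v : V) : W -> X -> X := scalop (fun w : W => w v : k).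

Lemma evop_bilin X v : bilinop (evop (X := X) v).
Proof. by apply: scalop_bilin => a w w'; rewrite !lfun_simp. Qed.

Lemma dualop_bilin (X : lmodType k) (w : W) : bilinop (scalop (X := X) w).
Proof. by apply: scalop_bilin => a v v'; rewrite linearP. Qed.

Lemma koszul_ext_size (U : lmodType k) (X : zmodType) (t : U -> X -> X) f f' s :
  (forall r, (size r).+1 = size s -> f r = f' r) -> koszul t f s = koszul t f' s.
Proof.
elim: s f f' => [|v s IHs] f f' ff' //=.
by rewrite ff' // (IHs _ (fun r => f' (v :: r))) // => r rs; rewrite ff' //= rs.
Qed.

Lemma koszul_exchange (U U' : lmodType k) (X : lmodType k) (t : U -> X -> X)
    (t' : U' -> X -> X) (F : seq U' -> seq U -> X) s l :
  bilinop t -> bilinop t' -> (forall v w x, t v (t' w x) = t' w (t v x)) ->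
  koszul t (fun r => koszul t' (fun s' => F s' r) s) l =
  koszul t' (fun s' => koszul t (F s') l) s.
Proof.
move=> tb tb' tt'; elim: s F => [|v s IHs] F /=; first exact: koszul0.
rewrite koszulB // (IHs (fun s' => F (v :: s'))); congr (_ - _).
apply/esym/koszul_post => [x y|w x]; last by rewrite tt'.
by have := tb'.2 v (-1) y x; rewrite !scaleN1r ![- _ + _]addrC.
Qed.

(** The determinant of the values of the covectors l on the vectors s, by
    expansion along the first vector. *)
Fixpoint detp (s : seq V) (l : seq W) : k^o :=
  if s is v :: s' then koszul (evop v) (detp s') l else (l == [::])%:R.

Lemma detp_isalt s : isalt (size s) (detp s).
Proof.
elim: s => [|v s IHs]; last exact: koszul_isalt (evop_bilin _ _) IHs.
by split=> [|[]//]; split=> [[|? ?]|[|? ?]] * //=; rewrite scaler0 addr0.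
Qed.

Lemma detp_multialt l : multialt (fun s => detp s l).
Proof.
split=> [s1 s2 a v w|s1 s2 v].
  elim: s1 l => [|x s1 IHs] l /=; last first.
    by rewrite -koszulD; [exact: koszul_ext | exact: evop_bilin].
  elim: l (detp s2) => [|y l IHl] f /=; first by rewrite scaler0 addr0.
  by rewrite IHl /evop /scalop linearP scalerDl scalerBr opprD addrACA scalerA.
elim: s1 l => [|x s1 IHs] l /=; last exact: koszul0 (evop_bilin _ _) IHs.
apply: koszul_sq; first exact: evop_bilin.
exact/scalop_comm/evop_bilin.
Qed.

Lemma detp_contract s w l :
  detp s (w :: l) = koszul (scalop (w : V -> k)) (fun s' => detp s' l) s.
Proof.
elim: s l => [|v s IHs] l //=; congr (_ - _).
rewrite -koszul_exchange; [exact: koszul_ext|exact: evop_bilin|exact: dualop_bilin|].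
by move=> x y z; rewrite /evop /scalop !scalerA mulrC.
Qed.

End DetPairing.

Section RestrictedLinear.
Variables (k : fieldType) (E : algType k) (P N : lmodType E) (f : {linear P -> N}).

Lemma resk_linear : linear (f : resk P -> resk N).
Proof. by move=> c x y; apply: linearP. Qed.

Lemma resk_linearZ (c : k) (x : resk P) : f (c *: x) = c *: (f x : resk N) :> resk N.
Proof. by have [g gE] := linear_pack resk_linear; rewrite -!gE linearZ. Qed.

End RestrictedLinear.

Section Resolution.
Variables (k : fieldType) (V : vectType k) (E : algType k) (T : V -> E).
Hypothesis T_lin : linear T.
Hypothesis T_comm : forall v w, T v * T w = T w * T v.
Local Notation W := (dualv V).
Local Notation dimV := (\dim (fullv : {vspace V})).
Local Notation e_ i := ((vbasis (fullv : {vspace V}))`_i).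

(** E (x) Lambda^p V is encoded as the module of alternating p-forms on V^* with
    values in E. *)
Definition kchain_pred (p : nat) : {pred seq W -> E^o} :=
  fun f => `[< isalt p (f : seq W -> E) >].
Fact kchain_closed p : submod_closed (kchain_pred p).
Proof.
split=> [|a f g]; rewrite ?unfold_in /kchain_pred; first exact/asboolP/isalt0.
move=> /asboolP fa /asboolP ga; apply/asboolP.
have aL : linear (fun x : E => a * x) by move=> c x y; rewrite mulrDr scalerAr.
by apply: isalt_ext (isaltD 1 (isalt_post aL fa) ga) => s; rewrite scale1r.
Qed.
HB.instance Definition _ p :=
  GRing.isSubmodClosed.Build E (seq W -> E^o) (kchain_pred p) (kchain_closed p).

Definition kchain p : lmodType E := submod (kchain_pred p).
Definition kval p (x : kchain p) : seq W -> E := val x.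

Lemma kval_isalt p (x : kchain p) : isalt p (kval x).
Proof. exact: (asboolW (valP x)). Qed.

Lemma kval_inj p : injective (@kval p).
Proof. exact: val_inj. Qed.

Lemma kval_lin p (a : E) (x y : kchain p) l :
  kval (a *: x + y) l = a * kval x l + kval y l.
Proof. by []. Qed.

Lemma kvalD p (x y : kchain p) l : kval (x + y) l = kval x l + kval y l.
Proof. by rewrite -[x]scale1r kval_lin scale1r mul1r. Qed.

Lemma kval0 p l : kval (0 : kchain p) l = 0.
Proof. by apply: (addrI (kval (0 : kchain p) l)); rewrite -kvalD !addr0. Qed.

Lemma kvalZ p (a : E) (x : kchain p) l : kval (a *: x) l = a * kval x l.
Proof. by rewrite -[a *: x]addr0 kval_lin kval0 addr0. Qed.

Lemma kval_resk p (a : k) (x y : resk (kchain p)) l :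
  kval (a *: x + y : resk (kchain p)) l = a%:A * kval x l + kval y l.
Proof. exact: (kval_lin a%:A). Qed.

Lemma kval_op (p q : nat) (F : (seq W -> E) -> (seq W -> E)) :
  (forall f, isalt p f -> isalt q (F f)) ->
  (forall (a : E) f g l, isalt p f -> isalt p g ->
     F (fun s => a * f s + g s) l = a * F f l + F g l) ->
  exists G : {linear kchain p -> kchain q}, forall x l, kval (G x) l = F (kval x) l.
Proof.
move=> Fa Fl.
have FP (x : kchain p) : F (kval x) \in kchain_pred q.
  by apply/asboolP/Fa; apply: kval_isalt.
have [|G GE] := @linear_pack E (kchain p) (kchain q) (fun x => (Sub (F (kval x)) (FP x) : submod (kchain_pred q))).
  move=> a x y; apply: kval_inj; apply/funext => l.
  by rewrite kval_lin /kval !SubK -Fl //; apply: kval_isalt.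
by exists G => x l; rewrite GE /kval SubK.
Qed.

(** The contraction with the element sum_i dcoord_i (x) T e_i, the tensor that
    corresponds to T. *)
Definition kbdry (f : seq W -> E) (l : seq W) : E :=
  \sum_i f (dcoord i :: l) * T (e_ i).

Lemma isalt_sum (U X : lmodType k) p (I : Type) (r : seq I) (f : I -> seq U -> X) :
  (forall i, isalt p (f i)) -> isalt p (fun s => \sum_(i <- r) f i s).
Proof.
move=> fa; elim: r => [|i r IHr].
  by under eq_fun => s do rewrite big_nil; apply: isalt0.
by apply: isalt_ext (isaltD 1 (fa i) IHr) => s; rewrite big_cons scale1r.
Qed.

Lemma kbdry_isalt p f : isalt p.+1 f -> isalt p (kbdry f).
Proof.
move=> fa; apply: isalt_sum => i.
apply: (isalt_post (L := fun x : E => x * T (e_ i))) (isaltS _ fa).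
by move=> c x y; rewrite mulrDl scalerAl.
Qed.

Lemma kbdryD (a : E) f g l :
  kbdry (fun s => a * f s + g s) l = a * kbdry f l + kbdry g l.
Proof.
rewrite /kbdry mulr_sumr -big_split; apply: eq_bigr => i _ /=.
by rewrite mulrDl mulrA.
Qed.

Definition kd p : {linear kchain p.+1 -> kchain p} :=
  sval (cid (kval_op (@kbdry_isalt p) (fun a f g l _ _ => kbdryD a f g l))).

Lemma kdE p (x : kchain p.+1) l : kval (kd p x) l = kbdry (kval x) l.
Proof. by rewrite /kd; case: cid => F /= ->. Qed.

Definition kgen_fun p (s : seq V) (l : seq W) : E :=
  if size s == p then (detp s l)%:A else 0.

Lemma kgen_subproof p s : kgen_fun p s \in kchain_pred p.
Proof.
apply/asboolP; rewrite /kgen_fun; case: eqP => [<-|_]; last exact: isalt0.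
apply: (isalt_post (L := fun c : k^o => c%:A : E)) (detp_isalt s).
by move=> c x y; rewrite scalerDl scalerA.
Qed.

(** The universal alternating map from V^p to the p-th term: kchain_ext and
    kchain_lift are its universal property, which takes the place of a basis
    of E (x) Lambda^p V. *)
Definition kgen p (s : seq V) : kchain p :=
  (Sub (kgen_fun p s) (kgen_subproof p s) : submod (kchain_pred p)).

Lemma kgenE p s l : kval (kgen p s) l = kgen_fun p s l.
Proof. by rewrite /kval SubK. Qed.

Lemma kgen_isalt p : isalt p (kgen p : seq V -> resk (kchain p)).
Proof.
split; last first.
  move=> s sp; apply: kval_inj; apply/funext => l.
  by rewrite kgenE /kgen_fun (negPf sp).
split=> [s1 s2 a v w|s1 s2 v]; apply: kval_inj; apply/funext => l; last first.
  rewrite kgenE /kgen_fun; case: eqP => // _.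
  by rewrite (detp_multialt l).2 scale0r.
rewrite kval_resk !kgenE /kgen_fun !size_cat /=; case: eqP => _; last by rewrite mulr0 addr0.
by rewrite (detp_multialt l).1 scalerDl mulr_algl scalerA.
Qed.

Lemma kgen_contract p s w l :
  kgen_fun p.+1 s (w :: l) = koszul (scalop (w : V -> k)) (fun r => kgen_fun p r l) s.
Proof.
rewrite [LHS]/kgen_fun; case: eqP => [sp|/eqP sp].
  rewrite detp_contract.
  rewrite (koszul_post (t' := scalop (w : V -> k)) (L := fun c : k^o => c%:A : E)).
  - apply: koszul_ext_size => r; rewrite sp => -[rp].
    by rewrite /kgen_fun rp eqxx.
  - by move=> x y; rewrite scalerBl.
  - by move=> v x; rewrite /scalop scalerA.
apply/esym/(koszul_supp (D := pred1 p.+1)) => //; first exact: dualop_bilin.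
by move=> r rp; rewrite /kgen_fun; case: eqP => // rE; rewrite rE /= eqxx in rp.
Qed.

Lemma kval_koszul p (N : seq V -> kchain p) (t : V -> kchain p -> kchain p) (t' : V -> E -> E) s l :
  (forall v x, kval (t v x) l = t' v (kval x l)) ->
  kval (koszul t N s) l = koszul t' (fun r => kval (N r) l) s.
Proof. by move=> tt'; apply: (koszul_post (L := fun x => kval x l)). Qed.

Definition Tact (N : lmodType E) (v : V) (x : N) : N := T v *: x.

Lemma Tact_bilin (N : lmodType E) : bilinop (Tact (N := N) : V -> resk N -> resk N).
Proof.
rewrite /Tact; split=> [a v w x|v a x y].
  by rewrite T_lin scalerDl -[a *: T v]mulr_algl -scalerA.
rewrite -[a *: x : resk N]/(a%:A *: (x : N)) scalerDr scalerA.
by rewrite mulr_algr -mulr_algl -scalerA.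
Qed.

Lemma Tact_comm (N : lmodType E) : commop (Tact (N := N) : V -> resk N -> resk N) (Tact (N := N)).
Proof. by move=> v w x; rewrite /Tact !scalerA T_comm. Qed.

(** The values of f are central, which lets the right multiplication by T in
    the boundary of chains become the left multiplication of cochains. *)
Lemma koszul_coords (f : seq V -> E) (c : seq V -> k) s : (forall r, f r = (c r)%:A) ->
  \sum_i koszul (scalop (dcoord i : V -> k)) f s * T (e_ i) = koszul (fun v x => T v * x) f s.
Proof.
elim: s f c => [|v s IHs] f c fc /=; first by rewrite big1 // => i _; rewrite mul0r.
under eq_bigr => i _ do rewrite mulrBl.
rewrite sumrB (IHs _ (fun r => c (v :: r))) //; congr (_ - _).
have [_ _ vE] := vbasis_dual V.
rewrite {2}[v]vE fc mulr_algr.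
have [T' T'E] := linear_pack T_lin; rewrite -T'E linear_sum scaler_sumr.
apply: eq_bigr => i _; rewrite linearZ /= T'E /scalop lfunE /= scalerA.
by rewrite mulr_algl scalerA mulrC.
Qed.

Lemma kd_gen p s : kd p (kgen p.+1 s) = koszul (Tact (N := kchain p)) (kgen p) s.
Proof.
apply: kval_inj; apply/funext => l; rewrite kdE /kbdry.
rewrite (@kval_koszul _ _ _ (fun v x => T v * x)) //.
under eq_bigr => i _ do rewrite kgenE kgen_contract.
under [RHS]koszul_ext => [v x|r] do [|rewrite kgenE].
have gE r : kgen_fun p r l = (if size r == p then detp r l else 0)%:A.
  by rewrite /kgen_fun; case: eqP; rewrite // scale0r.
apply: koszul_coords gE.
Qed.

Lemma kchain_mk p (f : seq W -> E) : isalt p f -> exists x : kchain p, kval x = f.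
Proof.
move=> /asboolP fP; exists (Sub f fP : submod (kchain_pred p)); exact: SubK.
Qed.

Lemma kwedge p (v : V) :
  exists G : {linear kchain p -> kchain p.+1},
    forall x l, kval (G x) l = koszul (evop v) (kval x) l.
Proof.
apply: (kval_op (F := koszul (evop v))) => [f|a f g l _ _].
  exact/koszul_isalt/evop_bilin.
have aE (f' : seq W -> E) : a * koszul (evop v) f' l = koszul (evop v) (fun s => a * f' s) l.
  apply: (koszul_post (L := fun x : E => a * x)) => [x y|w x]; first by rewrite mulrBr.
  by rewrite /evop /scalop scalerAr.
rewrite aE -[X in X + _]scale1r -koszulD; last exact: evop_bilin.
by apply: koszul_ext => // r; rewrite scale1r.
Qed.

Lemma kcontract p (w : W) :
  exists G : {linear kchain p.+1 -> kchain p},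
    forall x l, kval (G x) l = kval x (w :: l).
Proof. by apply: (kval_op (F := fun f l => f (w :: l))) => // f; apply: isaltS. Qed.

Lemma kchain0E (y : kchain 0) : y = kval y [::] *: kgen 0 [::].
Proof.
apply: kval_inj; apply/funext => l; rewrite kvalZ kgenE /kgen_fun /=.
case: l => [|w l]; first by rewrite scale1r mulr1.
by rewrite scale0r mulr0 (kval_isalt y).2.
Qed.

Lemma kchain_ext p (N : lmodType E) (f g : {linear kchain p -> N}) :
  (forall s, f (kgen p s) = g (kgen p s)) -> f =1 g.
Proof.
move=> fg x.
pose P q (h : seq W -> E) := isalt q h /\ forall (y : kchain q), kval y = h ->
  forall (N : lmodType E) (f g : {linear kchain q -> N}),
    (forall s, f (kgen q s) = g (kgen q s)) -> f y = g y.
suff [_ h] : P p (kval x) by apply: h.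
have := kval_isalt x; apply: (alt_ind (dual_dual V)) => {N f g fg p x} [h h0|p|p h h'|p h i ha].
- split=> // y yE N f g fg.
  rewrite [y]kchain0E.
  by rewrite !linearZ fg.
- split=> [|y y0 N f g _]; first exact: isalt0.
  have -> : y = 0 by apply: kval_inj; rewrite y0; apply/funext => l; rewrite kval0.
  by rewrite !linear0.
- move=> [ha hP] [ha' hP']; split=> [|y yE N f g fg].
    by apply: isalt_ext (isaltD 1 ha ha') => s; rewrite scale1r.
  have [z zE] := kchain_mk ha; have [z' zE'] := kchain_mk ha'.
  have -> : y = z + z' by apply: kval_inj; apply/funext => l; rewrite kvalD yE zE zE'.
  by rewrite !linearD (hP _ zE _ _ _ fg) (hP' _ zE' _ _ _ fg).
- move=> [_ hP]; split=> [|y yE N f g fg].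
    exact: koszul_isalt (evop_bilin _ _) ha.
  have [z zE] := kchain_mk ha; have [G GE] := kwedge p (e_ i).
  have -> : y = G z by apply: kval_inj; apply/funext => l; rewrite GE yE zE.
  apply: (hP z zE N (f \o G) (g \o G)) => s /=.
  have -> : G (kgen p s) = if size s == p then kgen p.+1 (e_ i :: s) else 0.
    apply: kval_inj; apply/funext => l; rewrite GE.
    case: ifP => sp.
      rewrite kgenE /kgen_fun /= eqSS sp.
      rewrite (koszul_post (t' := evop (e_ i)) (L := fun c : k^o => c%:A : E)).
      - by apply: koszul_ext => // r; rewrite kgenE /kgen_fun sp.
      - by move=> u v; rewrite scalerBl.
      - by move=> u v; rewrite /evop /scalop scalerA.
    apply: koszul0 => [|r]; first exact: evop_bilin.
    by rewrite kgenE /kgen_fun sp.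
  by case: ifP => _; rewrite ?fg // !linear0.
Qed.

Lemma kchain_lift p (N : lmodType E) (a : seq V -> resk N) : isalt p a ->
  exists f : {linear kchain p -> N}, forall s, f (kgen p s) = a s.
Proof.
pose P q (b : seq V -> resk N) :=
  exists f : {linear kchain q -> N}, forall s, f (kgen q s) = b s.
move=> aa; apply: (alt_ind (vbasis_dual V) (P := P) _ _ _ _ aa) => {p a aa}
  [a a0|p|p a b [f fE] [g gE]|p a i aa [f fE]].
- have [|f fE] := @linear_pack E (kchain 0) N (fun x => kval x [::] *: (a [::] : N)).
    by move=> c x y; rewrite kval_lin scalerDl scalerA.
  exists f => s; rewrite fE kgenE /kgen_fun; case: s => [|v s] /=.
    by rewrite !scale1r.
  by rewrite scale0r a0.2.
- by have [f fE] := linear_null (kchain p) N; exists f => s; rewrite fE.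
- have [|h hE] := @linear_pack E (kchain p) N (fun x => f x + g x).
    by move=> c x y; rewrite !linearP scalerDr addrACA.
  by exists h => s; rewrite hE fE gE.
have [G GE] := kcontract p (dcoord i); exists (f \o G) => s /=.
have -> : G (kgen p.+1 s) =
    koszul (scalop (X := resk (kchain p)) (dcoord i : V -> k)) (kgen p) s.
  apply: kval_inj; apply/funext => l; rewrite GE kgenE kgen_contract.
  rewrite (@kval_koszul _ _ _ (scalop (dcoord i : V -> k))).
    by apply: koszul_ext => // r; rewrite kgenE.
  by move=> v x; rewrite /scalop; rewrite (kvalZ (_%:A)) mulr_algl.
rewrite (koszul_post (t' := scalop (X := resk N) (dcoord i : V -> k))).
- by apply: koszul_ext => [v x|r]; rewrite /scalop ?lfunE ?fE.
- by move=> x y; rewrite linearB.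
- by move=> v x; apply: resk_linearZ.
Qed.

(** Only constants have to be lifted, by alt_ind.  With the universal property
    of kgen this makes the terms of the Koszul complex projective. *)
Lemma alt_surj p (U N : lmodType E) (q_ : {linear U -> N}) (a : seq V -> resk N) :
  (forall y, exists x, q_ x = y) -> isalt p a ->
  exists b : seq V -> resk U, isalt p b /\ forall s, q_ (b s) = a s.
Proof.
move=> q_surj.
pose P q (b : seq V -> resk N) :=
  exists c : seq V -> resk U, isalt q c /\ forall s, q_ (c s) = b s.
move=> aa; apply: (alt_ind (vbasis_dual V) (P := P) _ _ _ _ aa) => {p a aa}
  [a a0|p|p a b [f [fa fE]] [g [ga gE]]|p a i aa [f [fa fE]]].
- have [x xE] := q_surj (a [::]).
  exists (fun s => if s is [::] then x else 0); split=> [|[|v s] //]; last first.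
    by rewrite linear0 a0.2.
  by split=> [|[]//]; split=> [[|? ?]|[|? ?]] * //=; rewrite scaler0 addr0.
- by exists (fun _ : seq V => 0 : resk U); split=> [|s]; [apply: isalt0 | rewrite linear0].
- exists (fun s => (f s : resk U) + g s); split=> [|s]; last by rewrite linearD fE gE.
  by apply: isalt_ext (isaltD 1 fa ga) => s; rewrite scale1r.
exists (koszul (scalop (coord (vbasis fullv) i)) f); split.
  by apply: koszul_isalt fa; apply: scalop_bilin => c v w; rewrite linearP.
move=> s; rewrite (koszul_post (t' := scalop (X := resk N) (coord (vbasis fullv) i))).
- by apply: koszul_ext => // r; rewrite fE.
- by move=> x y; rewrite linearB.
- by move=> v x; apply: resk_linearZ.
Qed.

Lemma isalt_lin p (P N : lmodType E) (f : {linear P -> N}) (a : seq V -> resk P) :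
  isalt p a -> isalt p (fun s => f (a s) : resk N).
Proof. exact: isalt_post (resk_linear f). Qed.

Lemma kchain_projective p : projective (kchain p).
Proof.
move=> U N q f q_surj.
have [b [ba bE]] := alt_surj q_surj (isalt_lin f (kgen_isalt p)).
have [g gE] := kchain_lift ba; exists g.
by apply: (kchain_ext (f := q \o g)) => s /=; rewrite gE bE.
Qed.

Lemma kdkd p x : kd p (kd p.+1 x) = 0.
Proof.
have [z zE] := linear_null (kchain p.+2) (kchain p).
rewrite -[RHS](zE x); apply: (kchain_ext (f := kd p \o kd p.+1)) => s /=.
rewrite zE kd_gen (koszul_post (t' := Tact (N := kchain p))).
- rewrite (koszul_ext (f' := koszul (Tact (N := kchain p)) (kgen p)) (t' := Tact (N := kchain p))) //.
    exact: (koszul_sq _ _ (Tact_bilin (kchain p)) (Tact_comm (N := kchain p))).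
  by move=> r; rewrite kd_gen.
- by move=> u v; rewrite linearB.
- by move=> v u; rewrite /Tact linearZ.
Qed.

Hypothesis T_div : forall j : 'I_dimV, exists s : {linear E -> E},
  (forall x : E, s (x * T (e_ j)) = x) /\
  (forall i (x : E), i != j -> s (x * T (e_ i)) = s x * T (e_ i)).

(** Dividing the coefficients by T e_j and wedging with e_j is a homotopy: up to
    a boundary, a cycle is determined by its restriction to the covectors that
    vanish on e_j. *)
Lemma kbdry_homotopy j p f : isalt p.+1 f -> (forall l, kbdry f l = 0) ->
  exists g (L : E -> E), [/\ isalt p.+2 g, linear L &
    forall l, f l = kbdry g l +
       L (f (map (projalong (dcoord j) (fun w : W => w (e_ j))) l))].
Proof.
move=> fa f0; have [s [sj si]] := T_div j; pose t := evop (X := E) (e_ j).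
have tb : bilinop t by apply: evop_bilin.
exists (fun l => s (koszul t f l)), (fun x => x - s x * T (e_ j)).
split.
- exact: (isalt_post (linearP s)) (koszul_isalt tb fa).
- by move=> c x y; rewrite linearP mulrDl scalerBr scalerAl opprD addrACA.
move=> l.
have evl a (w w' : W) : (a *: w + w') (e_ j) = a * w (e_ j) + w' (e_ j) by rewrite !lfun_simp.
pose K i := koszul t (fun r => f (dcoord i :: r)) l.
have := alt_split (dcoord j) l evl fa.1; rewrite -/(K j); set f1 := f (map _ l) => fE.
have wE (i : 'I_dimV) : (dcoord i : W) (e_ j) = (i == j)%:R.
  by have [_ h _] := dual_dual V; rewrite h eq_sym.
have tE v x : t v x = v (e_ j) *: x by [].
have KF (F : 'I_dimV -> seq W -> E) : \sum_i koszul t (F i) l * T (e_ i) =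
    koszul t (fun r => \sum_i F i r * T (e_ i)) l.
  elim: l F {K f1 fE} => [|v l IHl] F /=; first by rewrite big1 // => i _; rewrite mul0r.
  rewrite -(IHl (fun i r => F i (v :: r))) tE scaler_sumr -sumrB; apply: eq_bigr => i _.
  by rewrite mulrBl tE scalerAl.
have K0 : \sum_i K i * T (e_ i) = 0 by rewrite /K KF; apply: koszul0.
rewrite /kbdry (bigD1 j) //= -/(K j) tE wE eqxx scale1r {2}fE addrK.
rewrite (eq_bigr (fun i => - s (K i * T (e_ i)))) => [|i ij]; last first.
  by rewrite tE wE (negPf ij) scale0r sub0r linearN mulNr si.
rewrite sumrN -linear_sum addrAC.
have -> : \sum_(i | i != j) K i * T (e_ i) = - (K j * T (e_ j)).
  by move: K0; rewrite (bigD1 j) //= addrC => /eqP; rewrite addr_eq0 => /eqP.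
by rewrite linearN /= sj opprK [_ + (f1 - _)]addrC subrK.
Qed.

(** Acyclicity in positive degree: kbdry_homotopy removes the coordinates one
    after another, until the cycle is evaluated on zero covectors.  The linear
    map L in the induction collects the remainders of the divisions. *)
Lemma kchain_exact p (x : kchain p.+1) : kd p x = 0 -> exists y, x = kd p.+1 y.
Proof.
move=> dx0.
suff h q f : isalt q.+1 f -> (forall l, kbdry f l = 0) ->
    exists g, isalt q.+2 g /\ forall l, f l = kbdry g l.
  have [|g [ga gE]] := h p _ (kval_isalt x).
    by move=> l; rewrite -kdE dx0 kval0.
  have [y yE] := kchain_mk ga; exists y; apply: kval_inj; apply/funext => l.
  by rewrite kdE yE.
have bb g l : isalt q.+2 g -> kbdry (kbdry g) l = 0.
  move=> /kchain_mk[y yE]; have := kdkd y; move=> /(congr1 (fun z => kval z l)).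
  rewrite kdE kval0 -yE => <-; congr (kbdry _ l).
  by apply/funext => r; rewrite kdE.
pose Q (f : seq W -> E) := forall L : E -> E, linear L -> (forall l, kbdry (fun s => L (f s)) l = 0) ->
  exists g, isalt q.+2 g /\ forall l, L (f l) = kbdry g l.
move=> fa f0; suff : Q f by move=> /(_ id) h; apply: h => //.
apply: (proj_elim (dual_dual V) (Q := Q) _ _ fa) => [j g ga Qg L Ll L0|L Ll _]; last first.
  have L00 : L 0 = 0 by have := Ll (-1) 0 0; rewrite scaler0 addr0 scaleN1r addNr.
  exists (fun=> 0); split=> [|l]; first exact: isalt0.
  by rewrite L00 /kbdry big1 // => i _; rewrite mul0r.
have [u [M [ua Ml LE]]] := kbdry_homotopy j (isalt_post Ll ga) L0.
have [||v [va vE]] := Qg (fun x => M (L x)).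
- by move=> c a b; rewrite Ll Ml.
- move=> l.
  have -> : (fun s => M (L (g (map (projalong (dcoord j) (fun w : W => w (e_ j))) s)))) =
            (fun s => (-1) * kbdry u s + L (g s)).
    by apply/funext => s; rewrite [in RHS]LE mulN1r addKr.
  by rewrite kbdryD bb // L0 mulr0 addr0.
exists (fun s => u s + v s); split=> [|l].
  by apply: isalt_ext (isaltD 1 ua va) => s; rewrite scale1r.
rewrite LE vE; have := kbdryD 1 u v l; rewrite mul1r => <-; congr (kbdry _ l).
by apply/funext => s; rewrite mul1r.
Qed.

End Resolution.

(** * From the standard resolution to invariant Koszul cochains *)

Section Cocycles.
Variables (k : comNzRingType) (V X : lmodType k) (t : V -> X -> X).

(** The condition on sizes is that h is of degree n - 1, which leaves only 0
    when n = 0. *)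
Definition kcob (n : nat) (w : seq V -> X) : Prop :=
  exists h : seq V -> X, [/\ multialt h, forall s, (size s).+1 != n -> h s = 0
                           & forall s, w s = koszul t h s].

Lemma kcob_ext n w w' : w =1 w' -> kcob n w -> kcob n w'.
Proof. by move=> /funext ->. Qed.

Hypothesis tb : bilinop t.

Lemma kcobD n a w w' : kcob n w -> kcob n w' -> kcob n (fun s => a *: w s + w' s).
Proof.
move=> [h [ha hs hE]] [h' [ha' hs' hE']]; exists (fun s => a *: h s + h' s); split.
- exact: multialtD.
- by move=> s sn; rewrite hs // hs' // scaler0 addr0.
- by move=> s; rewrite hE hE' koszulD.
Qed.

Lemma kcob0 n : kcob n (fun=> 0).
Proof. by exists (fun=> 0); split=> [||s]; rewrite ?koszul0 //; apply: multialt0. Qed.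

Lemma kcobS n w : kcob n.+1 w <-> exists2 h, isalt n h & forall s, w s = koszul t h s.
Proof.
by split=> [[h [ha hs hE]]|[h [ha hs] hE]]; exists h => //; split.
Qed.

Lemma kcob_deg0 w : kcob 0 w -> forall s, w s = 0.
Proof. by move=> [h [_ hs hE]] s; rewrite hE koszul0 // => r; apply: hs. Qed.

End Cocycles.

Section ComparisonWithKoszul.
Variables (k : fieldType) (V : vectType k) (gT : finGroupType) (rho : linrep V gT).
Hypothesis card_unit : (#|gT|%:R : k) \is a GRing.unit.
Local Notation A := (sym V).
Local Notation B := (smash rho).
Local Notation E := (envalg B).
Local Notation M := (bimod B).
Local Notation T := (@tdiff k V gT rho).
Local Notation P := (stdres M).
Local Notation Q := (kchain V E).
Local Notation dQ := (kd T).
Local Notation DT N := (@koszul k V (resk N) (@Tact k V E T N)).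
Local Notation gen := (@kgen k V E).
Local Notation gen0 := (gen 0%N [::]).

Definition avg (X : lmodType k) (F : gT -> X) : X := #|gT|%:R^-1 *: \sum_h F h.

(** The separability element |G|^-1 sum_h h (x) h^-1 of k[G].  It commutes with
    B up to boundaries (sepid_central) and fixes 1 in B (sepid_act1), so m goes
    to m sepid splits the multiplication B (x)_S(V) B -> B. *)
Definition sepid : E := avg (@gdiag k V gT rho).

Let dQgen p s : dQ p (gen p.+1 s) = koszul (Tact T (N := Q p)) (gen p) s.
Proof. by apply: kd_gen; apply: tdiff_lin. Qed.

(** Membership in the left ideal generated by the T v. *)
Definition bound0 (x : E) : Prop := exists y, x *: gen0 = dQ 0 y.

Lemma bound0D x y : bound0 x -> bound0 y -> bound0 (x + y).
Proof. by move=> [u uE] [v vE]; exists (u + v); rewrite linearD scalerDl uE vE. Qed.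

Lemma bound0M a x : bound0 x -> bound0 (a * x).
Proof. by move=> [u uE]; exists (a *: u); rewrite linearZ -scalerA uE. Qed.

Lemma bound0T v : bound0 (T v).
Proof. by exists (gen 1 [:: v]); rewrite dQgen /= subr0. Qed.

Lemma bound0_0 : bound0 0.
Proof. by exists 0; rewrite scale0r linear0. Qed.

Lemma bound0Z (c : k) x : bound0 x -> bound0 (c *: x).
Proof. by rewrite -mulr_algl; apply: bound0M. Qed.

Let dif (a : A) : E := ten (sm rho a 1%g) 1 - ten 1 (sm rho a 1%g).

Lemma bound0_dif a : bound0 (dif a).
Proof.
elim/sym_ind: a => [c|p q bp bq|p q bp bq|v]; last exact: bound0T.
- by rewrite /dif smZ sm1 tenZl tenZr subrr; apply: bound0_0.
- have -> : dif (p + q) = dif p + dif q; last exact: bound0D.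
  by rewrite /dif smD tenDl tenDr opprD addrACA.
have -> : dif (p * q) = ten (sm rho p 1%g) 1 * dif q + ten 1 (sm rho q 1%g) * dif p.
  rewrite /dif !mulrBr !ten_mul !mulr1 !mul1r !sm_mul rep_fun1 !sym_map_id mulg1.
  by rewrite addrA subrK.
by apply: bound0D; apply: bound0M.
Qed.

Lemma mulr_avg (c : E) F : c * avg F = avg (fun h => c * F h).
Proof. by rewrite /avg -scalerAr mulr_sumr. Qed.

Lemma bound0_avg F : (forall h, bound0 (F h)) -> bound0 (avg F).
Proof.
move=> Fb; apply: bound0Z; elim/big_ind: _ => //; first exact: bound0_0.
exact: bound0D.
Qed.

Lemma avgB (X : lmodType k) (F F' : gT -> X) : avg F - avg F' = avg (fun h => F h - F' h).
Proof. by rewrite /avg sumrB scalerBr. Qed.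

Lemma avg_reindex (X : lmodType k) (F : gT -> X) (p : gT -> gT) :
  injective p -> avg (fun h => F (p h)) = avg F.
Proof. by move=> pi; rewrite /avg [in RHS](reindex_inj pi). Qed.

Lemma avg_const (X : lmodType k) (x : X) : avg (fun=> x) = x.
Proof.
rewrite /avg sumr_const -scaler_nat scalerA mulVr ?scale1r //.
Qed.

Lemma sepid_g h : ten 1 (sm rho 1 h) * sepid = ten (sm rho 1 h) 1 * sepid.
Proof.
rewrite /sepid !mulr_avg -[LHS](avg_reindex _ (mulgI h)); congr avg.
apply/funext => g; rewrite /gdiag !ten_mul !mul1r !mulr1 !sm_mul !rmorph1 !mulr1.
by rewrite invMg -mulgA mulVg mulg1.
Qed.

Lemma sepid_a a :
  bound0 (ten 1 (sm rho a 1%g) * sepid - ten (sm rho a 1%g) 1 * sepid).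
Proof.
rewrite /sepid !mulr_avg avgB; apply: bound0_avg => g.
have -> : ten 1 (sm rho a 1%g) * gdiag rho g - ten (sm rho a 1%g) 1 * gdiag rho g =
    (- gdiag rho g) * dif (sym_map (rho g^-1%g) a).
  rewrite /dif /gdiag mulNr mulrBr opprB !ten_mul !mul1r !mulr1 !sm_mul.
  by rewrite sym_mapKV !mul1r !rmorph1 !mulr1 !mulg1 !mul1g ?rep_fun1 ?sym_map_id ?mul1r.
exact/bound0M/bound0_dif.
Qed.

(** The average commutes with G by reindexing, and with S(V) because h (x) h^-1
    transports the boundary elements a (x) 1 - 1 (x) a to each other. *)
Lemma sepid_central d : bound0 (ten 1 d * sepid - ten d 1 * sepid).
Proof.
rewrite [d]sm_sum.
have [L LE] : exists L : {linear B -> E}, L =1 (fun d => ten 1 d * sepid - ten d 1 * sepid).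
  apply: linear_pack => c u v; rewrite ten_linl ten_linr !mulrDl -!scalerAl.
  by rewrite scalerBr opprD addrACA.
rewrite -LE linear_sum; elim/big_ind: _ => [||h _]; [exact: bound0_0|exact: bound0D|].
rewrite LE; have {1 2}-> : sm rho (d h) h = sm rho (d h) 1%g * sm rho 1 h.
  by rewrite sm_mul mul1g rmorph1 mulr1.
set a := sm rho (d h) 1%g.
have -> : ten 1 (a * sm rho 1 h) * sepid - ten (a * sm rho 1 h) 1 * sepid =
    ten 1 (sm rho 1 h) * (ten 1 a * sepid - ten a 1 * sepid).
  rewrite mulrBr !mulrA !ten_mul !mul1r; congr (_ - _).
  have -> : ten a (sm rho 1 h) = ten a 1 * ten 1 (sm rho 1 h) by rewrite ten_mul !mulr1.
  by rewrite -mulrA sepid_g mulrA ten_mul mulr1.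
exact/bound0M/sepid_a.
Qed.

Lemma sepid_act1 : sepid *: (1 : M) = 1 :> B.
Proof.
have [L LE] : exists L : {linear E -> B}, L =1 (fun x => (x *: (1 : M) : B)).
  apply: linear_pack => c x y; rewrite scalerDl; congr (_ + _).
  by rewrite -mulr_algl -scalerA; apply: resk_bimodE.
rewrite -LE /sepid /avg linearZ linear_sum /= -[RHS](avg_const (1 : B)) /avg.
congr (_ *: _); apply: eq_bigr => h _; rewrite LE /gdiag ten_act mulr1 sm_mul.
by rewrite mul1r mulgV rmorph1 sm1.
Qed.

Let aug := stdres_aug M.

Lemma augE (m : M) : aug (ugen _ m) = m.
Proof. by rewrite /aug /stdres_aug /free_counit /= ulinE. Qed.

(** So m goes to m sepid is a map of bimodules modulo boundaries. *)
Lemma bound0_act x (m : B) :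
  bound0 (x * ten m 1 * sepid - ten ((x *: (m : M) : M) : B) 1 * sepid).
Proof.
elim/E_ind: x => [|c d x IH].
  rewrite !mul0r scale0r; have -> : ten (0 : B) (1 : B) = 0 :> E by exact: tens0l.
  by rewrite mul0r subrr; apply: bound0_0.
have -> : ((ten c d + x) *: (m : M) : M) = (c * m * d : B) + ((x *: (m : M) : M) : B) :> B.
  by rewrite scalerDl; congr (_ + _); apply: ten_act.
rewrite tenDl !mulrDl opprD addrACA; apply: bound0D => //.
have -> : ten c d * ten m 1 * sepid - ten (c * m * d) 1 * sepid =
    ten (c * m) 1 * (ten 1 d * sepid - ten d 1 * sepid).
  by rewrite mulrBr !mulrA !ten_mul !mulr1 mul1r.
exact/bound0M/sepid_central.
Qed.

Lemma tdiff_act1 v : T v *: (1 : M) = 0.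
Proof.
rewrite /tdiff scalerBl; apply/eqP; rewrite subr_eq0; apply/eqP.
by rewrite !ten_act !mulr1 !mul1r.
Qed.

Lemma aug_dQ0 (f : {linear Q 0 -> P 0}) : aug (f gen0) = 1 :> B ->
  forall x, aug (f (dQ 0 x)) = 0.
Proof.
move=> f1 x; have [z zE] := linear_null (Q 1) M.
rewrite -[RHS](zE x); apply: (kchain_ext (f := aug \o f \o dQ 0)) => s /=; rewrite zE.
have [|sp] := eqVneq (size s) 1%N; last first.
  by rewrite (kgen_isalt V E 1).2 // !linear0.
case: s => [|v [|w s]] // _; rewrite dQgen /= subr0 /Tact !linearZ f1.
exact: tdiff_act1.
Qed.

Section Average.
Variable N : lmodType E.
Implicit Types w : seq V -> resk N.

Definition diagact (h : gT) w : seq V -> resk N :=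
  fun s => gdiag rho h *: (w (map (rho h^-1%g) s) : N).
Definition avgact w : seq V -> resk N := fun s => avg (fun h => diagact h w s).

Lemma gdiag_lin h : linear (fun x : resk N => gdiag rho h *: (x : N) : resk N).
Proof.
move=> c x y; rewrite scalerDr; congr (_ + _).
by rewrite -[c *: x : resk N]/(c%:A *: (x : N)) scalerA mulr_algr -mulr_algl -scalerA.
Qed.

Lemma diagact_isalt p h w : isalt p w -> isalt p (diagact h w).
Proof.
move=> wa; apply: (isalt_post (gdiag_lin h)).
by apply: isalt_pre wa => c x y; rewrite linearP.
Qed.

Lemma avgact_isalt p w : isalt p w -> isalt p (avgact w).
Proof.
move=> wa; apply: (isalt_post (L := fun x : resk N => #|gT|%:R^-1 *: x)).
  by move=> c x y; rewrite scalerDr !scalerA mulrC.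
by apply: isalt_sum => h; apply: diagact_isalt.
Qed.

Lemma koszul_diagact h w s :
  DT N (diagact h w) s = diagact h (DT N w) s.
Proof.
rewrite /diagact (koszul_map (t' := fun v (x : N) => Tact T (rho h^-1%g v) x)) //.
apply/esym/koszul_post => [x y|v x]; first by rewrite scalerBr.
by rewrite /Tact !scalerA gdiag_tdiff repKV.
Qed.

Lemma koszul_avg (F : gT -> seq V -> resk N) s :
  DT N (fun r => avg (F^~ r)) s =
  avg (fun h => DT N (F h) s).
Proof.
have tb := Tact_bilin (@tdiff_lin _ _ _ rho) N.
rewrite /avg; transitivity (DT N
    (fun r => #|gT|%:R^-1 *: (\sum_h F h r) + (0 : resk N)) s).
  by apply: koszul_ext => // r; rewrite addr0.
rewrite koszulD // (koszul0 (f := fun=> 0)) // addr0; congr (_ *: _).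
elim: (index_enum gT) => [|h r IHr].
  by rewrite big_nil; apply: koszul0 => // l; rewrite big_nil.
rewrite big_cons -IHr -[X in X + _]scale1r -koszulD //.
by apply: koszul_ext => // l; rewrite big_cons scale1r.
Qed.

Lemma koszul_avgact w s :
  DT N (avgact w) s = avgact (DT N w) s.
Proof. by rewrite koszul_avg; congr avg; apply/funext => h; apply: koszul_diagact. Qed.

End Average.

Lemma lin_avgact (N N' : lmodType E) (f : {linear N' -> N}) (w : seq V -> resk N') s :
  f (avgact w s) = avgact (fun r => f (w r) : resk N) s.
Proof.
rewrite /avgact /avg resk_linearZ; congr (_ *: _); rewrite (linear_sum f).
by apply: eq_bigr => h _; rewrite linearZ.
Qed.

End ComparisonWithKoszul.

Section ComparisonMaps.
Variables (k : fieldType) (V : vectType k) (gT : finGroupType) (rho : linrep V gT).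
Hypothesis card_unit : (#|gT|%:R : k) \is a GRing.unit.
Local Notation A := (sym V).
Local Notation B := (smash rho).
Local Notation E := (envalg B).
Local Notation M := (bimod B).
Local Notation T := (@tdiff k V gT rho).
Local Notation P := (stdres M).
Local Notation dP := (stdres_d M).
Local Notation Q := (kchain V E).
Local Notation dQ := (kd T).
Local Notation DT N := (@koszul k V (resk N) (@Tact k V E T N)).
Local Notation kcobT N := (@kcob k V (resk N) (@Tact k V E T N)).
Local Notation gen := (@kgen k V E).
Local Notation gen0 := (gen 0%N [::]).
Local Notation sepid := (sepid rho).
Let aug := stdres_aug M.

Let T_lin := @tdiff_lin k V gT rho.
Let T_comm := @tdiff_comm k V gT rho.
Let dQgen p s : dQ p (gen p.+1 s) = DT (Q p) (gen p) s.
Proof. exact: (kd_gen T_lin). Qed.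
Let dQdQ p x : dQ p (dQ p.+1 x) = 0.
Proof. exact: (kdkd T_lin T_comm). Qed.
Let dPdP p x : dP p (dP p.+1 x) = 0.
Proof. by apply/stdres_exact; exists x. Qed.
Let P_exact p x : dP p x = 0 -> exists y, x = dP p.+1 y.
Proof. by move/stdres_exact. Qed.
Let Q_exact p x : dQ p x = 0 -> exists y, x = dQ p.+1 y.
Proof. by move=> dx; apply: (kchain_exact T_lin T_comm (@tdiff_div _ _ _ rho)). Qed.
Let P_proj p : projective (P p).
Proof. exact: stdres_projective. Qed.
Let Q_proj p : projective (Q p).
Proof. exact: kchain_projective. Qed.

(** The map a lifts m goes to m sepid from B to B (x)_S(V) B, and b lifts the
    multiplication back.  Their composite maps the generator 1 (x) 1 to
    sepid (1 (x) 1), and eps, the averaging operator on the Koszul generators,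
    lifts it too. *)
Lemma comparison_maps :
  exists (a : forall n, {linear P n -> Q n}) (b : forall n, {linear Q n -> P n})
         (eps : forall n, {linear Q n -> Q n}),
  [/\ [/\ forall n x, a n (dP n x) = dQ n (a n.+1 x),
      forall n x, b n (dQ n x) = dP n (b n.+1 x) &
      forall n x, eps n (dQ n x) = dQ n (eps n.+1 x)],
      forall n s, eps n (gen n s) = avgact (rho := rho) (gen n) s &
      [/\ forall x, exists y, b 0%N (a 0%N x) - x = dP 0 y,
       forall x, exists y, a 0%N (b 0%N x) - eps 0%N x = dQ 0 y &
       forall x, exists y, b 0%N x - b 0%N (eps 0%N x) = dP 0 y]].
Proof.
have [a0 a0E] : exists a0 : {linear P 0 -> Q 0},
    forall m, a0 (ugen _ m) = (ten (m : B) 1 * sepid) *: gen0.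
  exists (@ulin E M (fun (Z : lmodType E) (_ : M -> Z) => True) (Q 0)
           (fun m => (ten (m : B) 1 * sepid) *: gen0) I) => m.
  exact: ulinE.
have a0aug x : exists y, a0 x - (ten (aug x : B) 1 * sepid) *: gen0 = dQ 0 y.
  elim/umod_ind: x => [|c m x [y yE]].
    exists 0; rewrite !linear0; have -> : ten (0 : B) (1 : B) = 0 :> E by exact: tens0l.
    by rewrite mul0r scale0r subrr.
  have [z zE] := bound0_act c (m : B); exists (z + y).
  rewrite linearP a0E linearP [in LHS]augE linearD -zE -yE.
  have -> : ten ((c *: m + aug x : M) : B) (1 : B) =
      ten ((c *: m : M) : B) 1 + ten (aug x : B) 1 by exact: tenDl.
  by rewrite mulrDl scalerBl scalerDl opprD addrACA scalerA mulrA.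
have a0d x : exists y, a0 (dP 0 x) = dQ 0 y.
  have [y yE] := a0aug (dP 0 x); exists y; rewrite -yE.
  have -> : aug (dP 0 x) = 0 by apply/stdres_exact_aug; exists x.
  have -> : ten (0 : B) (1 : B) = 0 :> E by exact: tens0l.
  by rewrite mul0r scale0r subr0.
have [b0 b0E] : exists b0 : {linear Q 0 -> P 0}, b0 gen0 = ugen _ (1 : M).
  have [|b0 b0E] := @kchain_lift k V E 0 (P 0)
    (fun s => if s is [::] then ugen _ (1 : M) else 0); last by exists b0; rewrite b0E.
  by split=> [|[]//]; split=> [[|? ?]|[|? ?]] * //=; rewrite scaler0 addr0.
have augb1 : aug (b0 gen0) = 1 :> B by rewrite b0E /aug augE.
have augb x : aug (b0 (dQ 0 x)) = 0 by apply: (aug_dQ0 (f := b0)).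
have b0d x : exists y, b0 (dQ 0 x) = dP 0 y by apply/stdres_exact_aug/augb.
have [a [aE ad]] := chain_lift P_proj dPdP Q_exact a0d.
have [b [bE bd]] := chain_lift Q_proj dQdQ P_exact b0d.
have epsH n : exists e : {linear Q n -> Q n},
    forall s, e (gen n s) = avgact (rho := rho) (gen n) s.
  exact/kchain_lift/avgact_isalt/kgen_isalt.
pose eps n := sval (cid (epsH n)).
have epsE n : forall s, eps n (gen n s) = avgact (rho := rho) (gen n) s := svalP (cid (epsH n)).
have eps0 : eps 0%N gen0 = sepid *: gen0.
  have -> : sepid *: gen0 = (#|gT|%:R^-1 : k)%:A *: \sum_h gdiag rho h *: gen0.
    by rewrite /sepid /avg -[in LHS]mulr_algl -scalerA scaler_suml.
  by rewrite epsE.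
exists a, b, eps; split=> //; first split=> // n x.
  apply: (kchain_ext (f := eps n \o dQ n) (g := dQ n \o eps n.+1)) => s /=.
  rewrite dQgen epsE (lin_avgact (dQ n)).
  rewrite (koszul_post (t' := @Tact k V E T (Q n))).
  - have -> : (fun r => dQ n (gen n.+1 r)) = (DT (Q n) (gen n)).
      by apply/funext => r; apply: dQgen.
    by rewrite -koszul_avgact; apply: koszul_ext => // r; apply: epsE.
  - by move=> u v; rewrite linearB.
  - by move=> v y; rewrite /Tact linearZ.
have bQ x : aug (b 0%N x) = kval x [::] *: (1 : M).
  by rewrite bE [x in LHS]kchain0E !linearZ augb1.
split=> x.
- apply/stdres_exact_aug; rewrite linearB /= aE; apply/eqP; rewrite subr_eq0; apply/eqP.
  have [y yE] := a0aug x; rewrite -[a0 x](subrK ((ten (aug x : B) 1 * sepid) *: gen0)) yE.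
  rewrite linearD linearD !bE augb add0r !linearZ augb1.
  transitivity (ten (aug x : B) 1 *: (sepid *: (1 : M)) : M); first by rewrite scalerA.
  rewrite (sepid_act1 rho card_unit : _ = (1 : M)).
  by rewrite -[LHS]/((_ : M) : B) ten_act !mulr1.
- exists 0; rewrite linear0 [x]kchain0E !linearZ eps0 /= bE b0E aE a0E.
  by rewrite ten1 mul1r -scalerDr subrr scaler0.
apply/stdres_exact_aug; rewrite linearB /= !bQ; apply/eqP; rewrite subr_eq0; apply/eqP.
rewrite [x in RHS]kchain0E linearZ eps0 /= !kvalZ kgenE /kgen_fun /= scale1r mulr1.
by rewrite -scalerA (sepid_act1 rho card_unit : _ = (1 : M)).
Qed.

(** Values on generators identify the linear maps out of the Koszul complex
    with alternating maps, and Hom (dQ, N) with the Koszul differential. *)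
Lemma hcob_gen (N : lmodType E) n (c : Q n -> N) :
  hcob dQ c -> kcobT N n (fun s => c (gen n s) : resk N).
Proof.
have tb := Tact_bilin T_lin N.
case: n c => [|m] c /=.
  by move=> c0; apply: kcob_ext (kcob0 tb 0) => s; rewrite c0.
move=> [h hE]; apply/kcobS; exists (fun s => h (gen m s) : resk N).
  exact/isalt_lin/kgen_isalt.
move=> s; rewrite hE dQgen; apply: koszul_post => [x y|v x]; first by rewrite linearB.
by rewrite /Tact linearZ.
Qed.

Lemma gen_hcob (N : lmodType E) n (c : {linear Q n -> N}) :
  kcobT N n (fun s => c (gen n s) : resk N) -> hcob dQ c.
Proof.
have tb := Tact_bilin T_lin N.
case: n c => [|m] c /=.
  move=> /(kcob_deg0 tb) c0 x; have [z zE] := linear_null (Q 0) N.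
  by rewrite -[RHS](zE x); apply: kchain_ext => s; rewrite c0 zE.
move=> /kcobS[h ha hE]; have [h' h'E] := kchain_lift ha; exists h'.
apply: (kchain_ext (g := h' \o dQ m)) => s /=; rewrite hE dQgen.
rewrite (koszul_post (t' := @Tact k V E T N) (L := h')).
- by apply: koszul_ext => // r; rewrite h'E.
- by move=> x y; rewrite linearB.
- by move=> v x; rewrite /Tact linearZ.
Qed.

Lemma cocycle_gen (N : lmodType E) n (c : {linear Q n -> N}) :
  (forall x, c (dQ n x) = 0) <-> (forall s, DT N (fun r => c (gen n r)) s = 0).
Proof.
have dgen s : c (dQ n (gen n.+1 s)) = DT N (fun r => c (gen n r)) s.
  rewrite dQgen; apply: koszul_post => [x y|v x]; first by rewrite linearB.
  by rewrite /Tact linearZ.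
split=> [c0 s|c0 x]; first by rewrite -dgen c0.
have [z zE] := linear_null (Q n.+1) N.
rewrite -[RHS](zE x); apply: (kchain_ext (f := c \o dQ n)) => s.
by rewrite /= dgen c0 zE.
Qed.

(** Pulling back along b turns Ext into cohomology classes of alternating maps:
    injectively, because a b is homotopic to the identity of the standard
    resolution, and onto the invariant classes, because b a is homotopic to
    the averaging operator on the Koszul complex. *)
Lemma koszul_comparison n :
  exists b : {linear Q n -> P n}, forall N : lmodType E,
  let res (c : P n -> N) := fun s => c (b (gen n s)) : resk N in
  (forall c : {linear P n -> N}, (forall x, c (dP n x) = 0) ->
     [/\ isalt n (res c), forall s, DT N (res c) s = 0,
         kcobT N n (fun s => res c s - avgact (rho := rho) (res c) s) &
         (kcobT N n (res c) <-> hcob dP c)]) /\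
  (forall w : seq V -> resk N, isalt n w -> (forall s, DT N w s = 0) ->
     avgact (rho := rho) w =1 w ->
     exists2 c : {linear P n -> N}, (forall x, c (dP n x) = 0) &
       kcobT N n (fun s => res c s - w s)).
Proof.
have [a [b [eps [[ad bd ed] epsE [ba ab be]]]]] := comparison_maps.
exists (b n) => N res; split.
  move=> c c0.
  have [cb cbE] := linear_pack (f := fun x => c (b n x)) (linearP (c \o b n)).
  have cb0 x : cb (dQ n x) = 0 by rewrite cbE bd c0.
  have resE : res c = (fun s => cb (gen n s)) by apply/funext => s; rewrite cbE.
  rewrite resE; split.
  - exact/isalt_lin/kgen_isalt.
  - exact: (proj1 (cocycle_gen cb) cb0).
  - have nl := hcob_gen (retract_idem Q_proj dQdQ P_exact bd ed be c0).
    by apply: kcob_ext nl => s; rewrite -!cbE epsE (lin_avgact cb).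
  have ch := retract_hcob P_proj dPdP P_exact ad bd ba c0.
  split=> [/gen_hcob cbh|/(proj2 ch) cbh].
    by apply/(proj1 ch); apply: hcob_ext cbh => x.
  by apply: hcob_gen; apply: hcob_ext cbh => x.
move=> w wa w0 wavg; have [f fE] := kchain_lift wa.
have wE : w = (fun r => f (gen n r)) by apply/funext => r; rewrite fE.
have f0 : forall x, f (dQ n x) = 0 by apply/cocycle_gen => s; rewrite -wE.
exists (f \o a n) => [x|]; first by rewrite /= ad f0.
have nl := hcob_gen (section_idem Q_proj dQdQ Q_exact ad bd ed ab f0).
apply: kcob_ext nl => s; rewrite epsE (lin_avgact f) -wE wavg.
by [].
Qed.

End ComparisonMaps.

(** * Alternating maps of top degree *)

Section TopForms.
Variables (k : fieldType) (W : lmodType k) (n : nat).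
Variables (e : 'I_n -> W) (phi : 'I_n -> W -> k).
Hypothesis db : dualbasis e phi.

(** Only sublists of s of one element less occur in the Koszul sum. *)
Lemma koszul_vanish (X : zmodType) (t : W -> X -> X) f s :
  (forall v, t v 0 = 0) ->
  (forall r, (size r).+1 = size s -> {subset r <= s} -> f r = 0) -> koszul t f s = 0.
Proof.
move=> t0; elim: s f => [|v s IHs] f f0 //=.
rewrite f0 //; last by move=> x xs; rewrite inE xs orbT.
rewrite t0 IHs ?subrr // => r rs sr; rewrite f0 //= ?rs // => x.
by rewrite !inE => /orP[->//|/sr ->]; rewrite orbT.
Qed.

(** The list r holds the coordinates that may still be nonzero on s.  Splitting
    off its first element leaves the families of basis vectors that avoid it
    and, in the contraction, those that start with it. *)
Lemma alt_basis0 (X : lmodType k) (r : seq 'I_n) (f : seq W -> X) s : multialt f ->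
  (forall v, v \in s -> forall j, j \notin r -> phi j v = 0) ->
  (forall r', subseq r' r -> size r' = size s -> f (map e r') = 0) -> f s = 0.
Proof.
have [pl pe pb] := db.
elim: r f s => [|i r IHr] f s fa sr f0.
  case: s sr f0 => [|v s] sr f0; first exact: (f0 [::]).
  have -> : v = 0 by rewrite [v]pb big1 // => j _; rewrite sr ?mem_head // scale0r.
  exact: multialt_cons0.
have projr v : (forall j, j \notin i :: r -> phi j v = 0) ->
    forall j, j \notin r -> phi j (projalong (e i) (phi i) v) = 0.
  move=> vr j jr; rewrite /projalong addrC -scaleNr pl pe.
  have [->|ji] := eqVneq j i; first by rewrite mulr1 addNr.
  by rewrite mulr0 add0r vr // inE negb_or ji.
rewrite (alt_split (e i) s (pl i) fa) (IHr f) ?add0r //; first last.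
- by move=> r' r'r; rewrite size_map => rs; apply: f0 => //; apply: subseq_trans r'r (subseq_cons _ _).
- by move=> _ /mapP[v vs ->]; apply/projr/sr.
apply: koszul_vanish => [v|r' r's sr']; first by rewrite /scalop scaler0.
rewrite -(@multialt_projalong_in _ _ _ (fun l => f (e i :: l)) (e i) (phi i)).
- apply: (IHr (fun l => f (e i :: l))) => [|_ /mapP[v vr' ->]|r'' r''r].
  + exact: multialtS.
  + by apply/projr/sr/sr'.
  by rewrite size_map => rs; apply: (f0 (i :: r'')); rewrite /= ?eqxx // rs.
- exact: multialtS.
- by move=> l; apply: (fa.2 [::]).
Qed.

Lemma top_form0 (X : lmodType k) (f : seq W -> X) s : isalt n f ->
  f [seq e i | i <- enum 'I_n] = 0 -> f s = 0.
Proof.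
move=> [fa fs] f0; have [sn|/fs//] := eqVneq (size s) n.
apply: (alt_basis0 (r := enum 'I_n)) => // [v _ j|r' r'r rs]; first by rewrite mem_enum.
have [_] := size_subseq_leqif r'r; rewrite rs sn size_enum_ord eqxx => /esym/eqP ->.
by [].
Qed.

Definition detform (s : seq W) : k^o :=
  if size s == n then \det (\matrix_(i < n, j < n) phi j (nth 0 s i)) else 0.

Lemma detform_isalt : isalt n detform.
Proof.
have [pl pe pb] := db.
split; last by move=> s; rewrite /detform => /negPf ->.
split=> [s1 s2 a v w|s1 s2 v]; rewrite /detform !size_cat /=; case: eqP => [sn|_] //;
  rewrite ?scaler0 ?addr0 //.
- have lt_sn : (size s1 < n)%N by rewrite -sn -[X in (X < _)%N]addn0 ltn_add2l.
  pose i0 := Ordinal lt_sn.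
  have nthE x i : i != i0 -> nth 0 (s1 ++ x :: s2) (i : 'I_n) =
      nth 0 (s1 ++ (a *: v + w) :: s2) i.
    move=> ii0; rewrite !nth_cat; case: ltngtP => // [si|si].
      by rewrite -[(i - size s1)%N]prednK ?subn_gt0.
    by case/eqP: ii0; apply: val_inj.
  have nth0 x : nth 0 (s1 ++ x :: s2) i0 = x by rewrite nth_cat ltnn subnn.
  have := @determinant_multilinear _ n (\matrix_(i, j) phi j (nth 0 (s1 ++ (a *: v + w) :: s2) i))
    (\matrix_(i, j) phi j (nth 0 (s1 ++ v :: s2) i))
    (\matrix_(i, j) phi j (nth 0 (s1 ++ w :: s2) i)) i0 a 1.
  rewrite mul1r => -> //.
  + by apply/rowP => j; rewrite !mxE !nth0 pl mul1r.
  + apply/matrixP => i j; rewrite !mxE nthE //.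
    by rewrite eq_sym; apply: neq_lift.
  + apply/matrixP => i j; rewrite !mxE nthE //.
    by rewrite eq_sym; apply: neq_lift.
have lt1 : (size s1 < n)%N by rewrite -sn -[X in (X < _)%N]addn0 ltn_add2l.
have lt2 : ((size s1).+1 < n)%N by rewrite -sn !addnS !ltnS leq_addr.
apply: (@determinant_alternate _ _ _ (Ordinal lt1) (Ordinal lt2)).
  by rewrite -val_eqE /= neq_ltn ltnSn.
move=> j; rewrite !mxE !nth_cat ltnn subnn /=.
by rewrite ltnNge leqnSn /= subSn // subnn.
Qed.

Lemma detform_basis : detform [seq e i | i <- enum 'I_n] = 1.
Proof.
have [pl pe pb] := db.
rewrite /detform size_map size_enum_ord eqxx -[RHS](det1 _ n); congr (\det _).
apply/matrixP => i j; rewrite !mxE (nth_map i) ?size_enum_ord // nth_ord_enum pe.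
by rewrite eq_sym.
Qed.

Lemma top_form_det (X : lmodType k) (f : seq W -> X) s : isalt n f ->
  f s = detform s *: f [seq e i | i <- enum 'I_n].
Proof.
move=> fa; pose x := f [seq e i | i <- enum 'I_n].
have ga : isalt n (fun s => (-1) *: (detform s *: x) + f s).
  apply: isaltD fa; apply: (isalt_post (L := fun c : k^o => c *: x)) detform_isalt.
  by move=> c u v; rewrite scalerDl scalerA.
have := top_form0 s ga; rewrite detform_basis scale1r scaleN1r addNr => /(_ erefl).
by rewrite scaleN1r addrC => /eqP; rewrite subr_eq0 => /eqP.
Qed.

End TopForms.

Lemma alt_map_det (k : fieldType) (U : vectType k) (X : lmodType k)
    (f : seq U -> X) (h : 'End(U)) :
  let b := vbasis (fullv : {vspace U}) in
  multialt f -> f (map h b) = lfdet h *: f b.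
Proof.
move=> b fa; set n : nat := \dim (fullv : {vspace U}).
have db : dualbasis (fun i : 'I_n => b`_i) (fun i w => coord b i w) := vbasis_dual U.
have bE : [seq b`_(nat_of_ord i) | i <- enum 'I_n] = b.
  apply: (@eq_from_nth _ 0) => [|i]; rewrite size_map size_enum_ord ?size_tuple // => lt_i.
  by rewrite (nth_map (Ordinal lt_i)) ?size_enum_ord // (nth_ord_enum _ (Ordinal lt_i)).
pose g s := if size s == n then f s else 0.
have ga : isalt n g.
  split; last by move=> s /negPf sn; rewrite /g sn.
  split=> [s1 s2 a v w|s1 s2 v]; rewrite /g !size_cat /=; case: eqP => // _.
  - exact: fa.1.
  - by rewrite scaler0 addr0.
  - exact: fa.2.
have := top_form_det db (map h b) ga; rewrite bE /g size_map size_tuple eqxx => ->.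
congr (_ *: _); rewrite /detform size_map size_tuple eqxx /lfdet; congr (\det _).
by apply/matrixP => i j; rewrite !mxE /= passmx.vecof_delta (nth_map 0) ?size_tuple.
Qed.

Lemma lfdetV (k : fieldType) (U : vectType k) (g h : 'End(U)) :
  (g \o h = \1)%VF -> lfdet g = (lfdet h)^-1.
Proof.
move=> gh1; have fb := basis_free (vbasisP (fullv : {vspace U})).
have := congr1 (@lfdet k U) gh1; rewrite /lfdet.
rewrite (passmx.mxof_comp _ _ (vbasisP _)) passmx.mxof1 // det1 det_mulmx => dgh.
have h0 : \det (passmx.mxof (vbasis fullv) (vbasis fullv) h) != 0 :> k.
  by apply: contra_eq_neq dgh => ->; rewrite mul0r eq_sym oner_neq0.
by apply: (mulfI h0); rewrite dgh mulfV.
Qed.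

(** * The Koszul complex of one group element *)

Section SymDivision.
Variables (k : fieldType) (V : vectType k).

Lemma sym_in_eq0 (v : V) : sym_in v = 0 -> v = 0.
Proof.
move=> v0; rewrite [v](coord_vbasis (memvf v)) big1 // => i _.
have -> : coord (vbasis fullv) i v = (sym_in v)@_U_(i); last by rewrite v0 mcoeff0 scale0r.
rewrite /sym_in linear_sum (bigD1 i) //= big1 ?addr0 => [|j ji].
  by rewrite mcoeffZ mcoeffXU eqxx mulr1.
by rewrite mcoeffZ mcoeffXU (negPf ji) mulr0.
Qed.

Lemma sym_mulfI (v : V) (p q : sym V) : v != 0 -> sym_in v * p = sym_in v * q -> p = q.
Proof.
move=> v0; have : (sym_in v : {mpoly k[_]}) != 0 by apply: contra_neq v0 => /sym_in_eq0.
by move=> sv0; apply: (mulfI sv0).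
Qed.

(** Applying pi sets x to 0, so it changes p by a multiple of x.  As S(V) is a
    domain the quotient is unique; hence it is linear in p, and commutes with
    multiplication by vectors v that pi fixes. *)
Lemma sym_div (x : V) (psi : V -> k) (pi : 'End(V)) :
  x != 0 -> psi x = 1 -> (forall v, pi v = v - psi v *: x) ->
  exists s : {linear sym V -> sym V},
    [/\ forall p, p = sym_map pi p + sym_in x * s p,
        forall p, s (sym_in x * p) = p
      & forall v p, psi v = 0 -> s (sym_in v * p) = sym_in v * s p].
Proof.
move=> x0 px piE.
have ex p : exists q, p = sym_map pi p + sym_in x * q.
  elim/sym_ind: p => [c|p q [u uE] [v vE]|p q [u uE] [v vE]|v].
  - by exists 0; rewrite mulr0 addr0 linearZ rmorph1.
  - by exists (u + v); rewrite {1}uE {1}vE rmorphD mulrDr addrACA.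
  - exists (u * q + sym_map pi p * v); rewrite rmorphM /=.
    set P := sym_map pi p in uE *; set Q := sym_map pi q in vE *.
    rewrite {1}uE mulrDl {1}vE mulrDr -addrA; congr (_ + _).
    by rewrite mulrDr addrC -mulrA; congr (_ + _); rewrite mulrCA.
  exists (psi v)%:A; rewrite sym_map_in piE linearB linearZ /=.
  by rewrite -scalerAr mulr1 subrK.
have [s0 s0E] := choice ex.
have pix : sym_map pi (sym_in x) = 0 by rewrite sym_map_in piE px scale1r subrr linear0.
have [|s sE] := @linear_pack k (sym V) (sym V) s0.
  move=> c p q; apply: (sym_mulfI x0); apply: (addrI (sym_map pi (c *: p + q))).
  rewrite -s0E linearP /= mulrDr -scalerAr addrACA -scalerDr -!s0E //.
have sP p : p = sym_map pi p + sym_in x * s p by rewrite sE.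
exists s; split=> // [p|v p v0]; apply: (sym_mulfI x0).
  by rewrite [in RHS](sP (sym_in x * p)) rmorphM /= pix mul0r add0r.
apply: (addrI (sym_map pi (sym_in v * p))).
rewrite -sP rmorphM /= sym_map_in piE v0 scale0r subr0 mulrCA -mulrDr -sP //.
Qed.

End SymDivision.

Lemma koszul_opcomp (k : comNzRingType) (W : lmodType k) (X Y : zmodType)
    (t : W -> X -> X) (L : X -> X) f s :
  koszul (fun v x => t v (L x)) f s = koszul t (fun r => L (f r)) s.
Proof. by elim: s f => [|v s IHs] f //=; rewrite IHs. Qed.

Section Local.
Variables (k : fieldType) (V : vectType k) (c : 'End(V)) (U : {vspace V}).
Hypothesis cU : stable_complement c U.
Local Notation F := (fixedSpace c).
Local Notation S := (sym V).
Local Notation Us := (subvs_of U).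
Local Notation Fs := (subvs_of F).
Local Notation m := (\dim (fullv : {vspace Us})).
Local Notation b := (vbasis (fullv : {vspace Us})).

(** By tdiff_act this is the Koszul operator on the component of c. *)
Definition diffop (v : V) (x : S) : S := (sym_in v - sym_in (c v)) * x.

Lemma diffop_bilin : bilinop diffop.
Proof.
split=> [a v w x|v a x y].
  rewrite /diffop scalerAl -mulrDl; congr (_ * _).
  by rewrite !linearP /= addrACA -scalerDr.
by rewrite /diffop mulrDr scalerAr.
Qed.

Lemma diffop_comm : commop diffop diffop.
Proof. by move=> v w x; rewrite /diffop mulrCA. Qed.

(** The u_i form a basis of U and the x_i = u_i - c u_i another one.  With psi_i
    the coordinates in the latter, the forms phi_i v = psi_i (v - c v) are dual
    to the u_i, and v - c v is the sum of the phi_i v x_i (diff_dec). *)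
Definition ub (i : 'I_m) : V := vsval b`_i.
Definition xb (i : 'I_m) : V := ub i - c (ub i).
Definition projU : 'Hom(V, Us) := (linfun (vsproj U) \o daddv_pi U F)%VF.
Definition projF : 'Hom(V, Fs) := (linfun (vsproj F) \o daddv_pi F U)%VF.

Lemma capUF : (U :&: F = 0)%VS. Proof. by case: cU => _ _; rewrite capvC. Qed.
Lemma capFU : (F :&: U = 0)%VS. Proof. by case: cU. Qed.

Lemma projU_val v : vsval (projU v) = daddv_pi U F v.
Proof. by rewrite !lfunE /= lfunE /= vsprojK // memv_pi. Qed.
Lemma projF_val v : vsval (projF v) = daddv_pi F U v.
Proof. by rewrite !lfunE /= lfunE /= vsprojK // memv_pi. Qed.
Lemma proj_dec v : v = vsval (projU v) + vsval (projF v).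
Proof.
rewrite projU_val projF_val daddv_pi_add ?capUF // addvC.
by case: cU => _ -> _; rewrite memvf.
Qed.
Lemma projU_id u : projU (vsval u) = u.
Proof. by apply: subvs_inj; rewrite projU_val daddv_pi_id ?capUF // subvsP. Qed.
Lemma projF_id u : projF (vsval u) = u.
Proof. by apply: subvs_inj; rewrite projF_val daddv_pi_id ?capFU // subvsP. Qed.
Lemma projF_U u : u \in U -> projF u = 0.
Proof.
move=> uU; have := proj_dec u; rewrite -{1 2}(vsprojK uU) projU_id -[X in X = _]addr0.
by move=> /addrI/esym h; apply: subvs_inj; rewrite h linear0.
Qed.

Lemma diff_inU v : v - c v \in U.
Proof.
case: cU => cUU _ _; rewrite [v in v - _]proj_dec [v in c v]proj_dec linearD /=.
have /fixedSpaceP -> := subvsP (projF v).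
rewrite opprD addrACA subrr addr0 memvB ?subvsP //.
exact: (subvP cUU) (memv_img _ (subvsP _)).
Qed.

Definition deltaU : 'End(Us) := (projU \o (\1 - c) \o linfun vsval)%VF.

Lemma deltaUE u : vsval (deltaU u) = vsval u - c (vsval u).
Proof.
have -> : deltaU u = projU (vsval u - c (vsval u)).
  have vE : linfun (vsval : Us -> V) u = vsval u by rewrite lfunE.
  by rewrite /deltaU 2!comp_lfunE vE add_lfunE opp_lfunE id_lfunE.
by rewrite projU_val daddv_pi_id ?capUF ?diff_inU.
Qed.

Lemma deltaU_ker : lker deltaU == 0%VS.
Proof.
rewrite -subv0; apply/subvP => u; rewrite memv_ker memv0 => /eqP du.
have := deltaUE u; rewrite du linear0 => /esym/eqP; rewrite subr_eq0 => /eqP uc.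
have : vsval u \in (U :&: F)%VS.
  by rewrite memv_cap subvsP; apply/fixedSpaceP.
by rewrite capUF memv0 => /eqP u0; apply/eqP/subvs_inj; rewrite u0 linear0.
Qed.

Definition psi (i : 'I_m) (v : V) : k := coord b i ((deltaU^-1)%VF (projU v)).
Definition phi (i : 'I_m) (v : V) : k := psi i (v - c v).

Lemma psi_lin i a v w : psi i (a *: v + w) = a * psi i v + psi i w.
Proof. by rewrite /psi !linearP. Qed.

Lemma phi_lin i a v w : phi i (a *: v + w) = a * phi i v + phi i w.
Proof.
by rewrite /phi -psi_lin linearP /= scalerBr opprD addrACA.
Qed.

Lemma psi_xb i j : psi i (xb j) = (i == j)%:R.
Proof.
rewrite /psi /xb -deltaUE projU_id lker0_lfunK ?deltaU_ker //.
by rewrite coord_free ?(basis_free (vbasisP _)) // eq_sym.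
Qed.

Lemma phi_ub i j : phi i (ub j) = (i == j)%:R.
Proof. exact: psi_xb. Qed.

Lemma psi_dec v : v \in U -> v = \sum_i psi i v *: xb i.
Proof.
move=> vU; rewrite -[LHS](vsprojK vU) -[vsproj U v](lker0_lfunVK deltaU_ker).
rewrite [(deltaU^-1)%VF _](coord_vbasis (memvf _)) !linear_sum; apply: eq_bigr => i _.
by rewrite !linearZ /= deltaUE /psi -{2}(vsprojK vU) projU_id.
Qed.

Lemma diff_dec v : v - c v = \sum_i phi i v *: xb i.
Proof. exact/psi_dec/diff_inU. Qed.

Lemma koszul_diffop f s :
  koszul diffop f s = \sum_i sym_in (xb i) * koszul (scalop (phi i)) f s.
Proof.
rewrite (koszul_ext (t' := fun v x => \sum_i scalop (phi i) v (sym_in (xb i) * x)) (f' := f)) //.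
  rewrite koszul_sumop; apply: eq_bigr => i _; rewrite (koszul_opcomp S).
  apply/esym/koszul_post => [x y|v x]; first by rewrite mulrBr.
  by rewrite /scalop scalerAr.
move=> v x; rewrite /diffop -linearB diff_dec linear_sum mulr_suml.
by apply: eq_bigr => i _; rewrite linearZ /= /scalop scalerAl.
Qed.

Definition ubs : seq V := [seq ub i | i <- enum 'I_m].
Lemma size_ubs : size ubs = m. Proof. by rewrite size_map size_enum_ord. Qed.
Local Notation pr := (sym_map projF).

(** The cohomology is detected here: ubs uses up the top form of U, and what
    remains is restricted to the fixed part, values and arguments alike. *)
Definition res (w : seq V -> S) (l : seq Fs) : sym Fs := pr (w (ubs ++ map vsval l)).

(** Coboundaries have values in the ideal of the v - c v, which all lie in U. *)
Lemma res_cob h l : res (koszul diffop h) l = 0.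
Proof.
have K0 (f : seq V -> sym Fs) s : koszul (fun _ _ => 0) f s = 0.
  by elim: s f => [|v s IHs] f //=; rewrite IHs subrr.
rewrite /res (koszul_post (t' := fun _ _ => 0)) => [|x y|v x]; first exact: K0; last first.
- by rewrite /diffop -linearB rmorphM /= sym_map_in projF_U ?diff_inU // linear0 mul0r.
- exact: raddfB.
Qed.

Lemma res_kcob n w w' : kcob diffop n (fun s => w s - w' s) -> res w =1 res w'.
Proof.
move=> [h [_ _ hE]] l; apply/eqP; rewrite -subr_eq0 /res -raddfB hE.
by apply/eqP/res_cob.
Qed.

Lemma res_isalt q w : isalt (m + q) w -> isalt q (res w).
Proof.
move=> [wa ws].
have wa' r : multialt (fun s => w (r ++ s)) by elim: r w wa {ws} => [|v r IHr] w wa //; apply: IHr (multialtS v wa).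
split; last first.
  by move=> l lq; rewrite /res ws ?linear0 // size_cat size_ubs size_map eqn_add2l.
apply: (multialt_post (L := pr)); first exact: linearP.
by apply: (multialt_pre (h := vsval)) (wa' ubs) => a u v; rewrite linearP.
Qed.

Lemma pi_ex i : exists p : 'End(V), forall v, p v = v - psi i v *: xb i.
Proof.
have [|p pE] := @linear_pack k V V (projalong (xb i) (psi i)).
  move=> a v w; rewrite /projalong psi_lin scalerDl opprD addrACA.
  by rewrite [in RHS]scalerBr scalerA.
by exists (linfun p) => v; rewrite lfunE.
Qed.
Definition pi i : 'End(V) := sval (cid (pi_ex i)).
Lemma piE i v : pi i v = v - psi i v *: xb i.
Proof. by rewrite /pi; case: cid. Qed.

Lemma psi_pi i j v : psi i (pi j v) = psi i v - psi j v * (i == j)%:R.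
Proof. by rewrite piE addrC -scaleNr psi_lin psi_xb mulNr addrC. Qed.

Lemma xb_neq0 i : xb i != 0.
Proof.
apply/eqP => x0; have := psi_xb i i; rewrite x0 eqxx /psi !linear0 => /eqP.
by rewrite eq_sym oner_eq0.
Qed.

Lemma pi_comm i j p : sym_map (pi i) (sym_map (pi j) p) = sym_map (pi j) (sym_map (pi i) p).
Proof.
rewrite -[LHS]/((sym_map (pi i) \o sym_map (pi j)) p) -sym_map_comp.
rewrite -[RHS]/((sym_map (pi j) \o sym_map (pi i)) p) -sym_map_comp.
congr (sym_map _ p); apply/lfunP => v; rewrite !comp_lfunE.
have [->//|ij] := eqVneq i j.
rewrite [LHS]piE [RHS]piE !psi_pi [j == i]eq_sym (negPf ij) !mulr0 !subr0 !piE.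
by rewrite addrAC.
Qed.

Lemma pi_idem i p : sym_map (pi i) (sym_map (pi i) p) = sym_map (pi i) p.
Proof.
rewrite -[LHS]/((sym_map (pi i) \o sym_map (pi i)) p) -sym_map_comp.
congr (sym_map _ p); apply/lfunP => v; rewrite comp_lfunE.
by rewrite [LHS]piE psi_pi eqxx mulr1 subrr scale0r subr0.
Qed.

Lemma koszul_leibniz (X : lmodType k) (t : V -> X -> X) (f : V -> k) (L M : X -> X) w s :
  {morph L : x y / x - y} ->
  (forall v x, L (t v x) = t v (L x) + f v *: M x) ->
  L (koszul t w s) = koszul t (fun r => L (w r)) s + koszul (scalop f) (fun r => M (w r)) s.
Proof.
move=> LB Lt; elim: s w => [|v s IHs] w /=.
  by have := LB 0 0; rewrite !subrr addr0.
by rewrite LB Lt IHs opprD addrACA.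
Qed.

(** Contracting with u_i and dividing by x_i is a homotopy that retracts a
    cocycle onto a multiple of phi_i whose coefficients are free of x_i. *)
Lemma diffop_homotopy i n w : isalt n w -> (forall s, koszul diffop w s = 0) ->
  kcob diffop n (fun l => w l -
     koszul (scalop (phi i)) (fun r => sym_map (pi i) (w (ub i :: r))) l).
Proof.
move=> [wa ws] w0.
have psi1 : psi i (xb i) = 1 by rewrite psi_xb eqxx.
have [s [sP sx sv]] := sym_div (xb_neq0 i) psi1 (piE i).
have st v x : s (diffop v x) = diffop v (s x) + phi i v *: sym_map (pi i) x.
  rewrite /diffop -linearB diff_dec linear_sum !mulr_suml linear_sum (bigD1 i) //=.
  rewrite [in RHS](bigD1 i) //= addrAC; congr (_ + _); last first.
    apply: eq_bigr => j ji; rewrite linearZ /= -!scalerAl linearZ /= sv //.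
    by rewrite psi_xb eq_sym (negPf ji).
  by rewrite linearZ /= -!scalerAl linearZ /= sx -scalerDr [sym_in _ * _ + _]addrC -sP.
exists (fun l => s (w (ub i :: l))); split.
- exact: (multialt_post (linearP s)) (multialtS _ wa).
- by move=> r rn; rewrite ws // linear0.
move=> l; have := w0 (ub i :: l); rewrite /= => /(congr1 s).
rewrite linear0 linearB /= (koszul_leibniz _ _ _ st) /= -/(xb i); last exact: raddfB.
rewrite {1}/diffop -linearB -/(xb i) sx => /eqP; rewrite subr_eq0 => /eqP ->.
by rewrite addrK.
Qed.

Let tb := diffop_bilin.

Lemma phi_bilin i : bilinop (scalop (X := S) (phi i)).
Proof. exact/scalop_bilin/phi_lin. Qed.

Lemma phi_anticomm i j (f : seq V -> S) s :
  koszul (scalop (phi i)) (koszul (scalop (phi j)) f) s =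
  - koszul (scalop (phi j)) (koszul (scalop (phi i)) f) s.
Proof.
by apply: koszul_anticomm; [exact: phi_bilin|exact: phi_bilin|apply/scalop_comm/phi_bilin].
Qed.

Lemma koszul_sym_map (g : 'End(V)) i (f : seq V -> S) s :
  sym_map g (koszul (scalop (phi i)) f s) =
  koszul (scalop (phi i)) (fun r => sym_map g (f r)) s.
Proof.
apply: koszul_post => [x y|v x]; first exact: raddfB.
by rewrite /scalop linearZ.
Qed.

(** Iterating diffop_homotopy over the coordinates in r: the steps do not
    disturb each other, because phi_j (u_i) = 0 for j != i and the projections
    commute. *)
Lemma reduce_cocycle n w (r : seq 'I_m) : isalt n w ->
  (forall s, koszul diffop w s = 0) -> uniq r ->
  exists w', [/\ isalt n w', forall s, koszul diffop w' s = 0,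
    kcob diffop n (fun s => w s - w' s),
    forall i s, i \in r -> koszul (scalop (phi i)) w' s = 0 &
    forall i s, i \in r -> sym_map (pi i) (w' s) = w' s].
Proof.
move=> wa w0; elim: r => [|i r IHr] /=.
  move=> _; exists w; split=> //; apply: kcob_ext (kcob0 tb n) => s.
  by rewrite subrr.
move=> /andP[ir /IHr[w1 [w1a w10 ww1 w1r w1p]]].
pose w2 := koszul (scalop (phi i)) (fun r => sym_map (pi i) (w1 (ub i :: r))).
have w12 := diffop_homotopy i w1a w10.
have piL j : linear (sym_map (pi j)) by apply: linearP.
have w2a : isalt n w2.
  have [[n' nE]|n0] : (exists n', n = n'.+1) \/ n = 0%N by case: (n) => [|n']; [right|left; exists n'].
    rewrite nE in w1a *.
    apply: koszul_isalt (phi_bilin i) _; apply: (isalt_post (piL i)).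
    exact: isaltS w1a.
  rewrite n0 in w1a *.
  have f0 : (fun r => sym_map (pi i) (w1 (ub i :: r))) =1 (fun=> 0).
    by move=> s; rewrite w1a.2 // linear0.
  have w20 s : w2 s = 0 by apply: koszul0 f0; apply: phi_bilin.
  by apply: isalt_ext (isalt0 V S 0) => s; rewrite w20.
have ww2 : kcob diffop n (fun s => w s - w2 s).
  apply: kcob_ext (kcobD tb 1 ww1 w12) => s.
  by rewrite scale1r addrA subrK.
exists w2; split=> //.
- move=> s; have [h [_ _ hE]] := w12.
  have -> : koszul diffop w2 s = koszul diffop w1 s - koszul diffop (fun l => w1 l - w2 l) s.
    rewrite -koszulB //; apply: koszul_ext => // l.
    by rewrite opprB addrC subrK.
  rewrite w10 sub0r (koszul_ext (f' := koszul diffop h) (t' := diffop)) //.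
  by rewrite koszul_sq ?oppr0 //; apply: diffop_comm.
- move=> j s; rewrite inE; case: eqVneq => [-> _|ji /= jr].
    by apply: koszul_sq; [apply: phi_bilin|apply/scalop_comm/phi_bilin].
  rewrite /w2 phi_anticomm; apply/eqP; rewrite oppr_eq0; apply/eqP.
  apply: koszul0 => [|l]; first exact: phi_bilin.
  rewrite -koszul_sym_map; have := w1r j (ub i :: l) jr; rewrite /= /scalop phi_ub (negPf ji).
  by rewrite scale0r sub0r => /eqP; rewrite oppr_eq0 => /eqP ->; rewrite linear0.
move=> j s; rewrite inE /w2 koszul_sym_map; case: eqVneq => [-> _|ji /= jr].
  by apply: koszul_ext => [//|l]; rewrite pi_idem.
apply: koszul_ext => [//|l]; rewrite pi_comm; congr (sym_map _ _).
exact: w1p.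
Qed.

(** A form killed by phi_i is a multiple of phi_i, hence determined by its
    contraction with u_i. *)
Lemma contract_all0 (w : seq V -> S) (r : seq 'I_m) : uniq r ->
  (forall i s, i \in r -> koszul (scalop (phi i)) w s = 0) ->
  (forall l, w (map ub r ++ l) = 0) -> forall s, w s = 0.
Proof.
elim: r w => [|i r IHr] w /=; first by move=> _ _ w0 s; apply: (w0 s).
move=> /andP[ir ur] wr w0 s.
have wi : (fun l => w (ub i :: l)) =1 (fun=> 0).
  apply: IHr => // j l jr; have := wr j (ub i :: l); rewrite inE jr orbT => /(_ isT) /=.
  have ji : j != i by apply: contraNneq ir => <-.
  by rewrite /scalop phi_ub (negPf ji) scale0r sub0r => /eqP; rewrite oppr_eq0 => /eqP.
have := wr i (ub i :: s); rewrite inE eqxx => /(_ isT) /=.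
by rewrite (koszul0 _ (phi_bilin i) wi) subr0 /scalop phi_ub eqxx scale1r.
Qed.

(** After the u_i, the components of further arguments in U only give repetitions. *)
Lemma alt_ubs (X : lmodType k) (w : seq V -> X) l : multialt w ->
  w (ubs ++ l) = w (ubs ++ map (fun v => vsval (projF v)) l).
Proof.
move=> wa.
have wU s1 u s2 : u \in U -> w (ubs ++ s1 ++ u :: s2) = 0.
  move=> uU; rewrite -(vsprojK uU) [vsproj U u](coord_vbasis (memvf _)) linear_sum.
  have [L LE] : exists L : {linear V -> X}, L =1 (fun v => w (ubs ++ s1 ++ v :: s2)).
    by apply: linear_pack => a v v'; rewrite !catA wa.1.
  rewrite -LE linear_sum big1 // => i _; rewrite !linearZ /= LE.
  have /splitPr[p1 p2] : ub i \in ubs by rewrite map_f ?mem_enum.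
  by rewrite -catA /= catA (multialt_repeat _ p1) ?scaler0.
suff h s1 : w (ubs ++ s1 ++ l) = w (ubs ++ s1 ++ map (fun v => vsval (projF v)) l) by apply: (h [::]).
elim: l s1 => [|v l IHl] s1 //=.
have := IHl (rcons s1 (vsval (projF v))); rewrite !cat_rcons => <-.
rewrite {1}[v]proj_dec -[vsval (projU v)]scale1r catA wa.1 scale1r -!catA.
by rewrite (wU _ (vsval (projU v))) ?subvsP // add0r.
Qed.

Let valE u : linfun (vsval : Fs -> V) u = vsval u. Proof. exact: lfunE. Qed.

(** The composite of all the coordinate projections pi_i is the projection of V
    onto its fixed part. *)
Lemma fixed_projF (p : S) : (forall i, sym_map (pi i) p = p) ->
  p = sym_map (linfun vsval) (pr p).
Proof.
move=> pp; pose q r : 'End(V) := foldr (fun i g => (pi i \o g)%VF) \1%VF r.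
have qp r : sym_map (q r) p = p.
  elim: r => [|i r IHr] /=; first exact: sym_map_id.
  exact: (etrans (sym_map_comp _ _ _) (etrans (congr1 _ IHr) (pp i))).
have qpsi r j v : psi j (q r v) = if j \in r then 0 else psi j v.
  elim: r => [|i r IHr]; first by rewrite /= lfunE.
  rewrite /= comp_lfunE psi_pi IHr in_cons; case: eqVneq => [<-|ji] /=.
    by rewrite IHr mulr1 subrr.
  by rewrite mulr0 subr0.
have qU r v : v - q r v \in U.
  elim: r => [|i r IHr]; first by rewrite /= lfunE subrr mem0v.
  rewrite /= comp_lfunE piE opprB addrCA addrC memvD // memvZ //.
  exact: diff_inU.
have qE v : q (enum 'I_m) v = vsval (projF v).
  rewrite [LHS]proj_dec; have -> : vsval (projU (q (enum 'I_m) v)) = 0.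
    rewrite [LHS](psi_dec (subvsP _)) big1 // => i _.
    by rewrite {1}/psi projU_id -/(psi i _) qpsi mem_enum scale0r.
  have := projF_U (qU (enum 'I_m) v); rewrite linearB /= => /eqP.
  by rewrite subr_eq0 add0r => /eqP ->.
transitivity (sym_map (linfun vsval \o projF)%VF p); last exact: sym_map_comp.
rewrite -{1}(qp (enum 'I_m)); congr (sym_map _ p); apply/lfunP => v.
by rewrite qE comp_lfunE valE.
Qed.

(** A reduced cocycle is phi_1 /\ ... /\ phi_m times a form with values and
    arguments in the fixed part, and res reads off that form. *)
Lemma res_injective n w : isalt n w -> (forall s, koszul diffop w s = 0) ->
  (forall l, res w l = 0) -> kcob diffop n w.
Proof.
move=> wa w0 r0.
have [w' [w'a w'0 ww' w'phi w'pi]] := reduce_cocycle wa w0 (enum_uniq 'I_m).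
apply: (kcob_ext _ ww') => s; suff -> : w' s = 0 by rewrite subr0.
apply: (contract_all0 (enum_uniq 'I_m)) => [i r _|l].
  by apply: w'phi; rewrite mem_enum.
rewrite alt_ubs; last by case: w'a.
set l' := ubs ++ _; have l'P i : sym_map (pi i) (w' l') = w' l'.
  by apply: w'pi; rewrite mem_enum.
rewrite (fixed_projF l'P); suff -> : pr (w' l') = 0 by rewrite linear0.
have := r0 (map projF l); rewrite (res_kcob ww') /res -map_comp.
exact: id.
Qed.

(** The preimage is phi_1 /\ ... /\ phi_m times the pull-back of h along the
    projection to the fixed part.  Every phi_i kills it, and the differential
    is the sum of the x_i phi_i. *)
Lemma res_surjective q (h : seq Fs -> sym Fs) : isalt q h ->
  exists w, [/\ isalt (m + q) w, forall s, koszul diffop w s = 0 & res w =1 h].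
Proof.
move=> ha; pose w0 (s : seq V) : S := sym_map (linfun vsval) (h (map projF s)).
pose w (r : seq 'I_m) := foldr (fun i f => koszul (scalop (phi i)) f) w0 r.
have w0a : isalt q w0.
  apply: (isalt_post (L := sym_map (linfun vsval))); first exact: linearP.
  by apply: isalt_pre ha => a u v; rewrite linearP.
have wa r : isalt (size r + q) (w r).
  by elim: r => [|i r IHr] //=; apply: koszul_isalt (phi_bilin i) IHr.
have wphi r i s : i \in r -> koszul (scalop (phi i)) (w r) s = 0.
  elim: r s => [|j r IHr] s //; rewrite in_cons /=; case: eqVneq => [-> _|ij /= ir].
    by apply: koszul_sq; [apply: phi_bilin|apply/scalop_comm/phi_bilin].
  rewrite phi_anticomm koszul0 ?oppr0 //; first exact: phi_bilin.
  by move=> l; apply: IHr.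
have wub r j l : j \notin r -> w r (ub j :: l) = 0.
  elim: r l => [|i r IHr] l.
    rewrite /w /= /w0 /= projF_U ?subvsP // multialt_cons0 ?linear0 //.
    by case: ha.
  rewrite inE negb_or => /andP[ji jr] /=.
  rewrite koszul0 ?subr0; [|exact: phi_bilin|by move=> s; apply: IHr].
  by rewrite /scalop phi_ub eq_sym (negPf ji) scale0r.
have wE r l : uniq r -> w r (map ub r ++ l) = w0 l.
  elim: r => [|i r IHr] //= /andP[ir /IHr {}IHr].
  rewrite koszul0 ?subr0; [|exact: phi_bilin|by move=> s; apply: wub].
  by rewrite /scalop phi_ub eqxx scale1r.
exists (w (enum 'I_m)); split.
- by have := wa (enum 'I_m); rewrite size_enum_ord.
- move=> s; rewrite koszul_diffop big1 // => i _; rewrite wphi ?mulr0 //.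
  by rewrite mem_enum.
move=> l; rewrite /res wE ?enum_uniq // /w0 -map_comp.
have -> : map (projF \o vsval) l = l.
  by rewrite -[RHS]map_id; apply: eq_map => u /=; rewrite projF_id.
have idE : (projF \o linfun vsval = \1)%VF.
  by apply/lfunP => u; rewrite [LHS]comp_lfunE valE projF_id lfunE.
by have := sym_map_comp projF (linfun vsval) (h l); rewrite idE sym_map_id => /= <-.
Qed.

Lemma ubsE : ubs = map vsval b.
Proof.
have bE : [seq b`_(nat_of_ord i) | i <- enum 'I_m] = b.
  by rewrite -[RHS](mkseq_nth 0) /mkseq size_tuple -val_enum_ord -map_comp.
by rewrite -[in RHS]bE -map_comp.
Qed.

Section Equivariance.
Variables h hi : 'End(V).
Hypotheses (hhi : (h \o hi = \1)%VF) (hih : (hi \o h = \1)%VF).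
Hypotheses (hU : (h @: U <= U)%VS) (hiU : (hi @: U <= U)%VS).
Hypotheses (hF : (h @: F <= F)%VS) (hiF : (hi @: F <= F)%VS).

Lemma projF_h v : projF (h v) = restr h F (projF v).
Proof.
rewrite {1}[v]proj_dec !linearD /= projF_U ?add0r; last first.
  exact: (subvP hU) (memv_img _ (subvsP _)).
by rewrite -[in LHS](restrE _ hF) projF_id.
Qed.

(** The determinant appears because h^-1 moves the basis of U on which res
    evaluates, and an alternating map changes by det (h^-1 | U) under this. *)
Lemma res_equiv w l : multialt w ->
  res (fun s => sym_map h (w (map hi s))) l =
  (lfdet (restr h U))^-1 *: sym_map (restr h F) (res w (map (restr hi F) l)).
Proof.
move=> wa; rewrite /res map_cat ubsE.
have restr_map (G : {vspace V}) (hG : (hi @: G <= G)%VS) (s : seq (subvs_of G)) :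
    map hi (map vsval s) = map vsval (map (restr hi G) s).
  by rewrite -!map_comp; apply: eq_map => u /=; rewrite (restrE _ hG).
rewrite !restr_map //; set l' := map vsval (map (restr hi F) l).
have fa : multialt (fun u : seq Us => w (map vsval u ++ l')).
  apply: (multialt_pre (f := fun s => w (s ++ l'))) => [a u v|]; first by rewrite linearP.
  by split=> [s1 s2 a u v|s1 s2 u]; rewrite -!catA /= ?wa.1 ?wa.2.
rewrite (alt_map_det (restr hi U) fa) !linearZ /=; congr (_ *: _).
  apply: lfdetV; apply/lfunP => u; apply: subvs_inj.
  by rewrite comp_lfunE !restrE // -comp_lfunE hih !lfunE.
have hE : (projF \o h = restr h F \o projF)%VF.
  by apply/lfunP => v; rewrite [LHS]comp_lfunE [RHS]comp_lfunE projF_h.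
set x := w _; have := sym_map_comp projF h x; have := sym_map_comp (restr h F) projF x.
by rewrite hE /= => -> ->.
Qed.

End Equivariance.

End Local.

(** * Exterior powers of the dual and alternating maps *)

Section WedgeLists.
Variables (k : comNzRingType) (D : lmodType k) (p : nat).

Definition wedgel (s : seq D) : extpow D p :=
  if size s == p then wedge [ffun i : 'I_p => nth 0 s i] else 0.

Lemma wedgel_isalt : isalt p wedgel.
Proof.
have [wl wa] := wedge_alt D p.
split; last by move=> s /negPf sp; rewrite /wedgel sp.
split=> [s1 s2 a v w|s1 s2 v]; rewrite /wedgel !size_cat /=; case: eqP => [sp|_];
  rewrite ?scaler0 ?addr0 //.
- have lt_sp : (size s1 < p)%N by rewrite -sp -[X in (X < _)%N]addn0 ltn_add2l.
  pose w0 : {ffun 'I_p -> D} := [ffun i : 'I_p => nth 0 (s1 ++ 0 :: s2) i].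
  have updE x : [ffun i : 'I_p => nth 0 (s1 ++ x :: s2) i] = upd w0 (Ordinal lt_sp) x.
    apply/ffunP => i; rewrite !ffunE -val_eqE /= !nth_cat.
    case: ltngtP => // [si|->]; last by rewrite subnn.
    by rewrite -[(i - size s1)%N]prednK ?subn_gt0.
  by rewrite !updE wl.
have lt1 : (size s1 < p)%N by rewrite -sp -[X in (X < _)%N]addn0 ltn_add2l.
have lt2 : ((size s1).+1 < p)%N by rewrite -sp !addnS !ltnS leq_addr.
apply: (wa _ (Ordinal lt1) (Ordinal lt2)); first by rewrite -val_eqE /= neq_ltn ltnSn.
rewrite !ffunE /= !nth_cat ltnn subnn /=.
by rewrite ltnNge leqnSn /= subSn // subnn.
Qed.

Lemma wedge_wedgel (w : {ffun 'I_p -> D}) : wedge w = wedgel [seq w i | i <- enum 'I_p].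
Proof.
rewrite /wedgel size_map size_enum_ord eqxx; congr wedge; apply/ffunP => i.
by rewrite ffunE (nth_map i) ?size_enum_ord // nth_ord_enum.
Qed.

Lemma wedgel_lift (Z : lmodType k) (f : seq D -> Z) : isalt p f ->
  exists g : {linear extpow D p -> Z}, forall s, g (wedgel s) = f s.
Proof.
move=> [fa fs].
have ga : altmul (fun w : {ffun 'I_p -> D} => f [seq w i | i <- enum 'I_p]).
  split=> [w i|w i j ij wij].
    have := enum_uniq 'I_p; have : i \in enum 'I_p by rewrite mem_enum.
    case/splitPr => p1 p2 u a x y; rewrite !map_cat /= !ffunE eqxx.
    have updE z q : i \notin q -> [seq upd w i z j | j <- q] = [seq w j | j <- q].
      move=> iq; apply/eq_in_map => j jq; rewrite ffunE.
      by case: eqP => // ji; rewrite -ji jq in iq.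
    move: u; rewrite cat_uniq /= negb_or => /and3P[_ /andP[i1 _] /andP[i2 _]].
    by rewrite !updE // fa.1.
  have : i \in enum 'I_p by rewrite mem_enum.
  have : j \in enum 'I_p by rewrite mem_enum.
  move=> je ie; case/splitPr: ie je => p1 p2; rewrite mem_cat inE eq_sym (negPf ij) /=.
  case/orP => /splitPr[q1 q2]; rewrite !map_cat /= ?map_cat /= wij.
    by rewrite -catA /=; apply: multialt_repeat.
  exact: multialt_repeat.
exists (ext_lift ga) => s; rewrite /wedgel; case: eqP => [sp|/eqP sp]; last first.
  by rewrite linear0 fs.
rewrite ext_liftE; congr f; apply: (@eq_from_nth _ 0) => [|i].
  by rewrite size_map size_enum_ord.
rewrite size_map size_enum_ord => ip.
by rewrite (nth_map (Ordinal ip)) ?size_enum_ord // (nth_ord_enum _ (Ordinal ip)) ffunE.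
Qed.

End WedgeLists.

Lemma ext_map_wedgel (k : comNzRingType) (U W : lmodType k) p (f : {linear U -> W}) s :
  ext_map p f (wedgel p s) = wedgel p (map f s).
Proof.
rewrite /wedgel size_map; case: eqP => [sp|_]; last by rewrite linear0.
rewrite ext_mapE; congr wedge; apply/ffunP => i; rewrite !ffunE (nth_map 0) //.
by rewrite sp.
Qed.

Section FormsAsTensors.
Variables (k : fieldType) (W : vectType k) (X : lmodType k).
Local Notation D := (dualv W).
Local Notation Tn p := (tensor X (extpow D p)).

Lemma Tn_ind p (P : Tn p -> Prop) :
  P 0 -> (forall y z, P y -> P z -> P (y + z)) ->
  (forall x l, P (tens x (wedgel p l))) -> forall y, P y.
Proof.
move=> P0 PD PW y; elim/tens_ind: y => // x u y Py; apply: (PD _ _ _ Py).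
elim/umod_ind: u => [|a w u Pu]; first by rewrite tens0r.
rewrite tensDr tensZr -tensZl; apply: (PD _ _ _ Pu).
by rewrite -/(wedge w) wedge_wedgel; apply: PW.
Qed.

Lemma Tn_lift p (Z : lmodType k) (f : seq D -> Z) : isalt p f ->
  exists F : {linear Tn p -> tensor X Z}, forall x l, F (tens x (wedgel p l)) = tens x (f l).
Proof.
move=> /wedgel_lift[g gE]; exists (tens_map idfun g) => x l.
by rewrite tens_mapE gE.
Qed.

Lemma theta_ex p : exists th : Tn p -> seq W -> X,
  (forall s, linear (th^~ s)) /\
  (forall x l s, th (tens x (wedgel p l)) s = if size s == p then detp s l *: x else 0).
Proof.
have ths s : exists F : Tn p -> X, linear F /\
    forall x l, F (tens x (wedgel p l)) = if size s == p then detp s l *: x else 0.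
  have [sp|_] := eqVneq (size s) p; last first.
    by exists (fun=> 0); split=> // a u v; rewrite scaler0 addr0.
  have [g gE] : exists g : {linear extpow D p -> k^o}, forall l, g (wedgel p l) = detp s l.
    by apply: wedgel_lift; rewrite -sp; apply: detp_isalt.
  have bl : bilin (fun q : X * extpow D p => (g q.2 : k) *: q.1).
    split=> u a x y /=; first by rewrite scalerDr !scalerA mulrC.
    by rewrite linearP scalerDl scalerA.
  exists (tens_lift (f := fun x u => (g u : k) *: x) bl); split; first exact: linearP.
  by move=> x l; rewrite tens_liftE gE.
have [th thP] := choice ths; exists (fun y s => th s y).
by split=> [s|x l s]; [exact: (thP s).1 | exact: (thP s).2].
Qed.

(** The identification of X (x) Lambda^p (W^* ) with the alternating maps from
    W^p to X. *)
Definition theta p : Tn p -> seq W -> X := sval (cid (theta_ex p)).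

Lemma theta_lin p s : linear ((@theta p)^~ s).
Proof. by rewrite /theta; case: cid => th [? ?]. Qed.
Lemma thetaE p x l s :
  theta (tens x (wedgel p l)) s = if size s == p then detp s l *: x else 0.
Proof. by rewrite /theta; case: cid => th [? ?]. Qed.
Lemma theta0 p s : theta (0 : Tn p) s = 0.
Proof. by have [f fE] := linear_pack (@theta_lin p s); rewrite -fE linear0. Qed.
Lemma thetaD p (y z : Tn p) s : theta (y + z) s = theta y s + theta z s.
Proof. by have [f fE] := linear_pack (@theta_lin p s); rewrite -!fE linearD. Qed.

Lemma theta_isalt p (y : Tn p) : isalt p (theta y).
Proof.
elim/Tn_ind: y => [|y z ya za|x l].
- by apply: isalt_ext (isalt0 W X p) => s; rewrite theta0.
- by apply: isalt_ext (isaltD 1 ya za) => s; rewrite scale1r thetaD.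
split; last by move=> s /negPf sp; rewrite thetaE sp.
split=> [s1 s2 a v w|s1 s2 v]; rewrite !thetaE !size_cat /=; case: eqP => _ //.
- by rewrite (detp_multialt l).1 scalerDl scalerA.
- by rewrite scaler0 addr0.
- by rewrite (detp_multialt l).2 scale0r.
Qed.

Lemma theta_wedge p (w : D) : exists F : {linear Tn p -> Tn p.+1},
  forall y s, theta (F y) s = koszul (scalop (w : W -> k)) (theta y) s.
Proof.
have [|F FE] := @Tn_lift p _ (fun l => wedgel p.+1 (w :: l)).
  exact: isaltS (wedgel_isalt D p.+1).
have wb := dualop_bilin X w; exists F => y s.
elim/Tn_ind: y => [|y z yE zE|x l].
- by rewrite linear0 theta0 koszul0 // => r; rewrite theta0.
- rewrite linearD thetaD yE zE -[X in X + _ = _]scale1r -koszulD //.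
  by apply: koszul_ext => // r; rewrite scale1r thetaD.
rewrite FE thetaE; case: eqP => [sp|/eqP sp].
  rewrite detp_contract.
  rewrite (koszul_post (t' := scalop (w : W -> k)) (L := fun a : k^o => a *: x)).
  - by apply: koszul_ext_size => r; rewrite sp => -[rp]; rewrite thetaE rp eqxx.
  - by move=> a b; rewrite scalerBl.
  - by move=> v a; rewrite /scalop scalerA.
by rewrite (koszul_isalt wb (theta_isalt _)).2.
Qed.

Lemma theta_contract p (v : W) : exists F : {linear Tn p.+1 -> Tn p},
  (forall y s, theta (F y) s = theta y (v :: s)) /\
  (forall x l, F (tens x (wedgel p.+1 l)) = tens x (koszul (evop v) (wedgel p) l)).
Proof.
have vb := evop_bilin (extpow D p) v.
have [F FE] := @Tn_lift p.+1 _ _ (koszul_isalt vb (wedgel_isalt D p)).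
exists F; split=> // y s; elim/Tn_ind: y => [|y z yE zE|x l].
- by rewrite linear0 !theta0.
- by rewrite linearD !thetaD yE zE.
rewrite FE thetaE /= eqSS; have [th thE] := linear_pack (@theta_lin p s).
rewrite -thE (koszul_post (t' := evop v) (L := fun u => th (tens x u))) => [|u u'|w u].
- have [sp|sp] := eqVneq (size s) p; last first.
    by apply: koszul0 => [|r]; [exact: evop_bilin | rewrite thE thetaE (negPf sp)].
  rewrite (koszul_post (t' := evop v) (L := fun a : k^o => a *: x)).
  - by apply: koszul_ext => // r; rewrite thE thetaE sp eqxx.
  - by move=> a b; rewrite scalerBl.
  - by move=> w a; rewrite /evop /scalop scalerA.
- by rewrite tensDr -scaleN1r tensZr scaleN1r linearB.
- by rewrite /evop /scalop tensZr linearZ.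
Qed.

(** Induction on p.  The contractions of y vanish, so by alt_split y is equal to
    its pull-back along every coordinate projection, and proj_elim applies. *)
Lemma theta_inj p (y : Tn p) : (forall s, theta y s = 0) -> y = 0.
Proof.
elim: p y => [|p IHp] y y0.
  have [x xE] : exists x, y = tens x (wedgel 0 [::]).
    elim/Tn_ind: y {y0} => [|y z [x ->] [x' ->]|x l].
    - by exists 0; rewrite tens0l.
    - by exists (x + x'); rewrite tensDl.
    case: l => [|a l]; first by exists x.
    by exists 0; rewrite tens0l /wedgel /= tens0r.
  have := y0 [::]; rewrite xE thetaE /= scale1r => ->; exact: tens0l.
pose Q (f : seq D -> extpow D p.+1) := forall F : {linear Tn p.+1 -> Tn p.+1},
  (forall x l, F (tens x (wedgel p.+1 l)) = tens x (f l)) -> F y = 0.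
suff /(_ idfun) h : Q (wedgel p.+1) by apply: h.
apply: (proj_elim (dual_dual W) (Q := Q) _ _ (wedgel_isalt D p.+1)) => [i g ga Qg F FE|F FE].
  have ba := isalt_pre (projalong_lin (dual_dual W) i) ga.
  have ca := isaltS (dcoord i) ga.
  have [G GE] := Tn_lift ba; have [H HE] := Tn_lift ca.
  have [C [CE CE']] := theta_contract p (vbasis (fullv : {vspace W}))`_i.
  have Cy : C y = 0 by apply: IHp => s; rewrite CE y0.
  have Gy := Qg G GE.
  have FGH z : F z = G z + H (C z).
    elim/Tn_ind: z => [|z z' zE zE'|x l]; first by rewrite !linear0 addr0.
      by rewrite !linearD zE zE' addrACA.
    have evl a (u v : D) : (a *: u + v) (vbasis fullv)`_i =
        a * u (vbasis fullv)`_i + v (vbasis fullv)`_i by rewrite !lfun_simp.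
    rewrite FE GE CE' (alt_split (dcoord i) l evl ga.1) tensDr.
    congr (_ + _).
    rewrite (koszul_post (t' := evop (vbasis (fullv : {vspace W}))`_i) (L := fun u => H (tens x u))).
    - rewrite (koszul_post (t' := evop (vbasis (fullv : {vspace W}))`_i) (L := tens x)).
      + by apply: koszul_ext => // r; rewrite HE.
      + by move=> u u'; rewrite tensDr -scaleN1r tensZr scaleN1r.
      + by move=> w u; rewrite /scalop /evop tensZr.
    - by move=> u u'; rewrite tensDr -scaleN1r tensZr scaleN1r linearB.
    - by move=> w u; rewrite /evop /scalop tensZr linearZ.
  by rewrite FGH Gy Cy linear0 addr0.
elim/Tn_ind: (y) => [|z z' zE zE'|x l]; first by rewrite linear0.
  by rewrite linearD zE zE' addr0.
by rewrite FE tens0r.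
Qed.

(** The map theta is compatible with products by coordinate forms
    (theta_wedge), and these generate all forms. *)
Lemma theta_surj p (f : seq W -> X) : isalt p f -> exists y : Tn p, theta y =1 f.
Proof.
pose P q (g : seq W -> X) := exists y : Tn q, theta y =1 g.
apply: (alt_ind (vbasis_dual W) (P := P)) => {p f} [f fa|p|p f g [y yE] [z zE]|p f i _ [y yE]].
- exists (tens (f [::]) (wedgel 0 [::])) => -[|v s]; rewrite thetaE /= ?scale1r //.
  by rewrite fa.2.
- by exists 0 => s; rewrite theta0.
- by exists (y + z) => s; rewrite thetaD yE zE.
have [F FE] := theta_wedge p (dcoord i); exists (F y) => s; rewrite FE.
by apply: koszul_ext => // v x; rewrite /scalop [dcoord i v]lfunE.
Qed.

Lemma detp_dual (g : 'End(W)) s l : detp s (map (dual_map g) l) = detp (map g s) l.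
Proof.
elim: s l => [|v s IHs] l /=; first by case: l.
rewrite (koszul_map (t' := evop (X := k^o) (g v))) => [|w x].
  by apply: koszul_ext.
by rewrite /evop /scalop /dual_map comp_lfunE.
Qed.

Lemma theta_equiv p (a : {linear X -> X}) (g : 'End(W)) (y : Tn p) s :
  theta (tens_map a (ext_map p (dual_map g)) y) s = a (theta y (map g s)).
Proof.
elim/Tn_ind: y => [|y z yE zE|x l]; first by rewrite !linear0 !theta0 linear0.
  by rewrite linearD !thetaD linearD yE zE.
rewrite tens_mapE ext_map_wedgel !thetaE size_map detp_dual.
by case: eqP => _; rewrite ?linear0 ?linearZ.
Qed.

End FormsAsTensors.

(** * The contribution of one group element *)

Section TensorUnit.
Variables (k : fieldType) (Y : lmodType k).

Lemma tensor_unit : exists f : {linear tensor Y k^o -> Y},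
  (forall y (a : k^o), f (tens y a) = a *: y) /\ (forall z, tens (f z) (1 : k^o) = z).
Proof.
have bl : bilin (fun q : Y * k^o => (q.2 : k) *: q.1).
  split=> u a x y /=; first by rewrite scalerDr !scalerA mulrC.
  by rewrite scalerDl scalerA.
exists (tens_lift (f := fun y (a : k^o) => (a : k) *: y) bl); split=> [y a|z].
  by rewrite tens_liftE.
elim/tens_ind: z => [|y a z zE]; first by rewrite linear0 tens0l.
rewrite linearD tensDl zE tens_liftE tensZl -tensZr; congr (tens _ _ + _).
exact: mulr1.
Qed.

End TensorUnit.

Section LocalRelation.
Variables (k : fieldType) (V : vectType k) (gT : finGroupType) (rho : linrep V gT).
Hypothesis card_unit : (#|gT|%:R : k) \is a GRing.unit.
Variables (g : gT) (n : nat).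
Local Notation S := (sym V).
Implicit Types w : seq V -> S.

(** What diagact does to components; it leads from that of g to that of
    h g h^-1 (gcomp_diagact). *)
Definition hact (h : gT) w : seq V -> S :=
  fun s => sym_map (rho h) (w (map (rho h^-1%g) s)).

Lemma rep_compVK (h : gT) : (rho h^-1%g \o rho h = \1)%VF.
Proof. by rewrite -rep_funM mulVg rep_fun1. Qed.

Lemma movv_complement : stable_complement (rho g) (movv rho g).
Proof. by apply: movvP; rewrite -unitfE. Qed.

Lemma cent_fix h : h \in 'C[g]%g -> (rho h @: fixv rho g <= fixv rho g)%VS.
Proof.
move=> /cent1P hg; apply/subvP => _ /memv_imgP[v /fixedSpaceP gv ->]; apply/fixedSpaceP.
by rewrite -comp_lfunE -rep_funM -hg rep_funM comp_lfunE gv.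
Qed.

Lemma cent_mov h : h \in 'C[g]%g -> (rho h @: movv rho g <= movv rho g)%VS.
Proof.
move=> /cent1P hg; rewrite (stable_complement_unique movv_complement).
apply/subvP => _ /memv_imgP[_ /memv_imgP[v _ ->] ->]; apply/memv_imgP.
exists (rho h v); rewrite ?memvf //.
rewrite !add_lfunE !opp_lfunE !id_lfunE linearB /= -!comp_lfunE.
by rewrite -!rep_funM hg.
Qed.

(** R w y says that y is the class of w: theta y = res w.  The five groups of
    properties are linearity and totality, invariance under coboundaries,
    injectivity and surjectivity on classes, and compatibility with the
    centralizer.  For n < d_g, res vanishes for reasons of degree and every
    cocycle is a coboundary, in accordance with the zero target. *)
Lemma local_relation (z : int) : z = n%:Z - (mov_dim rho g)%:Z ->
  exists R : (seq V -> S) -> summand_mod rho g z -> Prop,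
  [/\ [/\ R (fun=> 0) 0,
          forall a w w' y y', R w y -> R w' y' -> R (fun s => a *: w s + w' s) (a *: y + y'),
          forall w y y', R w y -> R w y' -> y = y' &
          forall w, isalt n w -> exists y, R w y],
      forall w w' y, kcob (diffop (rho g)) n (fun s => w s - w' s) -> R w y -> R w' y,
      forall w y, isalt n w -> (forall s, koszul (diffop (rho g)) w s = 0) -> R w y ->
        (kcob (diffop (rho g)) n w <-> y = 0),
      forall y, exists w, [/\ isalt n w, forall s, koszul (diffop (rho g)) w s = 0 & R w y] &
      forall h w y, h \in 'C[g]%g -> multialt w -> R w y -> R (hact h w) (@summand_act k V gT rho g z h y)].
Proof.
have cU := movv_complement; pose c := rho g; pose U := movv rho g.
have mE : \dim (fullv : {vspace subvs_of U}) = mov_dim rho g by rewrite dimvf.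
case: z => [p|p] zE; last first.
  have T0 (y y' : summand_mod rho g (Negz p)) : y = y'.
    have Z0 (x : tensor (sym (subvs_of (fixv rho g))) ('rV[k]_0)) : x = 0.
      elim/tens_ind: x => // u w x ->; rewrite [w]thinmx0 tens0r addr0 //.
    have Y0 (x : summand_mod rho g (Negz p)) : x = 0.
      by elim/tens_ind: x => // u w x ->; rewrite [u]Z0 tens0l addr0.
    by rewrite [y]Y0 [y']Y0.
  exists (fun _ _ => True); split=> //; first by split=> // w _; exists 0.
  - move=> w y wa w0 _; split=> // _; apply: (res_injective cU wa w0) => l.
    rewrite /res wa.2 ?linear0 // size_cat size_ubs mE size_map.
    by rewrite gtn_eqF // ltn_addr // -ltz_nat -Num.Theory.subr_lt0 -zE.
  - move=> y; exists (fun=> 0); split=> //; first exact: isalt0.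
    by move=> s; apply: koszul0 => //; apply: diffop_bilin.
have nE : n = (\dim (fullv : {vspace subvs_of U}) + p)%N.
  by apply/eqP; rewrite mE -eqz_nat PoszD zE addrC subrK.
pose Fs := subvs_of (fixv rho g).
have [e2 [e2E e2K]] := tensor_unit (tensor (sym Fs) (extpow (dualv Fs) p)).
have e2inj y : e2 y = 0 -> y = 0 by move=> y0; rewrite -[y]e2K y0 tens0l.
exists (fun w (y : summand_mod rho g (Posz p)) => forall s, theta (e2 y) s = @res k V c U w s).
have pr_lin := linearP (sym_map (@projF k V c U)).
split; first split.
- by move=> s; rewrite linear0 theta0 /res linear0.
- move=> a w w' y y' wy wy' s; rewrite linearP theta_lin wy wy'.
  by rewrite /res -pr_lin.
- move=> w y y' wy wy'; apply/eqP; rewrite -subr_eq0; apply/eqP/e2inj/theta_inj => s.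
  have := theta_lin s (-1) (e2 y') (e2 y); rewrite wy wy' !scaleN1r addrC linearB addrC.
  by rewrite addNr addrC.
- move=> w wa; have [|y yE] := @theta_surj k Fs (sym Fs) p (@res k V c U w).
    by apply: res_isalt; rewrite -nE.
  exists (tens y 1) => s; rewrite e2E scale1r; exact: yE.
- by move=> w w' y ww' wy s; rewrite wy; apply: (res_kcob cU ww').
- move=> w y wa w0 wy; split=> [wc|y0].
    apply/e2inj/theta_inj => s; rewrite wy.
    have [h [_ _ hE]] := wc; rewrite /res hE; exact: (res_cob cU).
  by apply: (res_injective cU wa w0) => l; rewrite -wy y0 linear0 theta0.
- move=> y; have [w [wa w0 wE]] := res_surjective cU (theta_isalt (e2 y)).
  by exists w; split=> [||s]; [rewrite nE|exact: w0|rewrite wE].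
move=> h w y hC wa wy s.
have hVC : h^-1%g \in 'C[g]%g by rewrite groupV.
rewrite /hact (res_equiv cU (rep_compVK h) (cent_mov hC) (cent_mov hVC)
  (cent_fix hC) (cent_fix hVC)) //.
rewrite -wy -theta_equiv.
elim/tens_ind: (y) => [|u a v IH].
  by rewrite !linear0 theta0 scaler0.
rewrite !linearD !thetaD scalerDr -IH; congr (_ + _).
rewrite /summand_act tens_mapE !e2E [in RHS](linearZ_LR (tens_map _ _)).
have [f fE] := linear_pack (@theta_lin k Fs (sym Fs) p s).
by rewrite -!fE !(linearZ_LR f) scalerA.
Qed.

End LocalRelation.

(** * Components over the group elements *)

Section Components.
Variables (k : fieldType) (V : vectType k) (gT : finGroupType) (rho : linrep V gT).
Hypothesis card_unit : (#|gT|%:R : k) \is a GRing.unit.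
Local Notation S := (sym V).
Local Notation B := (smash rho).
Local Notation N := (bimod B).
Local Notation T := (@tdiff k V gT rho).
Local Notation DT := (@koszul k V (resk N) (@Tact k V (envalg B) T N)).
Local Notation kcobT := (@kcob k V (resk N) (@Tact k V (envalg B) T N)).
Implicit Types W : seq V -> resk N.

Definition gcomp W (g : gT) : seq V -> S := fun s => (W s : B) g.

Lemma gcomp_lin g : linear (fun x : resk N => (x : B) g).
Proof.
move=> c x y; transitivity ((c *: (x : B) + y : B) g); last exact: smash_linE.
by congr (fun_of_fin _ g); congr (_ + _); apply: resk_bimodE.
Qed.

Lemma gcompB W W' g s : gcomp (fun r => W r - W' r) g s = gcomp W g s - gcomp W' g s.
Proof. by rewrite /gcomp !ffunE. Qed.

Lemma gcomp_isalt n W : isalt n W <-> forall g, isalt n (gcomp W g).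
Proof.
split=> [Wa g|Wa]; first exact: isalt_post (gcomp_lin g) Wa.
split; last by move=> s sn; apply/ffunP => g; rewrite [LHS](Wa g).2 // [RHS]ffunE.
split=> [s1 s2 a v w|s1 s2 v]; apply/ffunP => g.
  by rewrite [RHS](gcomp_lin g) [LHS](Wa g).1.1.
by rewrite [LHS](Wa g).1.2 [RHS]ffunE.
Qed.

Lemma gcomp_koszul W g s : (DT W s : B) g = koszul (diffop (rho g)) (gcomp W g) s.
Proof.
apply: (koszul_post (L := fun x : resk N => (x : B) g)) => [x y|v x].
  by rewrite -[LHS]/((x - y : B) g) !ffunE.
exact: tdiff_act.
Qed.

Lemma gcomp_kcob n W : kcobT n W <-> forall g, kcob (diffop (rho g)) n (gcomp W g).
Proof.
split=> [[h [ha hs hE]] g|].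
  exists (gcomp h g); split=> [|s sn|s].
  - exact: multialt_post (gcomp_lin g) ha.
  - by rewrite /gcomp hs // ffunE.
  - by rewrite /gcomp hE gcomp_koszul.
move=> /choice[h hP]; exists (fun s => [ffun g => h g s] : B); split.
- split=> [s1 s2 a v w|s1 s2 v]; apply/ffunP => g; have [ha _ _] := hP g.
    by rewrite [RHS](gcomp_lin g) !ffunE ha.1.
  by rewrite !ffunE ha.2.
- by move=> s sn; apply/ffunP => g; have [_ hs _] := hP g; rewrite !ffunE hs.
move=> s; apply/ffunP => g; have [_ _ hE] := hP g.
rewrite gcomp_koszul -[LHS]/(gcomp W g s) hE; apply: koszul_ext => // r.
by rewrite /gcomp ffunE.
Qed.

Lemma gcomp_diagact h W g : gcomp (diagact h W) g = hact rho h (gcomp W (h^-1 * g * h)%g).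
Proof. by apply/funext => s; rewrite /gcomp /diagact /hact gdiag_act. Qed.

Lemma gcomp_avg W g s :
  gcomp (avgact W) g s =
  #|gT|%:R^-1 *: \sum_h hact rho h (gcomp W (h^-1 * g * h)%g) s.
Proof.
have [L LE] := linear_pack (gcomp_lin g).
rewrite /gcomp /avgact -LE /avg (linearZ_LR L) linear_sum; congr (_ *: _).
apply: eq_bigr => h _; rewrite LE; exact: (congr1 (fun f => f s) (gcomp_diagact h W g)).
Qed.

Lemma hact_kcob n h g w : kcob (diffop (rho g)) n w ->
  kcob (diffop (rho (h * g * h^-1)%g)) n (hact rho h w).
Proof.
move=> [f [fa fs fE]]; exists (hact rho h f); split.
- apply: (multialt_post (L := sym_map (rho h))); first exact: linearP.
  by apply: multialt_pre fa => a u v; rewrite linearP.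
- by move=> s sn; rewrite /hact fs ?size_map // linear0.
move=> s; rewrite /hact fE.
rewrite (koszul_map (t' := fun v x => diffop (rho g) (rho h^-1%g v) x)) //.
apply: koszul_post => [x y|v x]; first exact: raddfB.
rewrite /diffop -!linearB rmorphM /= sym_map_in linearB /= repKV; congr (sym_in (_ - _) * _).
by rewrite !rep_funM !comp_lfunE.
Qed.

Lemma diagact_avg h W : diagact h (avgact W) = avgact W.
Proof.
apply/funext => s; rewrite /diagact /avgact.
have [L LE] := linear_pack (gdiag_lin (N := N) h).
rewrite -LE /avg (linearZ_LR L) linear_sum; congr (_ *: _).
rewrite [RHS](reindex_inj (mulgI h)) /=; apply: eq_bigr => g _.
rewrite LE /diagact scalerA -gdiagM -map_comp.
suff -> : map (rho g^-1%g \o rho h^-1%g) s = map (rho (h * g)^-1%g) s by [].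
by apply: eq_map => v /=; rewrite -comp_lfunE -rep_funM -invMg.
Qed.

Lemma avg_idem W : avgact (avgact W) = avgact W.
Proof.
apply/funext => s; rewrite {1}/avgact; under eq_fun => h do rewrite diagact_avg.
exact: avg_const.
Qed.

Lemma diagact_kcob n h W : kcobT n W -> kcobT n (diagact h W).
Proof.
move=> /gcomp_kcob Wb; apply/gcomp_kcob => g; rewrite gcomp_diagact.
have := hact_kcob h (Wb (h^-1 * g * h)%g).
by rewrite !mulgA mulgV mul1g -mulgA mulgV mulg1.
Qed.

(** Both W and its image under h differ by coboundaries from the average of W,
    which h fixes. *)
Lemma invariant_cob n h W : kcobT n (fun s => W s - avgact W s) ->
  kcobT n (fun s => diagact h W s - W s).
Proof.
move=> Wb; have tb := Tact_bilin (@tdiff_lin _ _ _ rho) N.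
have h1 := diagact_kcob h Wb.
apply: kcob_ext (kcobD tb (-1) Wb h1) => s; rewrite scaleN1r.
have -> : diagact h (fun s => W s - avgact W s) s = diagact h W s - avgact W s.
  by rewrite -{2}(diagact_avg h) /diagact scalerBr.
by rewrite opprB addrC addrA subrK.
Qed.

End Components.

(** * Classes of homomorphisms out of the standard resolution *)

Section HomModules.
Variables (k : fieldType) (E : algType k) (P Q N : lmodType E).

Lemma hommod_inj (f g : hommod P N) : hom_fun f =1 hom_fun g -> f = g.
Proof. by move=> fg; apply/val_inj/funext. Qed.

Lemma hommod_linear (f : hommod P N) : exists h : {linear P -> N}, h =1 hom_fun f.
Proof. exact: linear_pack (@hom_funP _ _ _ _ f). Qed.

Lemma linear_hommod (h : {linear P -> N}) : exists f : hommod P N, hom_fun f =1 h.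
Proof.
have hP : (h : P -> resk N) \in hom_pred (P := P) (N := N) by apply/asboolP/linearP.
by exists (exist _ (h : P -> resk N) hP).
Qed.

Lemma precompE (d : {linear Q -> P}) (f : hommod P N) x :
  hom_fun (@precomp k E P Q N d f) x = hom_fun f (d x).
Proof. by []. Qed.

Lemma hom_funD (a : k) (f g : hommod P N) x :
  hom_fun (a *: f + g) x = a *: (hom_fun f x : resk N) + (hom_fun g x : resk N) :> resk N.
Proof. by []. Qed.

Lemma hom_fun0 x : hom_fun (0 : hommod P N) x = 0.
Proof. by []. Qed.

End HomModules.

Section Cohomology.
Variables (R : pzRingType) (C : nat -> lmodType R).
Variable delta : forall n, {linear C n -> C n.+1}.

Lemma cocycle_eq n (z : cocycles delta n) : delta n (val z) = 0.
Proof. exact: (eqP (valP z)). Qed.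

Lemma cocycle_ex n (x : C n) : delta n x = 0 -> exists z : cocycles delta n, val z = x.
Proof.
move=> /eqP xP; by exists (exist (fun y => y \in ker_pred (delta n)) x xP).
Qed.

Lemma cocycle_lin n (a : R) (y z : cocycles delta n) : val (a *: y + z) = a *: val y + val z.
Proof. by []. Qed.

Lemma coboundariesP n (z : cocycles delta n) :
  z \in @coboundaries R C delta n <-> @coboundary R C delta n (val z).
Proof. by split=> /asboolP. Qed.

Lemma coboundary0 (x : C 0) : @coboundary R C delta 0 x <-> x = 0.
Proof. by []. Qed.

Lemma coboundaryS n (x : C n.+1) :
  @coboundary R C delta n.+1 x <-> exists y, x = delta n y.
Proof. by []. Qed.

End Cohomology.

Section HomCochains.
Variables (k : fieldType) (E : algType k) (M N : lmodType E).
Local Notation dP := (stdres_d M).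
Local Notation homC := (fun m : nat => hommod (stdres M m) N).
Local Notation delta := (fun m : nat => @precomp k E (stdres M m) (stdres M m.+1) N (dP m)
  : {linear homC m -> homC m.+1}).
Local Notation Z n := (@cocycles k homC delta n).

Lemma hom_cocycle n (z : Z n) x : hom_fun (val z) (dP n x) = 0.
Proof.
have zE := cocycle_eq z.
by rewrite -[LHS]precompE zE hom_fun0.
Qed.

Lemma cocycle_hom n (c : {linear stdres M n -> N}) : (forall x, c (dP n x) = 0) ->
  exists z : Z n, hom_fun (val z) =1 c.
Proof.
move=> c0; have [f fE] := linear_hommod c.
have [|z zE] := @cocycle_ex k homC delta n f; last by exists z => x; rewrite zE.
by apply: hommod_inj => x; rewrite precompE fE c0 hom_fun0.
Qed.

Lemma hom_coboundary n (z : Z n) :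
  z \in @coboundaries k homC delta n <-> hcob dP (hom_fun (val z)).
Proof.
apply: (iff_trans (coboundariesP z)); move: (val z) => {z}.
case: n => [|m] f.
  apply: (iff_trans (coboundary0 delta f)); split=> [-> x|f0]; first exact: hom_fun0.
  by apply: hommod_inj => x; rewrite f0 hom_fun0.
apply: (iff_trans (coboundaryS delta f)).
split=> [[y fE]|[h hE]].
  have [h hE] := hommod_linear y; exists h => x.
  by rewrite hE fE precompE.
have [y yE] := linear_hommod h; exists y.
by apply: hommod_inj => x; rewrite precompE yE.
Qed.

(** The criterion isomorphic_qmod for Ext, with bare functions in place of
    elements of the module of cocycles. *)
Lemma isomorphic_ext n (Y : lmodType k) (rel : (stdres M n -> N) -> Y -> Prop) :
  let cocycle (c : {linear stdres M n -> N}) := forall x, c (dP n x) = 0 in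
  (forall c, cocycle c -> exists y, rel c y) ->
  (forall y, exists2 c : {linear stdres M n -> N}, cocycle c & rel c y) ->
  (forall (a : k) c c' y y', rel c y -> rel c' y' ->
     rel (fun x => a *: (c x : resk N) + (c' x : resk N)) (a *: y + y')) ->
  (forall c y, cocycle c -> rel c y -> (hcob dP c <-> y = 0)) ->
  isomorphic (@Ext k E M N n) Y.
Proof.
move=> cocycle rtot rsurj rlin rker.
have lin (z : Z n) : exists2 c : {linear stdres M n -> N}, cocycle c & hom_fun (val z) = c.
  have [c cE] := hommod_linear (val z); exists c; last exact/esym/funext.
  by move=> x; rewrite cE hom_cocycle.
apply: (@isomorphic_qmod _ (Z n) Y _ (fun z => rel (hom_fun (val z)))).
- by move=> z; have [c c0 ->] := lin z; apply: rtot.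
- move=> y; have [c c0 cy] := rsurj y; have [z zE] := cocycle_hom c0; exists z.
  by have -> : hom_fun (val z) = c by apply/funext.
- move=> a z z' y y' zy zy'.
  rewrite [X in hom_fun X](cocycle_lin a z z' : val (a *: z + z') = _).
  have := rlin a (hom_fun (val z)) (hom_fun (val z')) y y' zy zy'.
  have -> // : (fun x => a *: (hom_fun (val z) x : resk N) + (hom_fun (val z') x : resk N)) =
            hom_fun (a *: val z + val z').
  by apply/funext => x; rewrite hom_funD.
move=> z y zy; apply: (iff_trans (hom_coboundary z)).
by have [c c0 cE] := lin z; rewrite cE in zy *; apply: rker.
Qed.

End HomCochains.

(** * Invariants and conjugacy classes *)

Section Assembly.
Variables (k : fieldType) (V : vectType k) (gT : finGroupType) (rho : linrep V gT).
Hypothesis card_unit : (#|gT|%:R : k) \is a GRing.unit.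
Variable rep : conj_class gT -> gT.
Hypothesis rep_in : forall C : conj_class gT, rep C \in val C.
Variable n : nat.
Local Notation S := (sym V).
Local Notation B := (smash rho).
Local Notation N := (bimod B).
Local Notation T := (@tdiff k V gT rho).
Local Notation DT := (@koszul k V (resk N) (@Tact k V (envalg B) T N)).
Local Notation kcobT := (@kcob k V (resk N) (@Tact k V (envalg B) T N)).
Local Notation zdeg C := (n%:Z - (mov_dim rho (rep C))%:Z).
Implicit Types (W : seq V -> resk N) (C : conj_class gT).

Definition class_of (g : gT) : conj_class gT :=
  exist (fun A : {set gT} => A \in classes [set: gT]) (g ^: [set: gT])%g
        (mem_classes (finset.in_setT g)).

Lemma class_of_rep C : class_of (rep C) = C.
Proof.
apply: val_inj => /=; have /imsetP[x _ CE] := valP C.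
by have := rep_in C; rewrite CE => /class_eqP ->; rewrite -CE.
Qed.

Lemma rep_conj g : exists h, g = (h * rep (class_of g) * h^-1)%g.
Proof.
have /imsetP[x _ rE] : rep (class_of g) \in (g ^: [set: gT])%g := rep_in (class_of g).
by exists x; rewrite rE conjgE mulKVg mulgK.
Qed.

Lemma card_cent_unit (g : gT) : (#|'C[g]%g|%:R : k) \is a GRing.unit.
Proof.
have /dvdnP[q qE] : (#|'C[g]%g| %| #|gT|)%N by rewrite -cardsT; apply/cardSg/finset.subsetT.
by move: card_unit; rewrite qE natrM unitrM => /andP[].
Qed.

Let local_rel C := sval (cid (@local_relation k V gT rho card_unit (rep C) n _ erefl)).
Let local_relP C := svalP (cid (@local_relation k V gT rho card_unit (rep C) n _ erefl)).
Arguments local_rel C _ _ : clear implicits.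
Arguments local_relP C : clear implicits.

Lemma local_rel_sum C (r : seq gT) (w : gT -> seq V -> S) y :
  (forall i, i \in r -> local_rel C (w i) (y i)) ->
  local_rel C (fun s => \sum_(i <- r) w i s) (\sum_(i <- r) y i).
Proof.
have [[R0 RD _ _] _ _ _ _] := local_relP C; elim: r => [|i r IHr] wy.
  rewrite big_nil; have -> // : (fun s => \sum_(i <- [::]) w i s) = (fun=> 0).
  by apply/funext => s; rewrite big_nil.
rewrite big_cons -[y i]scale1r.
have -> : (fun s => \sum_(j <- i :: r) w j s) =
          (fun s => 1 *: w i s + \sum_(j <- r) w j s).
  by apply/funext => s; rewrite big_cons scale1r.
apply: RD; first by apply: wy; rewrite mem_head.
by apply: IHr => j jr; apply: wy; rewrite inE jr orbT.
Qed.

(** The cocycles w_C that represent the given classes are put on the chosen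
    representatives and spread over the conjugacy classes by averaging.  Of
    the |G| terms of the average, the |C(g)| ones with h in C(g) contribute to
    the component of a representative g; the factor q g corrects for this. *)
Lemma invariant_lift (y : forall C, summand rho (rep C) (zdeg C)) :
  exists W, [/\ isalt n W, forall s, DT W s = 0, avgact W =1 W &
               forall C, local_rel C (gcomp W (rep C)) (val (y C))].
Proof.
have wP C : exists w, [/\ isalt n w, forall s, koszul (diffop (rho (rep C))) w s = 0 &
    local_rel C w (val (y C))] by have [_ _ _ Rs _] := local_relP C; apply: Rs.
pose w C := sval (cid (wP C)).
pose q (g : gT) : k := #|gT|%:R / #|'C[g]%g|%:R.
pose W0 : seq V -> resk N := fun s =>
  [ffun g => if g == rep (class_of g) then q g *: w (class_of g) s else 0] : B.
have W0E g : gcomp W0 g = fun s => if g == rep (class_of g) then q g *: w (class_of g) s else 0.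
  by apply/funext => s; rewrite /gcomp /W0 ffunE.
have qL c : linear (fun x : S => (c : k) *: x).
  by move=> a u v; rewrite scalerDr !scalerA mulrC.
have W0a : isalt n W0.
  apply/gcomp_isalt => g; rewrite W0E; case: eqP => _; last exact: isalt0.
  by apply: isalt_post (qL (q g)) _; have [] := svalP (cid (wP (class_of g))).
have W00 s : DT W0 s = 0.
  apply/ffunP => g; rewrite gcomp_koszul W0E [RHS]ffunE.
  have tb := diffop_bilin (rho g).
  case: eqP => [gE|_]; last exact: koszul0.
  have [_ w0 _] := svalP (cid (wP (class_of g))).
  have := koszulD (q g) (w (class_of g)) (fun=> 0) s tb.
  rewrite [koszul _ (fun=> 0) s]koszul0 // addr0 [in X in koszul X (w _)]gE w0 scaler0 => <-.
  by apply: koszul_ext => // r; rewrite addr0.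
exists (avgact W0); split.
- exact: avgact_isalt.
- move=> s; rewrite koszul_avgact.
  have -> : DT W0 = (fun=> 0) by apply/funext.
  rewrite /avgact /avg big1 ?scaler0 // => h _; exact: (scaler0 (bimod B)).
- by move=> s; rewrite avg_idem.
move=> C; set g := rep C.
have gC : class_of g = C := class_of_rep C.
have [[R0 RD Rf Rt] Rc _ _ Re] := local_relP C.
have [_ _ wy] := svalP (cid (wP C)); have [wa _ _] := svalP (cid (wP C)).
have W0C h : gcomp W0 (h^-1 * g * h)%g = if h \in 'C[g]%g then (fun s => q g *: w C s) else (fun=> 0).
  have clE : class_of (h^-1 * g * h)%g = C.
    rewrite -gC; apply: val_inj => /=.
    by rewrite -mulgA -conjgE; apply: classGidl; rewrite finset.in_setT.
  rewrite W0E clE -/g; have -> : ((h^-1 * g * h)%g == g) = (h \in 'C[g]%g).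
    apply/eqP/cent1P => [gh|gh]; last by rewrite -mulgA -gh mulKg.
    by rewrite /commute -{1}gh -!mulgA mulKVg.
  by case: ifP => // /cent1P gh; have -> : (h^-1 * g * h)%g = g by rewrite -mulgA -gh mulKg.
have -> : gcomp (avgact W0) g =
   (fun s => #|gT|%:R^-1 *: (\sum_(h <- enum 'C[g]%g) hact rho h (fun s' => q g *: w C s') s)
             + (fun=> 0) s).
  apply/funext => s; rewrite gcomp_avg addr0; congr (_ *: _).
  rewrite big_enum /= [RHS]big_mkcond /=; apply: eq_bigr => h _; rewrite W0C.
  by case: ifP => // _; rewrite /hact linear0.
have -> : val (y C) = #|gT|%:R^-1 *: (\sum_(h <- enum 'C[g]%g) q g *: val (y C)) + 0.
  rewrite addr0 big_enum /= sumr_const -scaler_nat !scalerA /q.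
  by rewrite [X in _ * X]mulrC mulrA mulrK ?card_cent_unit // mulVr // scale1r.
apply: (RD) (R0); apply: local_rel_sum => h; rewrite mem_enum => hC.
have qwy : local_rel C (fun s => q g *: w C s) (q g *: val (y C)).
  rewrite -[X in local_rel C _ X]addr0; have -> : (fun s => q g *: w C s) =
    (fun s => q g *: w C s + (fun=> 0) s) by apply/funext => s; rewrite addr0.
  exact: RD.
have := Re h _ _ hC (multialt_post (qL (q g)) wa.1) qwy; rewrite linearZ /=.
by have /forall_inP/(_ h hC)/eqP -> := valP (y C).
Qed.

(** The action of h transports the component of a representative to any other
    component of its class, and changes W by a coboundary. *)
Lemma kcob_reps W : kcobT n (fun s => W s - avgact W s) ->
  (forall C, kcob (diffop (rho (rep C))) n (gcomp W (rep C))) -> kcobT n W.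
Proof.
move=> Winv Wrep; apply/gcomp_kcob => g; have [h gE] := rep_conj g.
have h1 := hact_kcob h (Wrep (class_of g)); rewrite -gE in h1.
have /gcomp_kcob/(_ g) h2 := invariant_cob h Winv.
apply: kcob_ext (kcobD (diffop_bilin (rho g)) (-1) h2 h1) => s.
rewrite gcompB gcomp_diagact {1}gE -!mulgA mulKg mulVg mulg1.
by rewrite scaleN1r opprB subrK.
Qed.

(** An element h of the centralizer changes the component by a coboundary; the
    class y depends only on the component up to coboundaries, so h y = y. *)
Lemma invariant_class W C : isalt n W -> kcobT n (fun s => W s - avgact W s) ->
  exists y : summand rho (rep C) (zdeg C), local_rel C (gcomp W (rep C)) (val y).
Proof.
move=> Wa Winv; have [[_ _ Rf Rt] Rc _ _ Re] := local_relP C; set g := rep C.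
have /gcomp_isalt/(_ g) ga := Wa; have [y0 y0E] := Rt _ ga.
suff yP : y0 \in @inv_pred k _ gT 'C[g]%g (@summand_act k V gT rho g (zdeg C)).
  by exists (exist (fun y => y \in inv_pred _ _) y0 yP).
apply/forall_inP => h hC; apply/eqP; apply: Rf (y0E).
apply: Rc (Re h _ _ hC ga.1 y0E).
have /gcomp_kcob/(_ g) := invariant_cob h Winv.
apply: kcob_ext => s; rewrite gcompB gcomp_diagact.
by have /cent1P gh := hC; have -> : (h^-1 * g * h)%g = g by rewrite -mulgA -gh mulKg.
Qed.

Lemma hochschild_smash :
  isomorphic (HH B n) (dsum (fun C => summand rho (rep C) (zdeg C))).
Proof.
have [b /(_ N) [res_of lift_of]] := koszul_comparison rho card_unit n.
set res := (fun c : stdres N n -> N => fun s => c (b (kgen _ n s)) : resk N) in res_of lift_of.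
apply: (@isomorphic_ext k (envalg B) N N n (dsum (fun C => summand rho (rep C) (zdeg C)))
  (fun c y => forall C, local_rel C (gcomp (res c) (rep C)) (val (y C)))).
- move=> c /res_of[ca _ ci _].
  have yP C := cid (invariant_class C ca ci).
  by exists (fun C => sval (yP C)) => C; apply: svalP (yP C).
- move=> y; have [W [Wa W0 WW Wy]] := invariant_lift y.
  have [c c0 cW] := lift_of W Wa W0 WW; exists c => // C.
  have [_ Rc _ _ _] := local_relP C; apply: Rc (Wy C).
  have /gcomp_kcob/(_ (rep C)) cWC := cW.
  have tb := diffop_bilin (rho (rep C)).
  apply: kcob_ext (kcobD tb (-1) cWC (kcob0 tb n)) => s.
  by rewrite gcompB addr0 scaleN1r opprB.
- move=> a c c' y y' cy cy' C; have [[_ RD _ _] _ _ _ _] := local_relP C.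
  have -> : gcomp (res (fun x => a *: (c x : resk N) + (c' x : resk N))) (rep C) =
     (fun s => a *: gcomp (res c) (rep C) s + gcomp (res c') (rep C) s).
    by apply/funext => s; rewrite -[RHS](gcomp_lin (rho := rho) (rep C)).
  exact: RD (cy C) (cy' C).
move=> c y /res_of[ca c0 ci ch] cy; apply: (iff_trans (iff_sym ch)).
have kR C : kcob (diffop (rho (rep C))) n (gcomp (res c) (rep C)) <-> val (y C) = 0.
  have [_ _ Ri _ _] := local_relP C; apply: Ri (cy C); first by have /gcomp_isalt := ca.
  by move=> s; rewrite -gcomp_koszul c0 ffunE.
split=> [/gcomp_kcob cc|y0].
  by apply: functional_extensionality_dep => C; apply/val_inj/kR.
by apply: kcob_reps ci _ => C; apply/kR; rewrite y0.
Qed.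

End Assembly.

Theorem theorem3p6 (k : fieldType) (V : vectType k) (gT : finGroupType)
    (rho : linrep V gT) (rho_faithful : injective rho)
    (card_unit : (#|gT|%:R : k) \is a GRing.unit)
    (root_of_unity : exists z : k, #|gT|.-primitive_root z)
    (rep : conj_class gT -> gT)
    (rep_in : forall C : conj_class gT, rep C \in val C)
    (n : nat) :
  isomorphic
    (HH (smash rho) n)
    (dsum (fun C : conj_class gT =>
       summand rho (rep C) (n%:Z - (mov_dim rho (rep C))%:Z))).
Proof. exact: hochschild_smash. Qed.
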